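(* Let $\boldsymbol\alpha=(\alpha_n)_{n\ge1}$ be a sequence compactly included in $\mathbb D$ (i.e. $\sup_n|\alpha_n|<1$) and let $\boldsymbol a=(a_n)_{n\ge1}$ be a sequence in $\mathbb D$. Then: 1. $\displaystyle\lim_na_n=0\ \Rightarrow\ \operatorname{supp}\mu(\boldsymbol a,\boldsymbol\alpha)=\mathbb T$. 2. $\displaystyle\lim_n|a_n|=1\ \Rightarrow\ \{\operatorname{supp}\mu(\boldsymbol a,\boldsymbol\alpha)\}'=\mathop{\mathrm{Lim}}_n\,\tilde\zeta_n(-\overline{a_n}\,a_{n+1})$. 3. $\displaystyle\limsup_n|a_n|=1\ \Rightarrow\ \mu(\boldsymbol a,\boldsymbol\alpha)$ is singular.
   Context: $\mathbb T$ is the unit circle, $\mathbb D$ the open unit disk. Measures on $\mathbb T$ are probability Borel measures with infinite support; singular means singular with respect to Lebesgue measure on $\mathbb T$ (no absolutely continuous part). $L^2_\mu$ carries the inner product $\langle f,g\rangle_\mu=\int\overline{f}\,g\,d\mu$. Let $\boldsymbol\alpha=(\alpha_n)_{n\ge1}$ be a sequence in $\mathbb D$ and set $\alpha_0=0$. For $n\ge0$ let $\varpi_n(z)=1-\overline{\alpha_n}z$, $\varpi_n^*(z)=z-\alpha_n$, $\zeta_n=\varpi_n^*/\varpi_n$, with inverse $\tilde\zeta_n(z)=\dfrac{z+\alpha_n}{1+\overline{\alpha_n}z}$. Let $B_0=1$, $B_n=\zeta_1\cdots\zeta_n$, and $f_*(z)=\overline{f(1/\overline z)}$. The orthogonal rational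 functions (ORF) $(\phi_n)_{n\ge0}$ of a measure $\mu$ associated with $\boldsymbol\alpha$ are the result of orthonormalizing $(B_n)_{n\ge0}$ in $L^2_\mu$, with unimodular factors chosen so that $\phi_0=1$ and, with $\phi_n^*=B_n\phi_{n*}$, $$\begin{pmatrix}\phi_n\\ \phi_n^*\end{pmatrix}=e_n\frac{\varpi_{n-1}}{\varpi_n}\begin{pmatrix}1&a_n\\ \overline{a_n}&1\end{pmatrix}\begin{pmatrix}\zeta_{n-1}\phi_{n-1}\\ \phi_{n-1}^*\end{pmatrix},\quad e_n=\sqrt{\frac{\varpi_n(\alpha_n)}{\varpi_{n-1}(\alpha_{n-1})}\frac1{1-|a_n|^2}},\quad n\ge1,$$ for some $a_n\in\mathbb D$; the sequence $\boldsymbol a=(a_n)_{n\ge1}$ is uniquely determined by $\mu$ and $\boldsymbol\alpha$, and one writes $\boldsymbol a=\mathcal S_{\boldsymbol\alpha}(\mu)$. When $\boldsymbol\alpha$ is compactly included in $\mathbb D$, $\mathcal S_{\boldsymbol\alpha}$ is a bijection between measures on $\mathbb T$ and sequences in $\mathbb D$, and $\mu(\boldsymbol a,\boldsymbol\alpha)$ denotes the unique measure $\mu$ with $\mathcal S_{\boldsymbol\alpha}(\mu)=\boldsymbol a$. $\{E\}'$ denotes the set of limit (accumulation) points of a set $E$, and $\mathrm{Lim}_n x_n$ the set of limit points of a sequence $(x_n)$ in $\mathbb C$, i.e. the set of limits of its convergent subsequences. *)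

(* Defs.v *)
From mathcomp Require Import all_boot all_order all_algebra.
From mathcomp Require Import complex.
From mathcomp Require Import all_classical all_reals all_analysis.

Set Implicit Arguments.
Unset Strict Implicit.
Unset Printing Implicit Defensive.

Import Order.TTheory GRing.Theory Num.Theory.
Import numFieldNormedType.Exports ComplexField.Normc.

Local Open Scope classical_set_scope.
Local Open Scope ring_scope.

(* [R[i]^o] is the alias of the complex field [R[i]] that carries the norm
   topology, and [borelC R] the one that carries its Borel sigma-algebra. *)
Definition borelC (R : realType) := g_sigma_algebraType (@open R[i]^o).

Definition unit_circle (R : realType) : set R[i] := [set z | `|z| = 1].

Definition supp (R : realType) (mu : set (borelC R) -> \bar R) : set R[i]^o :=
  [set z | forall U : set R[i]^o, open U -> U z -> (0 < mu U)%E].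

(* A measure on the circle is encoded as a Borel measure on the whole complex
   plane that is carried by the circle. *)
Definition circle_measure (R : realType) (mu : probability (borelC R) R) :=
  mu (@unit_circle R) = 1%E /\ infinite_set (supp mu).

(* Arc length, i.e. the image of Lebesgue measure on [0, 2 pi[ under
   t |-> exp (i t). *)
Definition circle_lebesgue (R : realType) (A : set (borelC R)) : \bar R :=
  lebesgue_measure
    [set t : R | 0 <= t < pi *+ 2 /\ A (Complex (cos t) (sin t))].

Definition singular (R : realType) (mu : probability (borelC R) R) :=
  exists N : set (borelC R),
    [/\ measurable N, mu N = 0%E & circle_lebesgue (~` N) = 0%E].

(* The inner product of L^2_mu, antilinear in its first argument. *)
Definition inner (R : realType) (mu : probability (borelC R) R)
    (f g : R[i] -> R[i]) : R[i] :=
  Complex (\int[mu]_(z in @unit_circle R) complex.Re ((f z)^* * g z))%R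
          (\int[mu]_(z in @unit_circle R) complex.Im ((f z)^* * g z))%R.

Section OrthogonalRationalFunctions.
Variable R : realType.
Implicit Types (alpha a : nat -> R[i]) (f : R[i] -> R[i]).

Definition varpi alpha (n : nat) (z : R[i]) : R[i] := 1 - (alpha n)^* * z.

Definition varpi_star alpha (n : nat) (z : R[i]) : R[i] := z - alpha n.

Definition zeta alpha (n : nat) (z : R[i]) : R[i] :=
  varpi_star alpha n z / varpi alpha n z.

Definition zeta_inv alpha (n : nat) (z : R[i]) : R[i] :=
  (z + alpha n) / (1 + (alpha n)^* * z).

Definition blaschke alpha (n : nat) (z : R[i]) : R[i] :=
  \prod_(1 <= k < n.+1) zeta alpha k z.

Definition substar f (z : R[i]) : R[i] := (f (1 / z^*))^*.

Definition superstar alpha (n : nat) f (z : R[i]) : R[i] :=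
  blaschke alpha n z * substar f z.

(* The argument of the square root is a positive real when alpha and a are in
   the open unit disk; [sqrtC] then returns the positive root. *)
Definition orf_e alpha a (n : nat) : R[i] :=
  sqrtC (varpi alpha n (alpha n) / varpi alpha n.-1 (alpha n.-1)
         * (1 / (1 - `|a n| ^+ 2))).

(* phi is obtained from (B_n)_n by orthonormalization in L^2_mu; this fixes
   each phi n up to a unimodular factor. *)
Definition orthonormalization alpha (mu : probability (borelC R) R)
    (phi : nat -> R[i] -> R[i]) :=
  (forall n, exists c : nat -> R[i], forall z,
     phi n z = \sum_(0 <= k < n.+1) c k * blaschke alpha k z) /\
  (forall m n, inner mu (phi m) (phi n) = (m == n)%:R).

(* The recurrence is an identity between rational functions. It is imposed on
   the unit circle, where no denominator vanishes; at the poles, the convention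
   0^-1 = 0 would give it a spurious meaning. *)
Definition orf_recurrence alpha a (phi : nat -> R[i] -> R[i]) :=
  forall n, (0 < n)%N -> forall z, unit_circle z ->
    phi n z =
      orf_e alpha a n * (varpi alpha n.-1 z / varpi alpha n z) *
      (zeta alpha n.-1 z * phi n.-1 z
       + a n * superstar alpha n.-1 (phi n.-1) z) /\
    superstar alpha n (phi n) z =
      orf_e alpha a n * (varpi alpha n.-1 z / varpi alpha n z) *
      ((a n)^* * (zeta alpha n.-1 z * phi n.-1 z)
       + superstar alpha n.-1 (phi n.-1) z).

(* The relation a = S_alpha(mu). Sequences indexed by n >= 1 are functions on
   nat; alpha 0 is meant to be 0, and a 0 is never used. *)
Definition orf_parameters alpha (mu : probability (borelC R) R) a :=
  (forall n, (0 < n)%N -> `|a n| < 1) /\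
  exists phi : nat -> R[i] -> R[i],
    [/\ orthonormalization alpha mu phi,
        forall z, phi 0%N z = 1
      & orf_recurrence alpha a phi].

Definition compactly_in_disk alpha :=
  exists2 r : R, r < 1 & forall n, (0 < n)%N -> normc (alpha n) <= r.

End OrthogonalRationalFunctions.

Definition seq_limit_points (T : topologicalType) (x : nat -> T) : set T :=
  [set l | exists s : nat -> nat,
     {homo s : m n / (m < n)%N} /\ x (s n) @[n --> \oo] --> l].

(* Main.v *)
(* Write psi_n for phi_n multiplied by varpi_n / s_n. On the circle, psi_n and
   psi_n^* have the same modulus and satisfy a Szego recurrence in which zeta_n
   replaces z, whence
     (zeta_n - lam_n) psi_n = rho_(n+1) psi_(n+1) - a_(n+1) rho_n psi_(n-1)^*,
   lam_n = - conj(a_n) a_(n+1), rho_n^2 = 1 - |a_n|^2.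

   If a_n tends to 0, then psi_(n+1) is close to zeta_n psi_n, which provides
   approximate eigenvectors of the multiplication by z for every point of the
   circle. If |a_n| tends to 1, the phi_n themselves are approximate eigenvectors
   with eigenvalues zeta_n^-1(lam_n), and the multiplication by z is diagonal in
   the basis (phi_n) up to an operator which is small on the tail; so the limit
   points of these eigenvalues are the non-isolated points of the support.

   If |a_n| is close to 1, let tau = a_n / |a_n|. The function
   h = zeta_(n-1) psi_(n-1) + tau psi_(n-1)^* is small in L^2(mu), whereas
   |h| = |psi_(n-1)| |tau + b| with b = zeta_(n-1) psi_(n-1) / psi_(n-1)^* inner.
   As |psi_(n-1)|^-2 has mean 1 for arc length, and the image of arc length under
   b is a Poisson kernel at a point of modulus at most sup |alpha_n|, |h| is
   small on a set of small arc length only. *)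
From HB Require Import structures.
Require Import Defs.
From mathcomp Require Import all_boot all_order all_algebra.
From mathcomp Require Import complex.
From mathcomp Require Import all_classical all_reals all_analysis.
From mathcomp Require Import measurable_realfun ring lra.
Set Implicit Arguments.
Unset Strict Implicit.
Unset Printing Implicit Defensive.
Import Order.TTheory GRing.Theory Num.Theory.
Import numFieldNormedType.Exports ComplexField.Normc.
Local Open Scope classical_set_scope.
Local Open Scope ring_scope.

(** * Measurability and integration on the circle *)

(** All operator statements take the form of estimates of [nsq], the squared L^2 norm, for finite
    combinations of the phi_n. In the second claim, multiplication by z is nearly diagonal on a tail
    of (phi_n) only. A test function that shows a limit point l of the support to be a limit of
    eigenvalues must therefore be orthogonal to the first n functions, lie in a finite span and
    concentrate near l. It is an interpolating combination times K peak factors. The orthogonality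
    conditions depend on K, so nothing is known of the combination beyond its largest coefficient.
    The interpolation nodes, discs around them and a common lower bound for the masses of these
    discs are thus fixed before K, and two powers with exponent K are compared at the end. In the
    third claim, holomorphy must be expressed on the circle, since rational functions take
    conventional values at their poles. Uniform limits of polynomials on the circle stand for
    functions holomorphic in the disk, and their mean for the value at 0. *)

Section ComplexPlane.
Variable R : realType.
Implicit Types (z w : R[i]) (U : set R[i]^o).

Lemma normcE z : `|z| = (normc z)%:C%C.
Proof. by case: z. Qed.

Lemma sqr_normcE z : normc z ^+ 2 = complex.Re z ^+ 2 + complex.Im z ^+ 2.
Proof. by case: z => a b /=; rewrite sqr_sqrtr// addr_ge0 ?sqr_ge0. Qed.

Lemma normc_ge0 z : 0 <= normc z.
Proof. by case: z => a b /=; rewrite sqrtr_ge0. Qed.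

Lemma normcJ z : normc z^* = normc z.
Proof. by case: z => a b /=; rewrite sqrrN. Qed.

Lemma normc_subC z w : normc (z - w) = normc (w - z).
Proof. by rewrite -[LHS](@normcN R) opprB. Qed.

Lemma mulcJ z : z * z^* = (normc z ^+ 2)%:C%C.
Proof. by rewrite -[z * z^*]normCK normcE rmorphXn. Qed.

Lemma normc_real (x : R) : normc x%:C%C = `|x|.
Proof. by rewrite /= expr0n addr0 sqrtr_sqr. Qed.

Lemma normr_Re_le z : `|complex.Re z| <= normc z.
Proof.
rewrite -(@ler_pXn2r _ 2) ?nnegrE ?normc_ge0// real_normK ?num_real//.
by rewrite sqr_normcE lerDl sqr_ge0.
Qed.

Lemma normr_Im_le z : `|complex.Im z| <= normc z.
Proof.
rewrite -(@ler_pXn2r _ 2) ?nnegrE ?normc_ge0// real_normK ?num_real//.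
by rewrite sqr_normcE lerDr sqr_ge0.
Qed.

Lemma normc_le_ReIm z : normc z <= `|complex.Re z| + `|complex.Im z|.
Proof.
rewrite -(@ler_pXn2r _ 2) ?nnegrE ?normc_ge0 ?addr_ge0//.
rewrite sqr_normcE sqrrD !real_normK ?num_real//.
by rewrite lerD2r lerDl mulrn_wge0// mulr_ge0.
Qed.

Lemma normc_eq0 z : (normc z == 0) = (z == 0).
Proof.
by apply/eqP/eqP => [/eq0_normc //|->]; rewrite normc0.
Qed.

Lemma normc_gt0 z : (0 < normc z) = (z != 0).
Proof. by rewrite lt_def normc_ge0 andbT normc_eq0. Qed.

Lemma sqr_normcD z w : normc (z + w) ^+ 2 <= 2 * normc z ^+ 2 + 2 * normc w ^+ 2.
Proof.
rewrite !sqr_normcE; case: z => a b; case: w => c d /=.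
have := sqr_ge0 (a - c); have := sqr_ge0 (b - d); nra.
Qed.

Lemma unit_circleE z : unit_circle z <-> normc z = 1.
Proof.
rewrite /unit_circle /= normcE; split=> [/(congr1 (@complex.Re R))//|->//].
Qed.

Lemma unit_circleV z : unit_circle z -> z^-1 = z^*.
Proof.
move=> /unit_circleE z1; have z0 : z != 0 by rewrite -normc_eq0 z1 oner_eq0.
by apply: (mulfI z0); rewrite mulcJ z1 expr1n mulfV.
Qed.

(** Balls of [R[i]^o] have radii in [R[i]], but a positive complex number is real, so real radii
    suffice. *)
Lemma nbhsCP z U :
  nbhs (z : R[i]^o) U <-> exists2 e : R, 0 < e & forall w, normc (z - w) < e -> U w.
Proof.
split=> [/nbhs_ballP[e /= e0 eU]|[e e0 eU]].
  have eR : (complex.Re e)%:C%C = e.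
    by move: e0; rewrite ltcE /= => /andP[/eqP e0 _]; case: e e0 {eU} => a b /= ->.
  exists (complex.Re e) => [|w zw].
    by move: e0; rewrite ltcE => /andP[].
  by apply: eU; rewrite -ball_normE /ball_ /= normcE -eR ltcR.
apply/nbhs_ballP; exists e%:C%C => /=; first by rewrite ltcR.
by move=> w; rewrite -ball_normE /ball_ /= normcE ltcR; exact: eU.
Qed.

Lemma openCP U : open U <->
  forall z, U z -> exists2 e : R, 0 < e & forall w, normc (z - w) < e -> U w.
Proof.
rewrite openE; split=> UU z /UU; first by move=> /nbhsCP.
by move=> ?; apply/nbhsCP.
Qed.

Lemma open_disc z (e : R) : open ([set w | normc (z - w) < e] : set R[i]^o).
Proof.
apply/openCP => w /= zw; exists (e - normc (z - w)) => [|v wv]; first by rewrite subr_gt0.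
rewrite (_ : z - v = (z - w) + (w - v)); last by ring.
by rewrite (le_lt_trans (le_normcD _ _))// -ltrBrDl.
Qed.

Lemma cvgCP (u : nat -> R[i]) l : ((u n : R[i]^o) @[n --> \oo] --> (l : R[i]^o)) <->
  forall e : R, 0 < e -> \forall n \near \oo, normc (l - u n) < e.
Proof.
split=> [ul e e0|ul].
  by apply: (ul [set w | normc (l - w) < e]); apply/nbhsCP; exists e.
move=> A /nbhsCP[e e0 eA]; rewrite /nbhs /=.
by have := ul _ e0; apply: filterS => n; exact: eA.
Qed.

End ComplexPlane.

Section Measurability.
Variable R : realType.
Local Notation C := (borelC R).
Implicit Types (f g : R[i] -> R[i]).

Lemma measurable_openC (U : set R[i]^o) : open U -> measurable (U : set C).
Proof. by move=> oU; apply: sub_sigma_algebra. Qed.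

Lemma lipschitz_borelC_measurable (F : R[i] -> R) :
  (forall z w, `|F z - F w| <= normc (z - w)) ->
  measurable_fun [set: C] (F : C -> R).
Proof.
move=> lF; apply: (measurability _ (measurable_realfun.RGenOpens.measurableE R)).
move=> _ [_ [a [b ->] <-]]; rewrite setTI.
apply: measurable_openC; apply/openCP => z /=.
rewrite in_itv /= => /andP[az zb].
exists (Num.min (F z - a) (b - F z)) => [|w]; first by rewrite lt_min !subr_gt0 az.
rewrite lt_min => /andP[zwa zwb]; have := lF z w; rewrite ler_norml => /andP[h1 h2].
by rewrite in_itv /=; apply/andP; split; lra.
Qed.

Lemma measurable_Re : measurable_fun [set: C] (fun z : C => complex.Re (z : R[i])).
Proof.
by apply: lipschitz_borelC_measurable => z w; rewrite -raddfB normr_Re_le.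
Qed.

Lemma measurable_Im : measurable_fun [set: C] (fun z : C => complex.Im (z : R[i])).
Proof.
by apply: lipschitz_borelC_measurable => z w; rewrite -raddfB normr_Im_le.
Qed.

Lemma measurable_invr : measurable_fun [set: R] (fun x : R => x^-1).
Proof.
have mN : measurable [set x : R | x != 0].
  by rewrite (_ : mkset _ = ~` [set 0]);
    [exact: measurableC|apply/seteqP; split=> x /= /eqP].
rewrite (_ : setT = [set x : R | x != 0] `|` [set 0]); last first.
  apply/seteqP; split=> // x _ /=.
  by have [->|] := eqVneq x 0; [right|left].
apply/measurable_funU => //; split.
  apply: open_continuous_measurable_fun.
    exact: open_neq.
  by move=> x; rewrite inE /= => x0; exact: inv_continuous.
exact: measurable_fun_set1.
Qed.

(** Componentwise, to match [inner], which integrates real and imaginary parts separately. *)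
Definition cmeasurable f :=
  measurable_fun [set: C] (fun z : C => complex.Re (f z)) /\
  measurable_fun [set: C] (fun z : C => complex.Im (f z)).

Lemma cmeasurable_id : cmeasurable id.
Proof. by split; [exact: measurable_Re|exact: measurable_Im]. Qed.

Lemma cmeasurable_cst c : cmeasurable (fun=> c).
Proof. by split; exact: measurable_cst. Qed.

Lemma cmeasurableD f g : cmeasurable f -> cmeasurable g ->
  cmeasurable (fun z => f z + g z).
Proof.
move=> [mf1 mf2] [mg1 mg2]; split.
  by apply: eq_measurable_fun (measurable_funD mf1 mg1) => z _; rewrite /= raddfD.
by apply: eq_measurable_fun (measurable_funD mf2 mg2) => z _; rewrite /= raddfD.
Qed.

Lemma cmeasurableM f g : cmeasurable f -> cmeasurable g ->
  cmeasurable (fun z => f z * g z).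
Proof.
move=> [mf1 mf2] [mg1 mg2]; split.
  apply: eq_measurable_fun
    (measurable_funB (measurable_funM mf1 mg1) (measurable_funM mf2 mg2)) => z _ /=.
  by case: (f z) (g z) => ? ? [].
apply: eq_measurable_fun
    (measurable_funD (measurable_funM mf1 mg2) (measurable_funM mf2 mg1)) => z _ /=.
by case: (f z) (g z) => ? ? [].
Qed.

Lemma cmeasurableJ f : cmeasurable f -> cmeasurable (fun z => (f z)^*).
Proof.
move=> [mf1 mf2]; split.
  by apply: eq_measurable_fun mf1 => z _; case: (f z).
by apply: eq_measurable_fun (measurable_funN mf2) => z _ /=; case: (f z).
Qed.

Lemma measurable_sqr_normc f : cmeasurable f ->
  measurable_fun [set: C] (fun z : C => normc (f z) ^+ 2).
Proof.
move=> [mf1 mf2].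
apply: eq_measurable_fun
  (measurable_funD (measurable_funM mf1 mf1) (measurable_funM mf2 mf2)) => z _ /=.
by rewrite sqr_normcE !expr2.
Qed.

Lemma cmeasurableV f : cmeasurable f -> cmeasurable (fun z => (f z)^-1).
Proof.
move=> mf.
have mV : cmeasurable (fun z => ((normc (f z) ^+ 2)^-1)%:C%C).
  split; last exact: measurable_cst.
  exact: (measurableT_comp measurable_invr (measurable_sqr_normc mf)).
have [m1 m2] := cmeasurableM mV (cmeasurableJ mf).
(* This also holds at the zeros of [f], where the convention for 0^-1 makes both sides 0. *)
have fE z : ((normc (f z) ^+ 2)^-1)%:C%C * (f z)^* = (f z)^-1.
  have [->|f0] := eqVneq (f z) 0; first by rewrite conjC0 mulr0 invr0.
  have nf0 : normc (f z) ^+ 2 != 0 by rewrite expf_eq0 normc_eq0.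
  apply: (mulfI f0); rewrite mulfV// mulrCA mulcJ -rmorphM/= mulVf//.
by split; [apply: eq_measurable_fun m1|apply: eq_measurable_fun m2] => z _; rewrite fE.
Qed.

End Measurability.

Section CircleIntegral.
Variable R : realType.
Local Notation C := (borelC R).
Local Notation T := (@unit_circle R).
Implicit Types (f g : R[i] -> R[i]) (F G : R[i] -> R).

Lemma measurable_unit_circle : measurable (T : set C).
Proof.
rewrite (_ : T = (fun z : C => normc (z : R[i]) ^+ 2) @^-1` [set 1]); last first.
  apply/seteqP; split=> z; first by move=> /unit_circleE /= ->; rewrite expr1n.
  move=> /= z1; apply/unit_circleE; apply/eqP.
  by rewrite -(@eqrXn2 _ 2) ?normc_ge0// z1 expr1n.
rewrite -[X in measurable X]setTI; apply: measurable_sqr_normc => //.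
exact: cmeasurable_id.
Qed.
Local Notation mT := measurable_unit_circle.

(* The bound is only required on the circle, off which the rational functions
   at hand may have poles. *)
Definition rnice F := measurable_fun [set: C] (F : C -> R) /\
  exists M : R, forall z, T z -> `|F z| <= M.

Definition cnice f := cmeasurable f /\
  exists M : R, forall z, T z -> normc (f z) <= M.

Lemma rnice_cst (c : R) : rnice (fun=> c).
Proof. by split; [exact: measurable_cst|exists `|c|]. Qed.

Lemma rniceD F G : rnice F -> rnice G -> rnice (fun z => F z + G z).
Proof.
move=> [mF [M FM]] [mG [N GN]]; split; first exact: measurable_funD.
exists (M + N) => z Tz; rewrite (le_trans (ler_normD _ _))//.
by rewrite lerD ?FM ?GN.
Qed.

Lemma rniceM F G : rnice F -> rnice G -> rnice (fun z => F z * G z).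
Proof.
move=> [mF [M FM]] [mG [N GN]]; split; first exact: measurable_funM.
by exists (M * N) => z Tz; rewrite normrM ler_pM ?FM ?GN.
Qed.

Lemma rnice_sum n (F : nat -> R[i] -> R) : (forall k, rnice (F k)) ->
  rnice (fun z => \sum_(k < n) F k z).
Proof.
move=> nF; elim: n => [|n IH].
  by under eq_fun do rewrite big_ord0; exact: rnice_cst.
by under eq_fun do rewrite big_ord_recr /=; exact: rniceD.
Qed.

Lemma cnice_Re f : cnice f -> rnice (fun z => complex.Re (f z)).
Proof.
move=> [[mf _] [M fM]]; split=> //; exists M => z Tz.
by rewrite (le_trans (normr_Re_le _)) ?fM.
Qed.

Lemma cnice_Im f : cnice f -> rnice (fun z => complex.Im (f z)).
Proof.
move=> [[_ mf] [M fM]]; split=> //; exists M => z Tz.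
by rewrite (le_trans (normr_Im_le _)) ?fM.
Qed.

Lemma cnice_sqr f : cnice f -> rnice (fun z => normc (f z) ^+ 2).
Proof.
move=> [mf [M fM]]; split; first exact: measurable_sqr_normc.
exists (M ^+ 2) => z Tz; rewrite normrX ler_pXn2r ?nnegrE//.
  by rewrite ger0_norm ?normc_ge0// fM.
by rewrite (le_trans (normc_ge0 (f z))) ?fM.
Qed.

Lemma cnice_id : cnice id.
Proof. by split; [exact: cmeasurable_id|exists 1 => z /unit_circleE ->]. Qed.

Lemma cnice_cst c : cnice (fun=> c).
Proof. by split; [exact: cmeasurable_cst|exists (normc c)]. Qed.

Lemma cniceD f g : cnice f -> cnice g -> cnice (fun z => f z + g z).
Proof.
move=> [mf [M fM]] [mg [N gN]]; split; first exact: cmeasurableD.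
exists (M + N) => z Tz; rewrite (le_trans (le_normcD _ _))//.
by rewrite lerD ?fM ?gN.
Qed.

Lemma cniceM f g : cnice f -> cnice g -> cnice (fun z => f z * g z).
Proof.
move=> [mf [M fM]] [mg [N gN]]; split; first exact: cmeasurableM.
by exists (M * N) => z Tz; rewrite normcM ler_pM ?normc_ge0 ?fM ?gN.
Qed.

Lemma cniceZ c f : cnice f -> cnice (fun z => c * f z).
Proof. by apply: cniceM; exact: cnice_cst. Qed.

Lemma cniceN f : cnice f -> cnice (fun z => - f z).
Proof.
by move=> nf; under eq_fun do rewrite -mulN1r; exact: cniceZ.
Qed.

Lemma cniceB f g : cnice f -> cnice g -> cnice (fun z => f z - g z).
Proof. by move=> nf ng; apply: cniceD => //; exact: cniceN. Qed.

Lemma cniceJ f : cnice f -> cnice (fun z => (f z)^*).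
Proof.
move=> [mf [M fM]]; split; first exact: cmeasurableJ.
by exists M => z Tz; rewrite normcJ fM.
Qed.

Lemma cniceV f (d : R) : 0 < d -> (forall z, T z -> d <= normc (f z)) ->
  cnice f -> cnice (fun z => (f z)^-1).
Proof.
move=> d0 fd [mf _]; split; first exact: cmeasurableV.
exists d^-1 => z Tz; have dz := fd _ Tz.
by rewrite normcV lef_pV2 ?posrE// (lt_le_trans d0).
Qed.

Lemma cnice_sum n (f : nat -> R[i] -> R[i]) : (forall k, cnice (f k)) ->
  cnice (fun z => \sum_(k < n) f k z).
Proof.
move=> nf; elim: n => [|n IH].
  by under eq_fun do rewrite big_ord0; exact: cnice_cst.
by under eq_fun do rewrite big_ord_recr /=; exact: cniceD.
Qed.

Variable m : {measure set C -> \bar R}.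
Hypothesis mTfin : (m T < +oo)%E.

(** The measure is only assumed finite on the circle, so that the same calculus serves both for mu
    and for arc length. *)
Definition RI F : R := (\int[m]_(z in (T : set C)) F z)%R.

Lemma rnice_integrable F : rnice F -> m.-integrable (T : set C) (EFin \o F).
Proof.
move=> [mF [M FM]]; apply: measurable_bounded_integrable => //.
- exact: mT.
- exact: measurable_funS mF.
- by exists M; split; [exact: num_real|move=> N MN z Tz; apply: (le_trans (FM _ Tz)); exact: ltW].
Qed.

Lemma eq_RI F G : (forall z, T z -> F z = G z) -> RI F = RI G.
Proof. by move=> FG; apply: eq_Rintegral => z; rewrite inE => /FG. Qed.

Lemma RID F G : rnice F -> rnice G -> RI (fun z => F z + G z) = RI F + RI G.
Proof.
by move=> nF nG; rewrite /RI RintegralD//; [exact: mT|exact: rnice_integrable..].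
Qed.

Lemma RIZ (c : R) F : rnice F -> RI (fun z => c * F z) = c * RI F.
Proof.
by move=> nF; rewrite /RI RintegralZl//; [exact: mT|exact: rnice_integrable].
Qed.

Lemma RI_cst (c : R) : RI (fun=> c) = c * fine (m T).
Proof. by rewrite /RI Rintegral_cst//; exact: mT. Qed.

Lemma RI_ge0 F : (forall z, T z -> 0 <= F z) -> 0 <= RI F.
Proof. by move=> F0; rewrite /RI; apply: Rintegral_ge0. Qed.

Lemma le_RI F G : rnice F -> rnice G -> (forall z, T z -> F z <= G z) -> RI F <= RI G.
Proof.
by move=> nF nG FG; apply: le_Rintegral => //; [exact: mT|exact: rnice_integrable..].
Qed.

Lemma le_RI_ae F G (N : set C) : measurable N -> m N = 0%E ->
  rnice F -> rnice G -> (forall z, T z -> ~ N z -> F z <= G z) -> RI F <= RI G.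
Proof.
move=> mN N0 nF nG FG; rewrite /RI /Rintegral.
rewrite (negligible_integral mN mT (rnice_integrable nF) N0).
rewrite (negligible_integral mN mT (rnice_integrable nG) N0).
have mD : measurable (T `\` N : set C).
  apply: measurableD; first exact: mT. exact: mN.
have iD H : rnice H -> m.-integrable (T `\` N : set C) (EFin \o H).
  by move=> nH; apply: (integrableS mT mD _ (rnice_integrable nH)) => z [].
by apply: le_Rintegral => //; [exact: iD..|move=> z [Tz Nz]; apply: FG].
Qed.

Lemma RI_markov (c : R) F (A : set C) : measurable A -> 0 <= c -> rnice F ->
  (forall z, T z -> 0 <= F z) -> (forall z, T z -> A z -> c <= F z) ->
  (c%:E * m (A `&` T) <= (RI F)%:E)%E.
Proof.
move=> mA c0 nF F0 Fc.
have mAT : measurable (A `&` T : set C) by exact: (measurableI _ _ mA mT).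
rewrite /RI /Rintegral fineK; last first.
  by apply: integrable_fin_num; [exact: mT|exact: rnice_integrable].
rewrite -integral_cst//.
have mF D : measurable_fun D (EFin \o F : C -> _).
  by apply/measurable_EFinP; apply: measurable_funS nF.1.
apply: (@le_trans _ _ (\int[m]_(z in A `&` T) (F z)%:E)%E).
  apply: ge0_le_integral => //.
  by move=> z [Az Tz]; rewrite lee_fin; exact: Fc.
by apply: ge0_subset_integral => //; exact: mT.
Qed.

Lemma RI_sum n (F : nat -> R[i] -> R) : (forall k, rnice (F k)) ->
  RI (fun z => \sum_(k < n) F k z) = \sum_(k < n) RI (F k).
Proof.
move=> nF; elim: n => [|n IH].
  by under eq_fun do rewrite big_ord0; rewrite RI_cst mul0r big_ord0.
under eq_fun do rewrite big_ord_recr /=.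
by rewrite RID//; [rewrite IH big_ord_recr|exact: rnice_sum].
Qed.

Definition cint f : R[i] :=
  Complex (RI (fun z => complex.Re (f z))) (RI (fun z => complex.Im (f z))).

Lemma eq_cint f g : (forall z, T z -> f z = g z) -> cint f = cint g.
Proof. by move=> fg; congr Complex; apply: eq_RI => z /fg ->. Qed.

Lemma cintD f g : cnice f -> cnice g -> cint (fun z => f z + g z) = cint f + cint g.
Proof.
move=> nf ng; rewrite /cint; apply/eqP; rewrite eq_complex /=.
under eq_RI do rewrite raddfD; rewrite RID ?eqxx /=; [|exact: cnice_Re..].
by under eq_RI do rewrite raddfD; rewrite RID ?eqxx /=; [|exact: cnice_Im..].
Qed.

Lemma cintZ c f : cnice f -> cint (fun z => c * f z) = c * cint f.
Proof.
case: c => a b nf; rewrite /cint; apply/eqP; rewrite eq_complex /=.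
have [n1 n2] := (cnice_Re nf, cnice_Im nf).
have nc (x : R) F : rnice F -> rnice (fun z => x * F z).
  by apply: rniceM; exact: rnice_cst.
rewrite (@eq_RI _ (fun z => a * complex.Re (f z) + - b * complex.Im (f z))); last first.
  by move=> z _; case: (f z) => x y /=; rewrite mulNr.
rewrite RID; [|exact: nc..]; rewrite !RIZ// mulNr eqxx /=.
rewrite (@eq_RI _ (fun z => a * complex.Im (f z) + b * complex.Re (f z))); last first.
  by move=> z _; case: (f z) => x y.
by rewrite RID; [|exact: nc..]; rewrite !RIZ// eqxx.
Qed.

Lemma cint_sum n (f : nat -> R[i] -> R[i]) : (forall k, cnice (f k)) ->
  cint (fun z => \sum_(k < n) f k z) = \sum_(k < n) cint (f k).
Proof.
move=> nf; elim: n => [|n IH].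
  rewrite big_ord0 -[RHS](mul0r (cint (fun=> 1))) -cintZ; last exact: cnice_cst.
  by apply: eq_cint => z _; rewrite big_ord0 mul0r.
under eq_fun do rewrite big_ord_recr /=.
by rewrite cintD//; [rewrite IH big_ord_recr|exact: cnice_sum].
Qed.

Lemma cintJ f : cnice f -> cint (fun z => (f z)^*) = (cint f)^*.
Proof.
move=> nf; rewrite /cint; apply/eqP; rewrite eq_complex /=; apply/andP; split; apply/eqP.
  by apply: eq_RI => z _; case: (f z).
rewrite -mulN1r -RIZ; last exact: cnice_Im.
by apply: eq_RI => z _; rewrite mulN1r; case: (f z).
Qed.

(** The squared norm of L^2(m). *)
Definition nsq f : R := RI (fun z => normc (f z) ^+ 2).

Lemma nsq_ge0 f : 0 <= nsq f.
Proof. by apply: RI_ge0 => z _; rewrite exprn_ge0// normc_ge0. Qed.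

Lemma eq_nsq f g : (forall z, T z -> f z = g z) -> nsq f = nsq g.
Proof. by move=> fg; apply: eq_RI => z /fg ->. Qed.

Lemma nsqE f : cnice f -> cint (fun z => (f z)^* * f z) = (nsq f)%:C%C.
Proof.
move=> nf; rewrite /cint /nsq; apply/eqP; rewrite eq_complex /=; apply/andP; split; apply/eqP.
  by apply: eq_RI => z _; rewrite mulrC mulcJ.
rewrite -(mul0r (RI (fun=> 0))) -RIZ; last exact: rnice_cst.
by apply: eq_RI => z _; rewrite mulrC mulcJ mul0r.
Qed.

Lemma le_nsq (c : R) f g : cnice f -> cnice g ->
  (forall z, T z -> normc (f z) <= c * normc (g z)) -> nsq f <= c ^+ 2 * nsq g.
Proof.
move=> nf ng fg; rewrite /nsq -RIZ; last exact: cnice_sqr.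
apply: le_RI => [||z /fg le_fg]; first exact: cnice_sqr.
  by apply: rniceM; [exact: rnice_cst|exact: cnice_sqr].
by rewrite -exprMn ler_pXn2r ?nnegrE ?normc_ge0// (le_trans (normc_ge0 _) le_fg).
Qed.

Lemma nsqZ c f : cnice f -> nsq (fun z => c * f z) = normc c ^+ 2 * nsq f.
Proof.
move=> nf; rewrite /nsq -RIZ; last exact: cnice_sqr.
by apply: eq_RI => z _; rewrite normcM exprMn.
Qed.

Lemma nsqD f g : cnice f -> cnice g ->
  nsq (fun z => f z + g z) <= 2 * nsq f + 2 * nsq g.
Proof.
move=> nf ng; have [n1 n2] := (cnice_sqr nf, cnice_sqr ng).
rewrite /nsq -!RIZ// -RID; [|by apply: rniceM => //; exact: rnice_cst..].
apply: le_RI => [||z _]; first by apply: cnice_sqr; exact: cniceD.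
  by apply: rniceD; apply: rniceM => //; exact: rnice_cst.
exact: sqr_normcD.
Qed.

Lemma sqr_normc_sum n (x : nat -> R[i]) :
  normc (\sum_(k < n) x k) ^+ 2 <= n%:R * \sum_(k < n) normc (x k) ^+ 2.
Proof.
have le_sum : normc (\sum_(k < n) x k) <= \sum_(k < n) normc (x k).
  elim: n => [|n IH]; first by rewrite !big_ord0 normc0.
  by rewrite !big_ord_recr /= (le_trans (le_normcD _ _))// lerD2r.
apply: (@le_trans _ _ ((\sum_(k < n) normc (x k)) ^+ 2)).
  by rewrite ler_pXn2r ?nnegrE ?normc_ge0//; apply: sumr_ge0 => ? _; exact: normc_ge0.
elim: n {le_sum} => [|[|n] IH]; first by rewrite !big_ord0 mul0r expr0n.
  by rewrite !big_ord_recr !big_ord0 /= !add0r mul1r.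
rewrite big_ord_recr [in leRHS]big_ord_recr /= -(natr1 n.+1).
set S := \sum_(i < n.+1) normc (x i) in IH *; set Q := \sum_(i < n.+1) _ in IH *.
set y := normc (x n.+1); have : 0 < n.+1%:R :> R by rewrite ltr0n.
move: n.+1%:R IH => N IH N0; rewrite -(ler_pM2l N0).
(* N (N + 1) (Q + y^2) - N (S + y)^2 = (N + 1) (N Q - S^2) + (S - N y)^2. *)
have := sqr_ge0 (S - N * y); have := mulr_ge0 (ltW N0) (_ : 0 <= N * Q - S ^+ 2).
by rewrite subr_ge0 => /(_ IH); nra.
Qed.

End CircleIntegral.

(** * The recurrence in normalized form *)

Section BlaschkeFactors.
Variables (R : realType) (alpha : nat -> R[i]) (r : R).
Hypotheses (r_ge0 : 0 <= r) (r_lt1 : r < 1) (alpha_le : forall n, normc (alpha n) <= r).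
Local Notation T := (@unit_circle R).
Implicit Types (z w : R[i]).

Definition sal n : R := Num.sqrt (1 - normc (alpha n) ^+ 2).

Lemma sal_sqr n : sal n ^+ 2 = 1 - normc (alpha n) ^+ 2.
Proof.
rewrite sqr_sqrtr// subr_ge0 expr_le1 ?normc_ge0//.
by rewrite (le_trans (alpha_le n)) ?ltW.
Qed.

Lemma sal_sqr_ge n : 1 - r ^+ 2 <= sal n ^+ 2.
Proof. by rewrite sal_sqr lerD2l lerN2 ler_pXn2r ?nnegrE ?normc_ge0. Qed.

Lemma sal_sqr_le n : sal n ^+ 2 <= 1.
Proof. by rewrite sal_sqr gerBl exprn_ge0// normc_ge0. Qed.

Lemma r2_lt1 : 0 < 1 - r ^+ 2.
Proof. by rewrite subr_gt0 expr_lt1. Qed.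

Lemma sal_gt0 n : 0 < sal n.
Proof.
by rewrite sqrtr_gt0 -sal_sqr (lt_le_trans r2_lt1)// sal_sqr_ge.
Qed.

Lemma salC_neq0 n : (sal n)%:C%C != 0.
Proof. by rewrite -normc_eq0 normc_real normr_eq0 gt_eqF ?sal_gt0. Qed.

Lemma salC_sqr n : (sal n)%:C%C ^+ 2 = 1 - (alpha n)^* * alpha n.
Proof. by rewrite mulrC mulcJ -rmorphXn /= sal_sqr rmorphB rmorph1. Qed.

Lemma varpi_alpha n : varpi alpha n (alpha n) = (sal n)%:C%C ^+ 2.
Proof. by rewrite salC_sqr. Qed.

Lemma normc_varpi_ge n z : normc z <= 1 -> 1 - r <= normc (varpi alpha n z).
Proof.
move=> z1; have : normc (1 : R[i]) <= normc (varpi alpha n z) + normc ((alpha n)^* * z).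
  by rewrite (le_trans _ (le_normcD _ _))// subrK.
rewrite normc1 normcM normcJ => h; rewrite lerBlDr (le_trans h)// lerD2l.
by rewrite -[leRHS]mulr1 ler_pM ?normc_ge0.
Qed.

Lemma normc_varpi_le n z : normc z <= 1 -> normc (varpi alpha n z) <= 1 + r.
Proof.
move=> z1; rewrite (le_trans (le_normcD _ _))// normcN normc1 normcM normcJ lerD2l.
by rewrite -[leRHS]mulr1 ler_pM ?normc_ge0.
Qed.

Lemma varpi_neq0 n z : normc z <= 1 -> varpi alpha n z != 0.
Proof.
by move=> z1; rewrite -normc_gt0 (lt_le_trans _ (normc_varpi_ge n z1))// subr_gt0.
Qed.

Lemma T_le1 z : T z -> normc z <= 1.
Proof. by move=> /unit_circleE ->. Qed.

Lemma mulcJ_T z : T z -> z * z^* = 1.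
Proof. by move=> /unit_circleE z1; rewrite mulcJ z1 expr1n. Qed.

Lemma varpi_starE n z : T z -> varpi_star alpha n z = z * (varpi alpha n z)^*.
Proof.
move=> /mulcJ_T zz; rewrite /varpi_star /varpi rmorphB rmorph1 rmorphM /= conjCK.
by rewrite mulrBr mulr1 mulrCA zz mulr1.
Qed.

Lemma normc_zeta n z : T z -> normc (zeta alpha n z) = 1.
Proof.
move=> Tz; rewrite /zeta normcM normcV varpi_starE// normcM normcJ.
by move/unit_circleE : (Tz) => ->; rewrite mul1r divff// normc_eq0 varpi_neq0// T_le1.
Qed.

Lemma T_zeta n z : T z -> T (zeta alpha n z).
Proof. by move=> Tz; apply/unit_circleE; exact: normc_zeta. Qed.

Lemma zetaB n z w : normc z <= 1 -> normc w <= 1 ->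
  zeta alpha n z - zeta alpha n w =
  (z - w) * ((sal n)%:C%C ^+ 2 / (varpi alpha n z * varpi alpha n w)).
Proof.
move=> /(varpi_neq0 n); rewrite /zeta /varpi_star salC_sqr /varpi => z1.
by move=> /(varpi_neq0 n); rewrite /varpi => w1; field; rewrite z1 w1.
Qed.

(** On the closed disk |varpi_n| lies between 1 - r and 1 + r, so the zeta_n are bi-Lipschitz with
    constants independent of n. This uniformity lets products of many zeta_n act as peak
    functions. *)
Lemma normc_zetaB_le n z w : normc z <= 1 -> normc w <= 1 ->
  normc (zeta alpha n z - zeta alpha n w) <= normc (z - w) / (1 - r) ^+ 2.
Proof.
move=> z1 w1; rewrite zetaB// normcM ler_wpM2l ?normc_ge0//.
have r1 : 0 < 1 - r by rewrite subr_gt0.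
rewrite normcM normcV -rmorphXn normc_real ger0_norm ?sqr_ge0// normcM.
rewrite ler_pdivrMr; last by rewrite mulr_gt0// normc_gt0 varpi_neq0.
rewrite (le_trans (sal_sqr_le n))// ler_pdivlMl ?exprn_gt0// mulr1 expr2.
by rewrite ler_pM ?normc_varpi_ge// ltW.
Qed.

Lemma normc_zetaB_ge n z w : normc z <= 1 -> normc w <= 1 ->
  normc (z - w) * ((1 - r ^+ 2) / (1 + r) ^+ 2) <= normc (zeta alpha n z - zeta alpha n w).
Proof.
move=> z1 w1; rewrite zetaB// normcM ler_wpM2l ?normc_ge0//.
rewrite normcM normcV -rmorphXn normc_real ger0_norm ?sqr_ge0// normcM.
have r1 : 0 < 1 + r by rewrite ltr_wpDr.
apply: ler_pM; [exact/ltW/r2_lt1|by rewrite invr_ge0 exprn_ge0 ?ltW|exact: sal_sqr_ge|].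
rewrite lef_pV2 ?posrE ?exprn_gt0// ?mulr_gt0 ?normc_gt0 ?varpi_neq0//.
by rewrite expr2 ler_pM ?normc_ge0 ?normc_varpi_le.
Qed.

Lemma normc_blaschke n z : T z -> normc (blaschke alpha n z) = 1.
Proof.
move=> Tz; rewrite /blaschke; elim/big_ind : _ => [|x y x1 y1|k _].
- exact: normc1.
- by rewrite normcM x1 y1 mulr1.
- exact: normc_zeta.
Qed.

Lemma blaschkeS n z : blaschke alpha n.+1 z = blaschke alpha n z * zeta alpha n.+1 z.
Proof. by rewrite /blaschke big_nat_recr. Qed.

Lemma blaschke0 z : blaschke alpha 0 z = 1.
Proof. by rewrite /blaschke big_geq. Qed.

Lemma cnice_varpi n : cnice (varpi alpha n).
Proof.
by apply: cniceB; [exact: cnice_cst|apply: cniceZ; exact: cnice_id].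
Qed.

Lemma cnice_zeta n : cnice (zeta alpha n).
Proof.
apply: cniceM; first by apply: cniceB; [exact: cnice_id|exact: cnice_cst].
apply: (@cniceV _ _ (1 - r)); first by rewrite subr_gt0.
  by move=> z /T_le1; exact: normc_varpi_ge.
exact: cnice_varpi.
Qed.

Lemma cnice_blaschke n : cnice (blaschke alpha n).
Proof.
elim: n => [|n IH].
  by rewrite (_ : blaschke _ _ = fun=> 1); [exact: cnice_cst|apply/funext/blaschke0].
rewrite (_ : blaschke _ _ = fun z => blaschke alpha n z * zeta alpha n.+1 z).
  by apply: cniceM => //; exact: cnice_zeta.
exact/funext/blaschkeS.
Qed.

(** The denominator [varpi alpha n z] cancels the factor varpi_n of psi_n: an approximate
    eigenvector equation for zeta_n and psi_n becomes one for z and phi_n. *)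
Lemma zeta_inv_sub n z l : normc l <= 1 -> normc z <= 1 ->
  zeta alpha n z - l =
  (1 + (alpha n)^* * l) * (z - zeta_inv alpha n l) / varpi alpha n z.
Proof.
move=> l1 z1; have l0 : 1 + (alpha n)^* * l != 0.
  by have := @varpi_neq0 n (- l); rewrite normcN /varpi mulrN opprK => ->.
have := varpi_neq0 n z1; rewrite /zeta /zeta_inv /varpi_star /varpi => z0.
by field; rewrite z0 l0.
Qed.

End BlaschkeFactors.

Section Recurrence.
Variables (R : realType) (alpha a : nat -> R[i]) (r : R) (phi : nat -> R[i] -> R[i]).
Hypotheses (r_ge0 : 0 <= r) (r_lt1 : r < 1) (alpha_le : forall n, normc (alpha n) <= r).
Hypothesis alpha0 : alpha 0%N = 0.
Hypothesis a_lt1 : forall n, (0 < n)%N -> normc (a n) < 1.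
Hypothesis phi0 : forall z, phi 0%N z = 1.
Hypothesis phi_rec : orf_recurrence alpha a phi.
Local Notation T := (@unit_circle R).
Implicit Types (z w : R[i]).
Local Notation s := (sal alpha).

Definition rho n : R := Num.sqrt (1 - normc (a n) ^+ 2).

Lemma rho_sqr n : (0 < n)%N -> rho n ^+ 2 = 1 - normc (a n) ^+ 2.
Proof.
by move=> n0; rewrite sqr_sqrtr// subr_ge0 expr_le1 ?normc_ge0// ltW ?a_lt1.
Qed.

Lemma rho_gt0 n : (0 < n)%N -> 0 < rho n.
Proof.
by move=> n0; rewrite sqrtr_gt0 subr_gt0 expr_lt1 ?normc_ge0// a_lt1.
Qed.

Lemma rhoC_neq0 n : (0 < n)%N -> (rho n)%:C%C != 0.
Proof. by move=> n0; rewrite -normc_eq0 normc_real normr_eq0 gt_eqF ?rho_gt0. Qed.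

Lemma rhoC_sqr n : (0 < n)%N -> (rho n)%:C%C ^+ 2 = 1 - a n * (a n)^*.
Proof. by move=> n0; rewrite mulcJ -rmorphXn /= rho_sqr// rmorphB rmorph1. Qed.

Lemma sqrtC_real (x : R) : 0 <= x -> sqrtC (x ^+ 2)%:C%C = x%:C%C.
Proof. by move=> x0; rewrite rmorphXn /= sqrCK// ler0c. Qed.

(** The quotient of the s_n is absorbed by the normalization of psi_n, which leaves only 1 / rho in
    its recurrence. *)
Lemma orf_eE n : orf_e alpha a n.+1 = (s n.+1 / (s n * rho n.+1))%:C%C.
Proof.
rewrite /orf_e /= !(varpi_alpha r_lt1 alpha_le).
rewrite normcE -rmorphXn /= -!rmorphXn /= -(rmorph1 (real_complex R)) -rmorphB /=.
rewrite -rho_sqr// -!fmorphV -!rmorphM /= mul1r -!exprVn -!exprMn.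
rewrite sqrtC_real ?invfM ?mulrA// !mulr_ge0 ?invr_ge0//.
- exact/ltW/(sal_gt0 r_ge0 r_lt1 alpha_le).
- exact/ltW/(sal_gt0 r_ge0 r_lt1 alpha_le).
- exact/ltW/rho_gt0.
Qed.

(* Multiplying phi_n and phi_n^* by varpi_n / s_n, with s_n^2 = varpi_n(alpha_n),
   turns the recurrence into Szego's one, with zeta_(n-1) in place of z. On the
   circle, superstar reduces to the product with a complex conjugate; this form
   avoids the poles. *)
Definition nphi n z := varpi alpha n z / (s n)%:C%C * phi n z.
Definition nphis n z := varpi alpha n z / (s n)%:C%C * (blaschke alpha n z * (phi n z)^*).
Local Notation psi := nphi.
Local Notation psis := nphis.

Lemma superstarE n (f : R[i] -> R[i]) z : T z ->
  superstar alpha n f z = blaschke alpha n z * (f z)^*.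
Proof.
by move=> Tz; rewrite /superstar /substar div1r -(unit_circleV Tz) invrK.
Qed.

Lemma psi_rec n z : T z ->
  (rho n.+1)%:C%C * psi n.+1 z = zeta alpha n z * psi n z + a n.+1 * psis n z.
Proof.
move=> Tz; rewrite {1}/psi; have [-> _] := phi_rec (ltn0Sn n) Tz.
rewrite superstarE// orf_eE /psi /psis /= !fmorph_div !rmorphM /=.
have h1 := varpi_neq0 r_lt1 alpha_le n.+1 (T_le1 Tz).
have h2 := salC_neq0 r_ge0 r_lt1 alpha_le n.
have h3 := salC_neq0 r_ge0 r_lt1 alpha_le n.+1.
have h4 := rhoC_neq0 (ltn0Sn n).
by field; rewrite h1 h2 h3 h4.
Qed.

Lemma psis_rec n z : T z ->
  (rho n.+1)%:C%C * psis n.+1 z = (a n.+1)^* * (zeta alpha n z * psi n z) + psis n z.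
Proof.
move=> Tz; rewrite {1}/psis -superstarE//; have [_ ->] := phi_rec (ltn0Sn n) Tz.
rewrite superstarE// orf_eE /psi /psis /= !fmorph_div !rmorphM /=.
have h1 := varpi_neq0 r_lt1 alpha_le n.+1 (T_le1 Tz).
have h2 := salC_neq0 r_ge0 r_lt1 alpha_le n.
have h3 := salC_neq0 r_ge0 r_lt1 alpha_le n.+1.
have h4 := rhoC_neq0 (ltn0Sn n).
by field; rewrite h1 h2 h3 h4.
Qed.

Lemma normc_psis n z : T z -> normc (psis n z) = normc (psi n z).
Proof.
by move=> Tz; rewrite /psis /psi !normcM normcJ (normc_blaschke r_lt1 alpha_le)// mul1r.
Qed.

Lemma psi0 z : psi 0 z = 1.
Proof.
rewrite /psi phi0 /varpi alpha0 conjC0 mul0r subr0 mulr1.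
by rewrite /sal alpha0 normc0 expr0n subr0 sqrtr1 divr1.
Qed.

Lemma psis0 z : T z -> psis 0 z = 1.
Proof.
move=> Tz; rewrite /psis blaschke0 mul1r phi0 conjC1.
by rewrite -(phi0 z) -/(psi 0 z) psi0.
Qed.

(** Elimination of zeta_n psi_n between the two lines of the recurrence. When rho is small,
    psi_(n+1)^* is thus nearly a multiple of psi_(n+1). *)
Lemma psis_psi n z : T z ->
  psis n.+1 z = (a n.+1)^* * psi n.+1 z + (rho n.+1)%:C%C * psis n z.
Proof.
move=> Tz; have h4 := rhoC_neq0 (ltn0Sn n); apply: (mulfI h4).
transitivity ((a n.+1)^* * ((rho n.+1)%:C%C * psi n.+1 z)
  + (rho n.+1)%:C%C ^+ 2 * psis n z); last by ring.
by rewrite psi_rec// psis_rec// rhoC_sqr//; ring.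
Qed.

Lemma zeta_psi n z : T z ->
  zeta alpha n z * psi n z = (rho n.+1)%:C%C * psi n.+1 z - a n.+1 * psis n z.
Proof. by move=> Tz; rewrite psi_rec// addrK. Qed.

Definition lam n := - (a n)^* * a n.+1.

Lemma normc_lam n : (0 < n)%N -> normc (lam n) <= 1.
Proof.
move=> n0; rewrite normcM normcN normcJ mulr_ile1 ?normc_ge0// ltW// a_lt1//.
Qed.

Lemma zeta_lam_psi n z : T z ->
  (zeta alpha n.+1 z - lam n.+1) * psi n.+1 z =
  (rho n.+2)%:C%C * psi n.+2 z - a n.+2 * (rho n.+1)%:C%C * psis n z.
Proof.
move=> Tz; rewrite mulrBl zeta_psi// psis_psi// /lam; ring.
Qed.

Definition ltil n := zeta_inv alpha n (lam n).
(** The factor by which (zeta_n - lam_n) psi_n must be multiplied to give (z - ltil_n) phi_n. *)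
Definition kap n := (s n)%:C%C / (1 + (alpha n)^* * lam n).

Lemma lam_neq0 n : (0 < n)%N -> 1 - r <= normc (1 + (alpha n)^* * lam n).
Proof.
move=> n0; have := @normc_varpi_ge _ alpha r alpha_le n (- lam n).
by rewrite normcN /varpi mulrN opprK; apply; exact: normc_lam.
Qed.

Lemma ltil_phi n z : T z ->
  (z - ltil n.+1) * phi n.+1 z =
  kap n.+1 * ((rho n.+2)%:C%C * psi n.+2 z - a n.+2 * (rho n.+1)%:C%C * psis n z).
Proof.
move=> Tz; rewrite -zeta_lam_psi// (zeta_inv_sub r_lt1 alpha_le) ?normc_lam ?T_le1// -/(ltil _).
have h1 := varpi_neq0 r_lt1 alpha_le n.+1 (T_le1 Tz).
have h3 := salC_neq0 r_ge0 r_lt1 alpha_le n.+1.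
have h5 : 1 + (alpha n.+1)^* * lam n.+1 != 0.
  by rewrite -normc_gt0 (lt_le_trans _ (lam_neq0 (ltn0Sn n)))// subr_gt0.
by rewrite /kap /psi; field; rewrite h1 h3 h5.
Qed.

Lemma normc_kap n : (0 < n)%N -> normc (kap n) <= (1 - r)^-1.
Proof.
move=> n0; have r1 : 0 < 1 - r by rewrite subr_gt0.
have h := lam_neq0 n0; rewrite normcM normcV normc_real -[leRHS]mul1r.
apply: ler_pM => //; [by rewrite invr_ge0 normc_ge0| |].
  rewrite -(@ler_pXn2r _ 2) ?nnegrE//  real_normK ?num_real// expr1n.
  exact: sal_sqr_le r_lt1 alpha_le _.
by rewrite lef_pV2 ?posrE// (lt_le_trans r1).
Qed.

End Recurrence.

(** * Orthonormal families and norm bounds for combinations of psi_n and psi_n^* *)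

Section Orthonormal.
Variables (R : realType) (m : {measure set (borelC R) -> \bar R}).
Local Notation T := (@unit_circle R).
Hypothesis mTfin : (m (T : set (borelC R)) < +oo)%E.
Variable g : nat -> R[i] -> R[i].
Hypothesis g_nice : forall n, cnice (g n).
Hypothesis g_orth : forall i j, cint m (fun z => (g i z)^* * g j z) = (i == j)%:R.

Lemma cint_orthonormal_coef M (c : nat -> R[i]) i :
  cint m (fun z => (g i z)^* * \sum_(k < M) c k * g k z) = if (i < M)%N then c i else 0.
Proof.
have nfk k : cnice (fun z => c k * ((g i z)^* * g k z)).
  by apply/cniceZ/cniceM; [exact: cniceJ|].
rewrite (@eq_cint _ _ _ (fun z => \sum_(k < M) c k * ((g i z)^* * g k z))); last first.
  by move=> z _; rewrite mulr_sumr; apply: eq_bigr => k _; rewrite mulrCA.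
rewrite (@cint_sum _ _ mTfin M (fun k z => c k * ((g i z)^* * g k z)))//.
have E (k : 'I_M) : cint m (fun z => c k * ((g i z)^* * g k z)) = c k * (i == k)%:R.
  by rewrite (cintZ mTfin) ?g_orth//; apply: cniceM => //; exact: cniceJ.
rewrite (eq_bigr _ (fun k _ => E k)).
case: ltnP => iM.
  rewrite (bigD1 (Ordinal iM))//= eqxx mulr1 big1 ?addr0// => k ki.
  rewrite (_ : (i == k :> nat) = false) ?mulr0//.
  by apply/negbTE; apply: contra ki => /eqP ik; apply/eqP/val_inj.
rewrite big1// => k _; rewrite gtn_eqF ?mulr0//.
by rewrite (leq_trans (ltn_ord k)).
Qed.

Lemma nsq_orthonormal M (c : nat -> R[i]) :
  nsq m (fun z => \sum_(k < M) c k * g k z) = \sum_(k < M) normc (c k) ^+ 2.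
Proof.
have nfk k : cnice (fun z => c k * g k z) by exact: cniceZ.
have nf : cnice (fun z => \sum_(k < M) c k * g k z).
  exact: (@cnice_sum _ M (fun k z => c k * g k z)).
apply: complexI; rewrite -nsqE// rmorph_sum /=.
set f := fun z => \sum_(k < M) c k * g k z.
rewrite (@eq_cint _ _ _ (fun z => \sum_(k < M) (c k)^* * ((g k z)^* * f z))); last first.
  move=> z _; rewrite {1}/f rmorph_sum mulr_suml; apply: eq_bigr => k _.
  by rewrite rmorphM mulrA.
rewrite (@cint_sum _ _ mTfin M (fun k z => (c k)^* * ((g k z)^* * f z))); last first.
  by move=> k; apply/cniceZ/cniceM => //; exact: cniceJ.
apply: eq_bigr => k _; rewrite (cintZ mTfin); last first.
  by apply/cniceM => //; exact: cniceJ.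
by rewrite cint_orthonormal_coef ltn_ord mulrC mulcJ.
Qed.

End Orthonormal.

Section OrthogonalRationalBounds.
Variables (R : realType) (alpha a : nat -> R[i]) (r : R) (phi : nat -> R[i] -> R[i]).
Hypotheses (r_ge0 : 0 <= r) (r_lt1 : r < 1) (alpha_le : forall n, normc (alpha n) <= r).
Hypothesis a_lt1 : forall n, (0 < n)%N -> normc (a n) < 1.
Hypothesis phi_rec : orf_recurrence alpha a phi.
Local Notation T := (@unit_circle R).
Implicit Types (z w : R[i]).
Local Notation s := (sal alpha).
Local Notation psi := (nphi alpha phi).
Local Notation psis := (nphis alpha phi).
Variable m : {measure set (borelC R) -> \bar R}.
Hypothesis mTfin : (m (T : set (borelC R)) < +oo)%E.
Hypothesis phi_nice : forall n, cnice (phi n).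
Hypothesis phi_orth : forall i j, cint m (fun z => (phi i z)^* * phi j z) = (i == j)%:R.

Lemma cnice_psi n : cnice (psi n).
Proof.
apply: cniceM => //; apply: cniceM; [exact: cnice_varpi|exact: cnice_cst].
Qed.

Lemma cnice_psis n : cnice (psis n).
Proof.
apply: cniceM; first by apply: cniceM; [exact: cnice_varpi|exact: cnice_cst].
apply: cniceM; [exact: (cnice_blaschke r_lt1 alpha_le)|exact: cniceJ].
Qed.

Lemma nsq_phi_shift p M (c : nat -> R[i]) :
  nsq m (fun z => \sum_(k < M) c k * phi (p + k)%N z) = \sum_(k < M) normc (c k) ^+ 2.
Proof.
apply: (@nsq_orthonormal _ _ mTfin (fun k => phi (p + k)%N)) => // i j.
by rewrite phi_orth eqn_add2l.
Qed.

Local Notation C0 := (4 / (1 - r ^+ 2)).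

Lemma C0_ge0 : 0 <= C0.
Proof. by rewrite divr_ge0// ltW// r2_lt1. Qed.

(** As psi_k = (1 - conj(alpha_k) z) phi_k / s_k, the sum is f1 + z f2 with f1 and f2 in the span of
    the phi_k, and multiplication by z preserves the norm. Both squared coefficients are at most
    |b_k|^2 / (1 - r^2) and [nsqD] doubles each, whence the 4 of C0. *)
Lemma nsq_sum_psi p M (b : nat -> R[i]) :
  nsq m (fun z => \sum_(k < M) b k * psi (p + k)%N z) <= C0 * \sum_(k < M) normc (b k) ^+ 2.
Proof.
pose c1 (k : nat) : R[i] := b k / (s (p + k)%N)%:C%C.
pose c2 (k : nat) : R[i] := - (b k / (s (p + k)%N)%:C%C * (alpha (p + k)%N)^*).
pose f (c : nat -> R[i]) (z : R[i]) := \sum_(k < M) c k * phi (p + k)%N z.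
have nf c : cnice (f c).
  by rewrite /f; apply: (@cnice_sum _ M (fun k z => c k * phi (p + k)%N z)) => k; exact: cniceZ.
rewrite (@eq_nsq _ _ _ (fun z => f c1 z + z * f c2 z)); last first.
  move=> z _; rewrite /f mulr_sumr -big_split; apply: eq_bigr => k _ /=.
  by rewrite /c1 /c2 /nphi /varpi; ring.
have nzf : cnice (fun z => z * f c2 z) by apply: cniceM => //; exact: cnice_id.
rewrite (le_trans (nsqD mTfin (nf c1) nzf))//.
have zf : nsq m (fun z => z * f c2 z) <= nsq m (f c2).
  rewrite -[leRHS]mul1r -(expr1n _ 2); apply: le_nsq => // z /unit_circleE z1.
  by rewrite normcM z1.
rewrite (le_trans (lerD (lexx _) (ler_wpM2l _ zf)))// !nsq_phi_shift.
have bnd k : 2 * normc (c1 k) ^+ 2 + 2 * normc (c2 k) ^+ 2 <= C0 * normc (b k) ^+ 2.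
  have s0 := sal_sqr_ge r_ge0 r_lt1 alpha_le (p + k)%N; have r2 := r2_lt1 r_ge0 r_lt1.
  rewrite /c1 /c2 normcN !normcM !normcV normc_real normcJ !exprMn !exprVn.
  rewrite real_normK ?num_real//; set S := s _ ^+ 2 in s0 *; set B := normc (b k) ^+ 2.
  have S0 : 0 < S by rewrite (lt_le_trans r2).
  have a1 : normc (alpha (p + k)%N) ^+ 2 <= 1.
    by rewrite expr_le1 ?normc_ge0// (le_trans (alpha_le _)) ?ltW.
  have B0 : 0 <= B by rewrite sqr_ge0.
  have BS : 0 <= B / S by rewrite divr_ge0// ltW.
  apply: (@le_trans _ _ (4 * (B / S))); first by nra.
  rewrite -mulrA ler_pM2l// mulrC ler_wpM2r// lef_pV2 ?posrE//.
rewrite !mulr_sumr -big_split /=; apply: ler_sum => k _; exact: bnd.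
Qed.

Lemma nsq_psi n : nsq m (psi n) <= C0.
Proof.
have := nsq_sum_psi n 1 (fun=> 1); rewrite big_ord1 [normc _]normc1 expr1n mulr1.
apply: le_trans; rewrite le_eqVlt; apply/orP; left; apply/eqP; apply: eq_nsq => z _.
by rewrite big_ord1 addn0 mul1r.
Qed.

Lemma nsq_psis n : nsq m (psis n) <= C0.
Proof.
apply: le_trans (nsq_psi n); rewrite -[leRHS]mul1r -(expr1n _ 2).
apply: le_nsq => //; [exact: cnice_psis|exact: cnice_psi|].
by move=> z Tz; rewrite (normc_psis phi r_lt1 alpha_le)// mul1r.
Qed.

Lemma nsqD3 (f g h : R[i] -> R[i]) : cnice f -> cnice g -> cnice h ->
  nsq m (fun z => f z + g z + h z) <= 3 * nsq m f + 3 * nsq m g + 3 * nsq m h.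
Proof.
move=> nf ng nh; have [n1 n2 n3] := And3 (cnice_sqr nf) (cnice_sqr ng) (cnice_sqr nh).
have nc (F : R[i] -> R) : rnice F -> rnice (fun z => 3 * F z).
  by apply: rniceM; exact: rnice_cst.
rewrite /nsq -!(RIZ mTfin)// -!(RID mTfin); [|by repeat (apply: rniceD || apply: nc)..].
apply: le_RI => // [||z _]; [|by repeat (apply: rniceD || apply: nc)|].
  by apply: cnice_sqr; apply: cniceD => //; exact: cniceD.
rewrite !sqr_normcE; case: (f z) (g z) (h z) => a1 a2 [b1 b2] [c1 c2] /=.
have := sqr_ge0 (a1 - b1); have := sqr_ge0 (a1 - c1); have := sqr_ge0 (b1 - c1).
have := sqr_ge0 (a2 - b2); have := sqr_ge0 (a2 - c2); have := sqr_ge0 (b2 - c2).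
nra.
Qed.

(** The psi_n^* are far from orthogonal in general. [psis_psi] trades each for psi_n and rho_n times
    the previous psi_(n-1)^*, which leaves a sum of one term fewer with coefficients damped by rho.
    With the factor 3 of [nsqD3] and rho^2 <= 1/6, the induction closes because 3 + 3 * 12 / 6 <=
    12. *)
Lemma nsq_sum_psis p M (b : nat -> R[i]) :
  (forall n, (p < n)%N -> rho a n ^+ 2 <= 1 / 6) ->
  nsq m (fun z => \sum_(k < M) b k * psis (p + k)%N z) <=
  12 * C0 * \sum_(k < M) normc (b k) ^+ 2.
Proof.
move=> rho6; elim: M b => [|M IH] b.
  rewrite big_ord0 mulr0 (@eq_nsq _ _ _ (fun=> 0 * 0)); last by move=> z _; rewrite big_ord0 mul0r.
  by rewrite nsqZ ?normc0 ?expr0n ?mul0r//; exact: cnice_cst.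
pose f0 z := b 0%N * psis p z.
pose c1 (k : nat) : R[i] := b k.+1 * (a (p + k.+1)%N)^*.
pose c2 (k : nat) : R[i] := b k.+1 * (rho a (p + k.+1)%N)%:C%C.
pose f1 z := \sum_(k < M) c1 k * psi (p.+1 + k)%N z.
pose f2 z := \sum_(k < M) c2 k * psis (p + k)%N z.
rewrite (@eq_nsq _ _ _ (fun z => f0 z + f1 z + f2 z)); last first.
  move=> z Tz; rewrite big_ord_recl addn0 -addrA; congr (_ + _).
  rewrite -big_split; apply: eq_bigr => k _ /=; rewrite /bump /= add1n addnS.
  rewrite (psis_psi r_ge0 r_lt1 alpha_le a_lt1 phi_rec)// /c1 /c2 !addnS addSn; ring.
have nf0 : cnice f0 by apply: cniceZ; exact: cnice_psis.
have nf1 : cnice f1.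
  rewrite /f1; apply: (@cnice_sum _ M (fun k z => c1 k * psi (p.+1 + k)%N z)) => k.
  exact/cniceZ/cnice_psi.
have nf2 : cnice f2.
  rewrite /f2; apply: (@cnice_sum _ M (fun k z => c2 k * psis (p + k)%N z)) => k.
  exact/cniceZ/cnice_psis.
rewrite (le_trans (nsqD3 nf0 nf1 nf2))//.
have h0 : nsq m f0 <= C0 * normc (b 0%N) ^+ 2.
  by rewrite nsqZ//; [rewrite mulrC ler_wpM2r ?sqr_ge0 ?nsq_psis|exact: cnice_psis].
have h1 := nsq_sum_psi p.+1 M c1; have h2 := IH c2.
have c0 := C0_ge0.
set S := \sum_(k < M) normc (b k.+1) ^+ 2.
have h1' : nsq m f1 <= C0 * S.
  apply: (le_trans h1); rewrite ler_wpM2l// ler_sum// => k _.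
  rewrite /c1 normcM normcJ exprMn ler_piMr ?sqr_ge0// expr_le1 ?normc_ge0// ltW// a_lt1//.
  by rewrite addnS.
have h2' : nsq m f2 <= 12 * C0 * (1 / 6 * S).
  apply: (le_trans h2); apply: ler_wpM2l; first exact: mulr_ge0.
  rewrite /S mulr_sumr ler_sum// => k _.
  rewrite /c2 normcM normc_real exprMn real_normK ?num_real// mulrC ler_wpM2r ?sqr_ge0//.
  by rewrite rho6// -addSnnS leq_addr.
have S0 : 0 <= S by apply: sumr_ge0 => k _; exact: sqr_ge0.
rewrite big_ord_recl (_ : \sum_(i < M) _ = S) //.
have := sqr_ge0 (normc (b 0%N)).
move: (4 / _) c0 h0 h1' h2' => c c0 h0 h1' h2' b0; nra.
Qed.

End OrthogonalRationalBounds.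

(** * Absence of gaps when a tends to 0 *)

Lemma nsq_sum (R : realType) (m : {measure set (borelC R) -> \bar R}) M
    (f : nat -> R[i] -> R[i]) : (m (@unit_circle R : set (borelC R)) < +oo)%E ->
  (forall k, cnice (f k)) ->
  nsq m (fun z => \sum_(k < M) f k z) <= M%:R * \sum_(k < M) nsq m (f k).
Proof.
move=> mTfin nf; have nf2 k := cnice_sqr (nf k).
rewrite /nsq -(RI_sum mTfin M nf2) -RIZ//; last exact: (@rnice_sum _ M _ nf2).
apply: le_RI => //; [by apply: cnice_sqr; exact: (@cnice_sum _ M f nf)| |].
  by apply: rniceM; [exact: rnice_cst|exact: (@rnice_sum _ M _ nf2)].
by move=> z _; exact: (@sqr_normc_sum _ M (fun k => f k z)).
Qed.

Section GapCriterion.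
Variables (R : realType) (alpha a : nat -> R[i]) (r : R) (phi : nat -> R[i] -> R[i]).
Hypotheses (r_ge0 : 0 <= r) (r_lt1 : r < 1) (alpha_le : forall n, normc (alpha n) <= r).
Hypothesis a_lt1 : forall n, (0 < n)%N -> normc (a n) < 1.
Hypothesis phi_rec : orf_recurrence alpha a phi.
Local Notation T := (@unit_circle R).
Implicit Types (z w : R[i]).
Local Notation s := (sal alpha).
Local Notation psi := (nphi alpha phi).
Local Notation psis := (nphis alpha phi).
Variable m : {measure set (borelC R) -> \bar R}.
Hypothesis mTfin : (m (T : set (borelC R)) < +oo)%E.
Hypothesis phi_nice : forall n, cnice (phi n).
Hypothesis phi_orth : forall i j, cint m (fun z => (phi i z)^* * phi j z) = (i == j)%:R.
Local Notation C0 := (4 / (1 - r ^+ 2)).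
Let npsi n : cnice (psi n) := cnice_psi alpha phi_nice n.
Let npsis n : cnice (psis n) := cnice_psis r_lt1 alpha_le phi_nice n.
Let bpsi n : nsq m (psi n) <= C0 :=
  nsq_psi r_ge0 r_lt1 alpha_le mTfin phi_nice phi_orth n.
Let bpsis n : nsq m (psis n) <= C0 :=
  nsq_psis r_ge0 r_lt1 alpha_le mTfin phi_nice phi_orth n.
Let bC0 : 0 <= C0 := C0_ge0 r_ge0 r_lt1.

Lemma nsq_zeta_psi n :
  nsq m (fun z => zeta alpha n z * psi n z - psi n.+1 z) <= 4 * C0 * normc (a n.+1) ^+ 2.
Proof.
pose f z := ((rho a n.+1)%:C%C - 1) * psi n.+1 z.
pose g z := - a n.+1 * psis n z.
rewrite (@eq_nsq _ _ _ (fun z => f z + g z)); last first.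
  by move=> z Tz; rewrite (zeta_psi r_ge0 r_lt1 alpha_le a_lt1 phi_rec)// /f /g; ring.
rewrite (le_trans (nsqD mTfin (cniceZ _ (npsi _)) (cniceZ _ (npsis _))))//.
rewrite !nsqZ// normcN -(rmorph1 (real_complex R)) -rmorphB normc_real.
have an := a_lt1 (ltn0Sn n); have rh := rho_sqr a_lt1 (ltn0Sn n).
have rh0 := rho_gt0 a_lt1 (ltn0Sn n).
have a0 := normc_ge0 (a n.+1).
have bp := bpsi n.+1; have bps := bpsis n.
have p0 := nsq_ge0 m (psi n.+1).
rewrite real_normK ?num_real//.
set A := normc _ in an rh a0 *; set rh' := rho _ _ in rh rh0 *.
(* Since 0 < rho <= 1, (1 - rho)^2 <= (1 - rho) (1 + rho) = |a|^2. *)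
have h1 : (rh' - 1) ^+ 2 <= A ^+ 2 by nra.
have A2 := sqr_ge0 A.
apply: (@le_trans _ _ (2 * (A ^+ 2 * C0) + 2 * (A ^+ 2 * C0))); last by nra.
apply: lerD; rewrite ler_pM2l//.
  by apply: ler_pM => //; exact: sqr_ge0.
by rewrite ler_wpM2l.
Qed.

(* When a is small, psi_(n+1) is close to zeta_n psi_n, so suitable unimodular
   multiples of the psi_n make (z - z0) times a sum of M of the phi_n telescope:
   its norm stays bounded while the norm of the sum grows like the square root
   of M. *)
Lemma no_gap z0 (e : R) :
  (forall d : R, 0 < d -> exists N, forall n, (N <= n)%N -> normc (a n) < d) ->
  T z0 -> 0 < e -> m [set z | normc (z0 - z) < e] = 0%E -> False.
Proof.
move=> a_to0 Tz0 e0 mN.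
pose D := (1 - r ^+ 2) / (1 + r) ^+ 2.
have D0 : 0 < D by rewrite divr_gt0 ?r2_lt1// exprn_gt0// ltr_wpDr.
(* Off the null disc |z - z0| >= e and each |c_k|^2 is at least D, so the norm is at least e^2 D M;
   the telescoped sum gives at most 6 C0 + 1. *)
pose M := (Num.truncn ((e ^+ 2 * D)^-1 * (6 * C0 + 1))).+1.
have eD0 : 0 < e ^+ 2 * D by rewrite mulr_gt0 ?exprn_gt0.
have M_big : 6 * C0 + 1 < e ^+ 2 * D * M%:R.
  by rewrite -ltr_pdivrMl// /M truncnS_gt.
(* Weight of |a|^2 in the total error: 3 from [nsqD3], M from Cauchy-Schwarz, and M terms of size at
   most 4 C0 |a|^2. *)
pose X := 12 * M%:R ^+ 2 * C0.
have X0 : 0 <= X by apply: mulr_ge0 => //; rewrite mulr_ge0// sqr_ge0.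
have [p ap] : exists p, forall n, (p <= n)%N -> X * normc (a n) ^+ 2 <= 1.
  have X1 : 0 < X + 1 by rewrite ltr_wpDl.
  have [|p pP] := a_to0 (Num.min 1 (X + 1)^-1); first by rewrite lt_min ltr01 invr_gt0.
  exists p => n /pP; rewrite lt_min => /andP[a1 aX]; have an0 := normc_ge0 (a n).
  rewrite -(ltr_pM2l X1) mulfV ?gt_eqF// in aX; nra.
(* Chosen so that d_k psi_(p+k+1) = v_(k+1); replacing zeta psi_(p+k) by psi_(p+k+1) then turns d_k
   (zeta(z) - zeta(z0)) psi_(p+k) into v_(k+1) - v_k. *)
pose d := fix d k := if k is k'.+1 then (zeta alpha (p + k)%N z0)^* * d k' else 1.
have dS k : d k.+1 * zeta alpha (p + k.+1)%N z0 = d k.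
  by rewrite /= mulrAC [_^* * _]mulrC mulcJ_T ?mul1r//; exact: (T_zeta r_lt1 alpha_le).
have d1 k : normc (d k) = 1.
  elim: k => [|k IH]; first exact: normc1.
  by rewrite [d _]/= normcM normcJ (normc_zeta r_lt1 alpha_le)// mul1r.
(* By [zetaB], (z - z0) c_k phi_(p+k) = d_k (zeta(z) - zeta(z0)) psi_(p+k). *)
pose c k := d k * ((s (p + k)%N)%:C%C / varpi alpha (p + k)%N z0).
pose f z := \sum_(k < M) c k * phi (p + k)%N z.
pose v k z := d k * zeta alpha (p + k)%N z0 * psi (p + k)%N z.
pose er k z := d k * (zeta alpha (p + k)%N z * psi (p + k)%N z - psi (p + k).+1 z).
have nf : cnice f.
  by apply: (@cnice_sum _ M (fun k z => c k * phi (p + k)%N z)) => k; exact: cniceZ.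
have nzf : cnice (fun z => (z - z0) * f z).
  by apply: cniceM => //; apply: cniceB; [exact: cnice_id|exact: cnice_cst].
have nv k : cnice (v k) by exact: cniceZ.
have ner k : cnice (er k).
  apply/cniceZ/cniceB => //; apply: cniceM => //; exact: (cnice_zeta r_lt1 alpha_le).
have ner_sum : cnice (fun z => \sum_(k < M) er k z) by exact: (@cnice_sum _ M er ner).
have fE z : T z -> (z - z0) * f z = v M z + - v 0%N z + \sum_(k < M) er k z.
  move=> Tz; rewrite -[v M z + _](telescope_sumr (fun k => v k z) (leq0n M)) big_mkord.
  rewrite -big_split /f mulr_sumr; apply: eq_bigr => k _ /=.
  rewrite {1}/v dS /v /er addnS.
  have z1 := T_le1 Tz; have z01 := T_le1 Tz0.
  have := zetaB r_lt1 alpha_le (p + k)%N z1 z01.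
  have := varpi_neq0 r_lt1 alpha_le (p + k)%N z1.
  have := varpi_neq0 r_lt1 alpha_le (p + k)%N z01.
  have := salC_neq0 r_ge0 r_lt1 alpha_le (p + k)%N.
  rewrite /nphi /c; set Z := zeta _ _ z; set Z0 := zeta _ _ z0.
  set W := varpi _ _ z; set W0 := varpi _ _ z0; set S := (s _)%:C%C => S0 W00 W1 ZZ.
  transitivity (d k * (Z - Z0) * (W / S * phi (p + k)%N z)); last by ring.
  by rewrite ZZ; field; rewrite S0 W00 W1.
have lower : e ^+ 2 * (M%:R * D) <= nsq m (fun z => (z - z0) * f z).
  apply: (@le_trans _ _ (e ^+ 2 * nsq m f)).
    rewrite ler_wpM2l ?sqr_ge0// /f (nsq_phi_shift mTfin phi_nice phi_orth).
    rewrite -[M in M%:R]card_ord -sum1_card natr_sum mulr_suml ler_sum// => k _.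
    rewrite mul1r /c normcM d1 mul1r normcM normcV normc_real exprMn exprVn.
    rewrite real_normK ?num_real//; apply: ler_pM.
    - exact/ltW/r2_lt1.
    - by rewrite invr_ge0 sqr_ge0.
    - exact: sal_sqr_ge.
    rewrite lef_pV2 ?posrE ?exprn_gt0 ?normc_gt0 ?(varpi_neq0 r_lt1 alpha_le) ?T_le1//; last first.
      by rewrite ltr_wpDr.
    by rewrite ler_pXn2r ?nnegrE ?normc_ge0 ?addr_ge0// (normc_varpi_le alpha_le)// T_le1.
  rewrite /nsq -RIZ//; last exact: cnice_sqr.
  apply: (le_RI_ae mTfin _ mN) => //.
  - by apply: measurable_openC; exact: open_disc.
  - by apply: rniceM; [exact: rnice_cst|exact: cnice_sqr].
  - exact: cnice_sqr.
  move=> z Tz /negP; rewrite -leNgt => ez.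
  rewrite normcM exprMn ler_wpM2r ?sqr_ge0// normc_subC.
  by rewrite ler_pXn2r ?nnegrE ?normc_ge0// ltW.
have upper : nsq m (fun z => (z - z0) * f z) <= 6 * C0 + 1.
  rewrite (@eq_nsq _ _ _ (fun z => v M z + - v 0%N z + \sum_(k < M) er k z))//.
  rewrite (le_trans (nsqD3 mTfin (nv M) (cniceN (nv 0%N)) ner_sum))//.
  have hv k : nsq m (v k) <= C0.
    rewrite nsqZ// normcM d1 (normc_zeta r_lt1 alpha_le)// mulr1 expr1n mul1r.
    exact: bpsi.
  have hv0 : nsq m (fun z => - v 0%N z) <= C0.
    apply: le_trans (hv 0%N); rewrite -[leRHS]mul1r -(expr1n _ 2).
    by apply: le_nsq => //; [exact: cniceN|move=> z _; rewrite normcN mul1r].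
  have her : 3 * nsq m (fun z => \sum_(k < M) er k z) <= 1.
    have M0 : 0 < M%:R :> R by rewrite ltr0n.
    apply: (@le_trans _ _ (3 * (M%:R * \sum_(k < M) (M%:R ^+ 2 * 3)^-1))); last first.
      rewrite sumr_const card_ord -[_ *+ M]mulr_natl.
      by rewrite le_eqVlt; apply/orP; left; apply/eqP; field; rewrite gt_eqF.
    rewrite ler_pM2l// (le_trans (nsq_sum M mTfin ner))// ler_pM2l//.
    apply: ler_sum => k _; rewrite nsqZ//; last first.
      by apply: cniceB => //; apply: cniceM => //; exact: (cnice_zeta r_lt1 alpha_le).
    rewrite d1 expr1n mul1r (le_trans (nsq_zeta_psi _))//.
    have := ap (p + k).+1; rewrite leqW ?leq_addr// => /(_ isT) aX.
    have MM : 0 < M%:R ^+ 2 * 3 :> R by rewrite mulr_gt0// exprn_gt0.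
    rewrite -(ler_pM2l MM) mulfV ?gt_eqF//.
    apply: le_trans aX; rewrite le_eqVlt; apply/orP; left; apply/eqP.
    by rewrite /X; ring.
  have := hv M; nra.
have := le_lt_trans (le_trans lower upper) M_big.
by rewrite -mulrA [D * _]mulrC ltxx.
Qed.

End GapCriterion.

(** * The derived set of the support when |a| tends to 1 *)

Section Support.
Variables (R : realType) (m : {measure set (borelC R) -> \bar R}).
Implicit Types (z w : R[i]).
Local Notation disc z e := [set w : R[i] | normc (z - w) < e].

Lemma measurable_disc z (e : R) : measurable (disc z e : set (borelC R)).
Proof. by apply: measurable_openC; exact: open_disc. Qed.

Lemma supp_disc z (e : R) : supp m z -> 0 < e -> (0 < m (disc z e))%E.
Proof.
by move=> mz e0; apply: mz; [exact: open_disc|rewrite /= subrr normc0].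
Qed.

Lemma not_supp_disc z : ~ supp m z -> exists2 e : R, 0 < e & m (disc z e) = 0%E.
Proof.
move=> /existsNP[U /not_implyP[oU /not_implyP[Uz /negP]]]; rewrite -leNgt => mU.
have [e e0 eU] := (openCP U).1 oU z Uz; exists e => //.
apply/eqP; rewrite eq_le measure_ge0 andbT (le_trans _ mU)// le_measure ?inE//.
  exact: measurable_disc.
exact: measurable_openC.
Qed.

(* The discs with rational centre and inverse integer radius form a countable
   base of the plane. *)
Lemma null_open (U : set R[i]^o) : open U -> (forall z, U z -> ~ supp m z) ->
  m (U : set (borelC R)) = 0%E.
Proof.
move=> oU Us.
pose D (q : rat * rat * nat) : set (borelC R) :=
  disc (Complex (ratr q.1.1) (ratr q.1.2)) (q.2.+1%:R^-1).
pose F n : set (borelC R) := if unpickle n is Some q then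
  (if `[< m (D q) = 0%E >] then D q else set0) else set0.
have F0 n : m.-negligible (F n).
  rewrite /F; case: unpickle => [q|]; last exact: negligible_set0.
  case: asboolP => [q0|_]; last exact: negligible_set0.
  by apply/negligibleP => //; exact: measurable_disc.
apply/negligibleP; first exact: measurable_openC.
apply: negligibleS (negligible_bigcup F0) => z /Us /not_supp_disc[e e0 ze].
pose k := Num.truncn (2 / e).
have ke : k.+1%:R^-1 + k.+1%:R^-1 < e.
  rewrite (_ : _ + _ = 2 / k.+1%:R); last by ring.
  by rewrite ltr_pdivrMr ?ltr0n// mulrC -ltr_pdivrMr// truncnS_gt.
have k0 : 0 < k.+1%:R^-1 :> R by rewrite invr_gt0.
have near_rat (x : R) : exists q : rat, `|x - ratr q| < k.+1%:R^-1 / 2.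
  move: k.+1%:R^-1 k0 => h h0.
  have [|q] := @rat_in_itvoo R (x - h / 2) (x + h / 2); first by lra.
  rewrite in_itv /= => /andP[q1 q2]; exists q.
  by rewrite ltr_norml; apply/andP; split; lra.
have [q1 Q1] := near_rat (complex.Re z); have [q2 Q2] := near_rat (complex.Im z).
pose c := Complex (ratr q1 : R) (ratr q2); have zc : normc (z - c) < k.+1%:R^-1.
  rewrite (le_lt_trans (normc_le_ReIm _))// raddfB raddfB /=.
  by rewrite [ltRHS](splitr _) ltrD.
have := pickleK (q1, q2, k); move: (pickle _) => n nE.
exists n; first exact: I.
rewrite /F nE.
have -> : `[< m (D (q1, q2, k)) = 0%E >].
  apply/asboolP/eqP; rewrite eq_le measure_ge0 andbT -ze le_measure ?inE//;
    [exact: measurable_disc..|].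
  move=> w; rewrite /D /= => cw; rewrite (_ : z - w = (z - c) + (c - w)); last by ring.
  by rewrite (le_lt_trans (le_normcD _ _))// (lt_trans _ ke)// ltrD.
by rewrite /D /= normc_subC.
Qed.

Lemma supp_subset_circle : m (~` @unit_circle R : set (borelC R)) = 0%E ->
  supp m `<=` @unit_circle R.
Proof.
move=> mT z mz; apply: contrapT => Tz.
pose d := `|normc z - 1|.
have d0 : 0 < d by rewrite normr_gt0 subr_eq0; apply/eqP => z1; apply/Tz/unit_circleE.
have := supp_disc mz d0; rewrite ltNge => /negP; apply; rewrite -mT le_measure ?inE//.
- exact: measurable_disc.
- by apply: measurableC; exact: measurable_unit_circle.
move=> w /= zw /unit_circleE w1; move: zw; apply/negP; rewrite -leNgt /d -w1.
have h1 := le_normcD (z - w) w; have h2 := le_normcD (w - z) z.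
rewrite !subrK normc_subC in h1 h2.
by rewrite ler_norml; apply/andP; split; rewrite normc_subC; lra.
Qed.

End Support.

Section ApproximateEigenvectors.
Variables (R : realType) (alpha a : nat -> R[i]) (r : R) (phi : nat -> R[i] -> R[i]).
Hypotheses (r_ge0 : 0 <= r) (r_lt1 : r < 1) (alpha_le : forall n, normc (alpha n) <= r).
Hypothesis a_lt1 : forall n, (0 < n)%N -> normc (a n) < 1.
Hypothesis phi_rec : orf_recurrence alpha a phi.
Local Notation T := (@unit_circle R).
Implicit Types (z w : R[i]).
Local Notation psi := (nphi alpha phi).
Local Notation psis := (nphis alpha phi).
Local Notation lt_ := (ltil alpha a).
Variable m : {measure set (borelC R) -> \bar R}.
Hypothesis mTfin : (m (T : set (borelC R)) < +oo)%E.
Hypothesis phi_nice : forall n, cnice (phi n).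
Hypothesis phi_orth : forall i j, cint m (fun z => (phi i z)^* * phi j z) = (i == j)%:R.
Local Notation C0 := (4 / (1 - r ^+ 2)).
Local Notation K := ((1 - r)^-1).
Let npsi n : cnice (psi n) := cnice_psi alpha phi_nice n.
Let npsis n : cnice (psis n) := cnice_psis r_lt1 alpha_le phi_nice n.
Let bpsi n : nsq m (psi n) <= C0 :=
  nsq_psi r_ge0 r_lt1 alpha_le mTfin phi_nice phi_orth n.
Let bpsis n : nsq m (psis n) <= C0 :=
  nsq_psis r_ge0 r_lt1 alpha_le mTfin phi_nice phi_orth n.
Let bC0 : 0 <= C0 := C0_ge0 r_ge0 r_lt1.
Hypothesis rho_to0 : forall d : R, 0 < d ->
  exists N, forall n, (N <= n)%N -> rho a n ^+ 2 <= d.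

Let nzphi (l : R[i]) n : cnice (fun z => (z - l) * phi n z).
Proof.
by apply: cniceM => //; apply: cniceB; [exact: cnice_id|exact: cnice_cst].
Qed.

Lemma nsq_ltil_phi n : nsq m (fun z => (z - lt_ n.+1) * phi n.+1 z) <=
  K ^+ 2 * (2 * C0 * (rho a n.+2 ^+ 2 + rho a n.+1 ^+ 2)).
Proof.
pose f z := (rho a n.+2)%:C%C * psi n.+2 z.
pose g z := - (a n.+2 * (rho a n.+1)%:C%C) * psis n z.
have [nf ng] : cnice f /\ cnice g by split; exact: cniceZ.
rewrite (@eq_nsq _ _ _ (fun z => kap alpha a n.+1 * (f z + g z))); last first.
  move=> z Tz; rewrite (ltil_phi r_ge0 r_lt1 alpha_le a_lt1 phi_rec)// /f /g; ring.
rewrite nsqZ//; last exact: cniceD.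
apply: ler_pM; [exact: sqr_ge0|exact: nsq_ge0| |].
  rewrite ler_pXn2r ?nnegrE ?normc_ge0 ?invr_ge0 ?subr_ge0 ?(ltW r_lt1)//.
  exact: (normc_kap r_lt1 alpha_le a_lt1 (ltn0Sn n)).
rewrite (le_trans (nsqD mTfin nf ng))// !nsqZ// normcN normcM !normc_real exprMn.
rewrite !real_normK ?num_real//.
have b1 := bpsi n.+2; have b2 := bpsis n; have p1 := nsq_ge0 m (psi n.+2).
have p2 := nsq_ge0 m (psis n).
have r1 := sqr_ge0 (rho a n.+2); have r2 := sqr_ge0 (rho a n.+1).
have an : normc (a n.+2) ^+ 2 <= 1.
  by rewrite expr_le1 ?normc_ge0// ltW// a_lt1.
have an0 := sqr_ge0 (normc (a n.+2)).
set X1 := rho _ _ ^+ 2 in r1 *; set X2 := rho _ _ ^+ 2 in r2 *.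
rewrite [leRHS](_ : _ = 2 * (X1 * C0) + 2 * (X2 * C0)); last by ring.
apply: lerD; rewrite ler_pM2l//; first by rewrite ler_wpM2l.
by apply: ler_pM => //; [exact: mulr_ge0|exact: ler_piMl].
Qed.

Lemma nsq_phi2 i j (c1 c2 : R[i]) : (i < j)%N ->
  nsq m (fun z => c1 * phi i z + c2 * phi j z) = normc c1 ^+ 2 + normc c2 ^+ 2.
Proof.
move=> ij; pose h k := if k is k'.+1 then (j + k')%N else i.
pose c k := if k is 0 then c1 else c2.
have := @nsq_orthonormal _ m mTfin (fun k => phi (h k)) (fun k => phi_nice _) _ 2 c.
rewrite !big_ord_recr !big_ord0 /= !add0r => <-.
  by apply: eq_nsq => z _; rewrite !big_ord_recr big_ord0 /= add0r addn0.
move=> x y; rewrite phi_orth; congr (_%:R); congr nat_of_bool.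
case: x y => [|x] [|y]; rewrite ?eqxx//.
- by apply: ltn_eqF; exact: ltn_addr.
- by apply: gtn_eqF; exact: ltn_addr.
- by rewrite /h eqn_add2l.
Qed.

(* If l were isolated in the support, a combination of two of the phi_n which
   vanishes at l could not be an approximate eigenvector. *)
Lemma limit_eigenvalue_in_limit_point (l : R[i]) :
  seq_limit_points (lt_ : nat -> R[i]^o) l -> limit_point (supp m) l.
Proof.
move=> [u [u_incr /cvgCP u_l]]; apply: contrapT.
move=> /existsNP[U /not_implyP[/nbhsCP[d d0 dU] noU]].
have d4 : 0 < d ^+ 2 / 16 by rewrite divr_gt0// exprn_gt0.
have K0 : 0 < K by rewrite invr_gt0 subr_gt0.
have KC : 0 <= K ^+ 2 * (2 * C0) by rewrite mulr_ge0 ?sqr_ge0// mulr_ge0.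
have u_ge n : (n <= u n)%N.
  by elim: n => // n IH; apply: leq_ltn_trans IH _; exact: u_incr.
have [N N_small] : exists N, forall n, (N <= n)%N ->
    nsq m (fun z => (z - l) * phi (u n) z) <= d ^+ 2 / 4.
  (* [nsq_ltil_phi] then contributes at most d^2 / 16, and so does the distance d / 4 between l and
     the eigenvalue; [nsqD] doubles both. The [maxn 1] below keeps [u n] positive, as [nsq_ltil_phi]
     requires. *)
  pose e := d ^+ 2 / 16 / (2 * (K ^+ 2 * (2 * C0)) + 1).
  have e0 : 0 < e by rewrite divr_gt0// ltr_wpDl// mulr_ge0.
  have [N1 HN1] := rho_to0 e0.
  have [N2 _ HN2] := u_l (d / 4) (divr_gt0 d0 (ltr0n _ 4)).
  exists (maxn 1 (maxn N1 N2)) => n; rewrite !geq_max => /and3P[n1 nN1 nN2].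
  have := HN2 _ nN2; have := u_ge n.
  case: (u n) => [|k] nk; first by rewrite leqn0 in nk; rewrite (eqP nk) in n1.
  move=> kl; pose f z := (z - lt_ k.+1) * phi k.+1 z.
  rewrite (@eq_nsq _ _ _ (fun z => f z + - (l - lt_ k.+1) * phi k.+1 z)); last first.
    by move=> z _; rewrite /f; ring.
  rewrite (le_trans (nsqD mTfin (nzphi _ _) (cniceZ _ (phi_nice _))))//.
  rewrite nsqZ// normcN.
  have -> : nsq m (phi k.+1) = 1.
    by apply: complexI; rewrite -nsqE// phi_orth eqxx.
  have h1 := nsq_ltil_phi k; rewrite -/f in h1 *.
  have h2 : normc (l - lt_ k.+1) ^+ 2 <= (d / 4) ^+ 2.
    by rewrite ler_pXn2r ?nnegrE ?normc_ge0// ltW// divr_gt0.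
  have h3 := HN1 k.+1 (leq_trans nN1 nk); have h4 := HN1 k.+2 (leqW (leq_trans nN1 nk)).
  have h5 : nsq m f <= d ^+ 2 / 16.
    apply: (le_trans h1); rewrite mulrA.
    apply: (@le_trans _ _ (K ^+ 2 * (2 * C0) * (e + e))).
      by rewrite ler_wpM2l// lerD.
    rewrite /e; set Y := K ^+ 2 * _ in KC *.
    have Y1 : 0 < 2 * Y + 1 by rewrite ltr_wpDl// mulr_ge0.
    rewrite -mulrDl mulrA ler_pdivrMr//; nra.
  rewrite exprMn in h2; rewrite mulr1; lra.
have [nu1 nu2] := (N_small N (leqnn N), N_small N.+1 (leqnSn N)).
have ij : (u N < u N.+1)%N by exact: u_incr.
set i := u N in nu1 ij *; set j := u N.+1 in nu2 ij *.
have [c1 [c2 [c12 cl]]] : exists c1 c2 : R[i], 0 < normc c1 ^+ 2 + normc c2 ^+ 2 /\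
    c1 * phi i l + c2 * phi j l = 0.
  have [pj|pj] := eqVneq (phi j l) 0.
    by exists 0, 1; split; [rewrite normc0 normc1 expr0n add0r expr1n|rewrite mul0r pj mulr0 addr0].
  exists (phi j l), (- phi i l); split; last by ring.
  by rewrite ltr_pwDl ?sqr_ge0// exprn_gt0// normc_gt0.
pose g z := c1 * phi i z + c2 * phi j z.
have ng : cnice g by apply: cniceD; exact: cniceZ.
(* The point l may be an atom of m, so only the punctured disc is null; at l itself the inequality
   holds because g vanishes there. *)
pose V : set R[i]^o := [set w | normc (l - w) < d] `&` [set w | w != l].
have oV : open V.
  apply: openI; first exact: open_disc.
  apply/openCP => z /= zl; exists (normc (z - l)); first by rewrite normc_gt0 subr_eq0.
  by move=> w; apply: contraTneq => ->; rewrite ltxx.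
have mV : m (V : set (borelC R)) = 0%E.
  apply: null_open oV _ => z [zl zl0] mz; apply: noU; exists z; split => //.
  exact: dU.
have nzg : cnice (fun z => (z - l) * g z).
  by apply: cniceM => //; apply: cniceB; [exact: cnice_id|exact: cnice_cst].
have lower : d ^+ 2 * nsq m g <= nsq m (fun z => (z - l) * g z).
  rewrite /nsq -RIZ//; last exact: cnice_sqr.
  apply: (le_RI_ae mTfin _ mV).
  - exact: measurable_openC.
  - by apply: rniceM; [exact: rnice_cst|exact: cnice_sqr].
  - exact: cnice_sqr.
  move=> z Tz Vz; rewrite normcM exprMn.
  have [->|zl] := eqVneq z l; first by rewrite /g cl normc0 expr0n !mulr0.
  rewrite ler_wpM2r ?sqr_ge0// normc_subC ler_pXn2r ?nnegrE ?normc_ge0 ?(ltW d0)//.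
  by rewrite leNgt; apply/negP => dz; apply: Vz.
have upper : nsq m (fun z => (z - l) * g z) <= (normc c1 ^+ 2 + normc c2 ^+ 2) * (d ^+ 2 / 2).
  rewrite (@eq_nsq _ _ _ 
    (fun z => c1 * ((z - l) * phi i z) + c2 * ((z - l) * phi j z))); last first.
    by move=> z _; rewrite /g; ring.
  rewrite (le_trans (nsqD mTfin (cniceZ _ (nzphi _ _)) (cniceZ _ (nzphi _ _))))//.
  rewrite !nsqZ//.
  have := sqr_ge0 (normc c1); have := sqr_ge0 (normc c2); nra.
rewrite nsq_phi2// in lower.
have := le_trans lower upper; have := exprn_gt0 2 d0; nra.
Qed.

End ApproximateEigenvectors.

(** * Spans of Blaschke products and of orthogonal rational functions *)

Section LinearSpan.
Variable R : realType.
Local Notation T := (@unit_circle R).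
Implicit Types (z w : R[i]) (f : R[i] -> R[i]) (g h : nat -> R[i] -> R[i]).

(** Equality is required on the circle only, away from the poles. *)
Definition lspan g n f := exists c : nat -> R[i],
  forall z, T z -> f z = \sum_(k < n) c k * g k z.

Lemma eq_lspan g n f1 f2 : (forall z, T z -> f1 z = f2 z) -> lspan g n f1 -> lspan g n f2.
Proof. by move=> f12 [c fc]; exists c => z Tz; rewrite -f12// fc. Qed.

Lemma lspan_gen g n k : (k < n)%N -> lspan g n (g k).
Proof.
move=> kn; exists (fun j => (j == k)%:R) => z _.
rewrite (bigD1 (Ordinal kn))//= eqxx mul1r big1 ?addr0// => j jk.
rewrite (_ : (j == k :> nat) = false) ?mul0r//.
by apply/negbTE; apply: contra jk => /eqP jk; apply/eqP/val_inj.
Qed.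

Lemma lspanD g n f1 f2 : lspan g n f1 -> lspan g n f2 -> lspan g n (fun z => f1 z + f2 z).
Proof.
move=> [c1 h1] [c2 h2]; exists (fun k => c1 k + c2 k) => z Tz.
by rewrite h1// h2// -big_split; apply: eq_bigr => k _; rewrite mulrDl.
Qed.

Lemma lspanZ g n c f : lspan g n f -> lspan g n (fun z => c * f z).
Proof.
move=> [d h1]; exists (fun k => c * d k) => z Tz.
by rewrite h1// mulr_sumr; apply: eq_bigr => k _; rewrite mulrA.
Qed.

Lemma lspan_sum g n p (c : nat -> R[i]) h : (forall k, (k < p)%N -> lspan g n (h k)) ->
  lspan g n (fun z => \sum_(k < p) c k * h k z).
Proof.
elim: p => [|p IH] hk.
  by exists (fun=> 0) => z _; rewrite big_ord0 big1// => k _; rewrite mul0r.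
apply: (@eq_lspan _ _ (fun z => \sum_(k < p) c k * h k z + c p * h p z)).
  by move=> z _; rewrite big_ord_recr.
apply: lspanD; last by apply: lspanZ; exact: hk.
by apply: IH => k kp; apply: hk; exact: ltnW.
Qed.

Lemma lspan_trans g h n p f : (forall k, (k < p)%N -> lspan g n (h k)) ->
  lspan h p f -> lspan g n f.
Proof.
move=> gh [c fc]; apply: (@eq_lspan _ _ (fun z => \sum_(k < p) c k * h k z)).
  by move=> z /fc.
exact: lspan_sum.
Qed.

Lemma lspan_le g n p f : (n <= p)%N -> lspan g n f -> lspan g p f.
Proof.
move=> np; apply: lspan_trans => k kn; apply: lspan_gen; exact: leq_trans np.
Qed.

End LinearSpan.

Section BlaschkeSpan.
Variables (R : realType) (alpha : nat -> R[i]) (r : R).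
Hypotheses (r_ge0 : 0 <= r) (r_lt1 : r < 1) (alpha_le : forall n, normc (alpha n) <= r).
Local Notation T := (@unit_circle R).
Local Notation B := (blaschke alpha).
Implicit Types (z w : R[i]).

(* A Moebius function of z is a Moebius function of any zeta_j, which trades the
   pole of zeta_n for that of zeta_(j+1). *)
Lemma zeta_relation n j : exists x y x' y', x != 0 /\
  forall z, T z -> zeta alpha n z * (x + y * zeta alpha j z) = x' + y' * zeta alpha j z.
Proof.
pose S := (sal alpha j)%:C%C ^+ 2.
have S0 : S != 0 by rewrite expf_neq0// (salC_neq0 r_ge0 r_lt1 alpha_le).
exists ((1 - (alpha n)^* * alpha j) / S), (((alpha j)^* - (alpha n)^*) / S).
exists ((alpha j - alpha n) / S), ((1 - alpha n * (alpha j)^*) / S); split.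
  rewrite mulf_neq0 ?invr_eq0//; apply: (varpi_neq0 r_lt1 alpha_le).
  by rewrite (le_trans (alpha_le j))// ltW.
move=> w Tw; have w1 := T_le1 Tw.
have := varpi_neq0 r_lt1 alpha_le n w1; have := varpi_neq0 r_lt1 alpha_le j w1.
move: S0; rewrite /S (salC_sqr r_lt1 alpha_le) /zeta /varpi_star /varpi.
by move=> S0 h1 h2; field; rewrite S0 h1 h2.
Qed.

(** Downward induction from zeta_(n+1) B_n = B_(n+1): multiplying [zeta_relation] by B_k expresses
    zeta_(n+1) B_k through B_k, B_(k+1) and zeta_(n+1) B_(k+1). *)
Lemma lspan_zeta_blaschke n j : (j <= n)%N ->
  lspan B n.+2 (fun z => zeta alpha n.+1 z * B j z).
Proof.
move=> jn; rewrite -(subKn jn); elim: (n - j)%N (leq_subr j n) => [|d IH] dn.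
  rewrite subn0; apply: (@eq_lspan _ _ _ (B n.+1)); last exact: lspan_gen.
  by move=> z _; rewrite blaschkeS mulrC.
have {}IH := IH (ltnW dn); set k := (n - d.+1)%N.
have kE : (n - d)%N = k.+1 by rewrite /k subnSK.
rewrite kE in IH.
have [x [y [x' [y' [x0 xy]]]]] := zeta_relation n.+1 k.+1.
have kn : (k <= n)%N by exact: leq_subr.
apply: (@eq_lspan _ _ _ (fun z => x^-1 * (x' * B k z + y' * B k.+1 z +
    - y * (zeta alpha n.+1 z * B k.+1 z)))).
  move=> z Tz; have := xy z Tz; rewrite !blaschkeS => h.
  apply/esym/(mulfI x0); rewrite [RHS]mulrA mulfV// mul1r.
  transitivity (B k z * (x' + y' * zeta alpha k.+1 z)
    - B k z * y * zeta alpha n.+1 z * zeta alpha k.+1 z); last by ring.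
  by rewrite -h; ring.
apply/lspanZ/lspanD; last exact: lspanZ.
by apply: lspanD; apply/lspanZ/lspan_gen => //; rewrite ltnS; exact: leq_trans kn _.
Qed.

Lemma lspan_mul_zeta n f (u v : R[i]) : lspan B n.+1 f ->
  lspan B n.+2 (fun z => f z * (u + v * zeta alpha n.+1 z)).
Proof.
move=> Bf; apply: (@eq_lspan _ _ _ (fun z => u * f z + v * (zeta alpha n.+1 z * f z))).
  by move=> z _; ring.
apply: lspanD; first by apply: lspanZ; exact: lspan_le Bf.
apply: lspanZ; case: Bf => c fc.
apply: (@eq_lspan _ _ _ (fun z => \sum_(k < n.+1) c k * (zeta alpha n.+1 z * B k z))).
  by move=> z Tz; rewrite fc// mulr_sumr; apply: eq_bigr => k _; rewrite mulrCA.
apply: (@lspan_sum _ _ _ n.+1 c (fun k z => zeta alpha n.+1 z * B k z)) => k kn.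
exact: (@lspan_zeta_blaschke n k kn).
Qed.

Lemma lspan_prod_zeta n K f (u v : nat -> R[i]) : lspan B n.+1 f ->
  lspan B (n + K).+1 (fun z => f z * \prod_(k < K) (u k + v k * zeta alpha (n + k).+1 z)).
Proof.
move=> Bf; elim: K => [|K IH].
  by rewrite addn0; apply: eq_lspan Bf => z _; rewrite big_ord0 mulr1.
rewrite addnS; apply: eq_lspan (lspan_mul_zeta (u K) (v K) IH) => z _.
by rewrite big_ord_recr /= mulrA.
Qed.

Variable phi : nat -> R[i] -> R[i].
Variable m : {measure set (borelC R) -> \bar R}.
Hypothesis mTfin : (m (T : set (borelC R)) < +oo)%E.
Hypothesis phi_nice : forall n, cnice (phi n).
Hypothesis phi_orth : forall i j, cint m (fun z => (phi i z)^* * phi j z) = (i == j)%:R.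
Hypothesis phi_span : forall n, lspan B n.+1 (phi n).

(** The change of basis is triangular. Its diagonal coefficients do not vanish: otherwise phi_n
    would be a combination of earlier phi_k, hence orthogonal to itself. *)
Lemma blaschke_lspan n : lspan phi n.+1 (B n).
Proof.
elim/ltn_ind: n => n IH; have [c phic] := phi_span n.
pose f z := \sum_(k < n) c k * B k z.
have ff : lspan phi n f.
  by apply: lspan_sum => k kn; exact: lspan_le (IH _ kn).
have phiE z : T z -> phi n z = f z + c n * B n z.
  by move=> Tz; rewrite phic// big_ord_recr.
have cn0 : c n != 0.
  apply/eqP => cn0; have [d fd] := ff.
  have := phi_orth n n; rewrite eqxx.
  rewrite (@eq_cint _ _ _ (fun z => (phi n z)^* * \sum_(k < n) d k * phi k z)); last first.
    by move=> z Tz; congr (_ * _); rewrite -fd// phiE// cn0 mul0r addr0.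
  rewrite (cint_orthonormal_coef mTfin phi_nice phi_orth) ltnn.
  by move=> /esym/eqP; rewrite oner_eq0.
apply: (@eq_lspan _ _ _ (fun z => (c n)^-1 * (phi n z + (- 1) * f z))).
  move=> z Tz; apply/esym/(mulfI cn0); rewrite [RHS]mulrA mulfV// mul1r phiE//; ring.
apply/lspanZ/lspanD; first exact: lspan_gen.
by apply: lspanZ; exact: lspan_le ff.
Qed.

Lemma lspan_blaschke_phi n f : lspan B n f -> lspan phi n f.
Proof.
by apply: lspan_trans => k kn; exact: lspan_le (blaschke_lspan k).
Qed.

End BlaschkeSpan.

Section LimitPoints.
Variable R : realType.
Implicit Types (z w l : R[i]).

Lemma not_seq_limit_point (x : nat -> R[i]) l :
  ~ seq_limit_points (x : nat -> R[i]^o) l ->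
  exists2 d : R, 0 < d & exists N, forall n, (N <= n)%N -> d <= normc (x n - l).
Proof.
move=> xl; apply: contrapT => H; apply: xl.
(* The condition 0 < d is put inside the conclusion so that a choice function exists on all pairs
   (N, d). *)
have near N (d : R) : exists n, (N <= n)%N /\ (0 < d -> normc (x n - l) < d).
  have [d0|d0] := ltP 0 d; last by exists N.
  apply: contrapT => H'; apply: H; exists d => //; exists N => n Nn.
  by rewrite leNgt; apply/negP => nd; apply: H'; exists n.
have /choice [f fP] : forall p : nat * R, exists n,
    (p.1 <= n)%N /\ (0 < p.2 -> normc (x n - l) < p.2).
  by move=> [N d]; exact: near.
pose s := fix s k := if k is k'.+1 then f ((s k').+1, k.+1%:R^-1) else f (0%N, 1).
exists s; split.
  apply: homo_ltn; first exact: ltn_trans.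
  by move=> k; have [] := fP ((s k).+1, k.+2%:R^-1).
have sk k : normc (x (s k) - l) < k.+1%:R^-1.
  case: k => [|k]; first by have [_ /=] := fP (0%N, 1); rewrite invr1; apply.
  by have [_] := fP ((s k).+1, k.+2%:R^-1); apply; rewrite invr_gt0.
apply/cvgCP => e e0; near=> k.
rewrite normc_subC (lt_trans (sk k))//.
near: k; exists (Num.truncn e^-1) => // k /= ek.
rewrite -[e]invrK ltf_pV2 ?posrE ?invr_gt0//.
by rewrite (lt_le_trans (truncnS_gt _))// ler_nat.
Unshelve. all: by end_near.
Qed.

Lemma limit_point_distinct (E : set R[i]^o) l n (e : R) : limit_point E l -> 0 < e ->
  exists x : nat -> R[i], (forall i, (i < n)%N -> E (x i) /\ normc (x i - l) < e) /\
    (forall i j, (i < n)%N -> (j < n)%N -> x i = x j -> i = j).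
Proof.
move=> El e0.
(* The induction carries a positive lower bound d for the distances to l; a point of E closer than
   d, other than l, is then new. *)
suff [x [d [_ _ xd xinj]]] : exists x : nat -> R[i], exists d : R, [/\ 0 < d, d <= e,
    forall i, (i < n)%N -> [/\ E (x i), d <= normc (x i - l) & normc (x i - l) < e] &
    forall i j, (i < n)%N -> (j < n)%N -> x i = x j -> i = j].
  by exists x; split => // i /xd[].
elim: n => [|n [x [d [d0 de xd xinj]]]]; first by exists (fun=> 0), e.
have [|y [yl Ey ly]] := El [set w | normc (l - w) < d].
  by apply/nbhsCP; exists d.
have yl' : normc (y - l) < d by rewrite normc_subC.
have yx i : (i < n)%N -> y <> x i.
  by move=> /xd[_ h _] yxi; move: h; rewrite -yxi leNgt yl'.
exists (fun i => if i == n then y else x i), (normc (y - l)); split.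
- by rewrite normc_gt0 subr_eq0.
- exact: le_trans (ltW yl') de.
- move=> i; rewrite ltnS leq_eqVlt; case: eqVneq => [_ _|_ /= /xd[h1 h2 h3]].
    by split=> //; exact: lt_le_trans yl' de.
  by split=> //; exact: le_trans (ltW yl') h2.
- move=> i j; rewrite !ltnS (leq_eqVlt i) (leq_eqVlt j).
  case: (eqVneq i n) => [->|_]; case: (eqVneq j n) => [->|_] //= hi hj.
  + by move/yx: hj.
  + by move=> /esym; move/yx: hi.
  + exact: xinj.
Qed.

Lemma common_lower_bound n (F : nat -> \bar R) : (forall i, (i < n)%N -> (0 < F i)%E) ->
  exists2 c : R, 0 < c & forall i, (i < n)%N -> (c%:E <= F i)%E.
Proof.
elim: n => [|n IH] F0; first by exists 1.
have [c c0 cF] := IH (fun i ni => F0 i (ltnW ni)).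
have [d d0 dF] : exists2 d : R, 0 < d & (d%:E <= F n)%E.
  have := F0 n (ltnSn n); case: (F n) => [x|_|//]; first by rewrite lte_fin; exists x.
  by exists 1; rewrite ?leey.
exists (Num.min c d) => [|i]; first by rewrite lt_min c0.
rewrite ltnS leq_eqVlt => /orP[/eqP ->|/cF].
  by apply: le_trans dF; rewrite lee_fin ge_min lexx orbT.
by apply: le_trans; rewrite lee_fin ge_min lexx.
Qed.

Lemma geometric_gap (x y A B : R) : 0 <= x -> x < y -> 0 < A -> 0 <= B ->
  exists K, B * x ^+ K < A * y ^+ K.
Proof.
move=> x0 xy A0 B0; have y0 : 0 < y by exact: le_lt_trans xy.
have q1 : `|x / y| < 1 by rewrite ger0_norm ?divr_ge0 ?(ltW y0)// ltr_pdivrMr// mul1r.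
have B1 : 0 < B + 1 by rewrite ltr_wpDl.
have /cvgrPdist_lt /(_ (A / (B + 1))) := cvg_expr q1.
rewrite divr_gt0// => /(_ isT)[K _ /(_ K (leqnn K))].
rewrite sub0r normrN ger0_norm ?exprn_ge0 ?divr_ge0 ?(ltW y0)// => h; exists K.
rewrite expr_div_n ltr_pdivrMr ?exprn_gt0// mulrAC ltr_pdivlMr// in h.
apply: le_lt_trans h; rewrite mulrC ler_wpM2l ?exprn_ge0//; lra.
Qed.

End LimitPoints.

Section Lipschitz.
Variable R : realType.
Local Notation T := (@unit_circle R).
Implicit Types (z w : R[i]) (f g : R[i] -> R[i]).

(** One constant bounds both values and increments, which is enough to pass to products. *)
Definition lip f (L : R) := (forall z, T z -> normc (f z) <= L) /\
  (forall z w, T z -> T w -> normc (f z - f w) <= L * normc (z - w)).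

Lemma lip_ge0 f L : lip f L -> 0 <= L.
Proof.
by move=> [h _]; apply: le_trans (normc_ge0 _) (h 1 _); apply/unit_circleE/normc1.
Qed.

Lemma lipM f g L1 L2 : lip f L1 -> lip g L2 ->
  lip (fun z => f z * g z) (2 * (L1 * L2)).
Proof.
move=> fL gL; have [L10 L20] := (lip_ge0 fL, lip_ge0 gL).
have L12 : 0 <= L1 * L2 by exact: mulr_ge0.
case: fL gL => [f1 f2] [g1 g2]; split=> [z Tz|z w Tz Tw].
  rewrite normcM (le_trans (ler_pM (normc_ge0 _) (normc_ge0 _) (f1 _ Tz) (g1 _ Tz)))//; lra.
rewrite (_ : _ - _ = f z * (g z - g w) + (f z - f w) * g w); last by ring.
rewrite (le_trans (le_normcD _ _))// !normcM -mulrA mulr2n mulrDl mul1r.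
have zw := normc_ge0 (z - w).
apply: lerD.
  by rewrite -mulrA; apply: ler_pM; rewrite ?normc_ge0 ?f1 ?g2.
by rewrite mulrAC; apply: ler_pM; rewrite ?normc_ge0 ?g1 ?f2.
Qed.

Lemma lip_cst c : exists L, lip (fun=> c) L.
Proof.
exists (normc c); split=> // z w _ _.
by rewrite subrr normc0 mulr_ge0 ?normc_ge0.
Qed.

Lemma lip_prod n (f : nat -> R[i] -> R[i]) : (forall k, exists L, lip (f k) L) ->
  exists L, lip (fun z => \prod_(k < n) f k z) L.
Proof.
move=> fL; elim: n => [|n [L IH]].
  have [L L1] := lip_cst 1; exists L.
  by under eq_fun do rewrite big_ord0.
have [L' fL'] := fL n; exists (2 * (L * L')).
by under eq_fun do rewrite big_ord_recr /=; exact: lipM.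
Qed.

End Lipschitz.

Section LimitPointsOfSupport.
Variables (R : realType) (alpha a : nat -> R[i]) (r : R) (phi : nat -> R[i] -> R[i]).
Hypotheses (r_ge0 : 0 <= r) (r_lt1 : r < 1) (alpha_le : forall n, normc (alpha n) <= r).
Hypothesis a_lt1 : forall n, (0 < n)%N -> normc (a n) < 1.
Hypothesis phi_rec : orf_recurrence alpha a phi.
Local Notation T := (@unit_circle R).
Implicit Types (z w : R[i]).
Local Notation psi := (nphi alpha phi).
Local Notation psis := (nphis alpha phi).
Local Notation lt_ := (ltil alpha a).
Variable m : {measure set (borelC R) -> \bar R}.
Hypothesis mTfin : (m (T : set (borelC R)) < +oo)%E.
Hypothesis phi_nice : forall n, cnice (phi n).
Hypothesis phi_orth : forall i j, cint m (fun z => (phi i z)^* * phi j z) = (i == j)%:R.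
Local Notation C0 := (4 / (1 - r ^+ 2)).
Local Notation K := ((1 - r)^-1).
Let npsi n : cnice (psi n) := cnice_psi alpha phi_nice n.
Let npsis n : cnice (psis n) := cnice_psis r_lt1 alpha_le phi_nice n.
Let bC0 : 0 <= C0 := C0_ge0 r_ge0 r_lt1.
Hypothesis rho_to0 : forall d : R, 0 < d ->
  exists N, forall n, (N <= n)%N -> rho a n ^+ 2 <= d.

Let nlin (c : nat -> R[i]) (g : nat -> R[i] -> R[i]) M : (forall k, cnice (g k)) ->
  cnice (fun z => \sum_(k < M) c k * g k z).
Proof. by move=> ng; apply: (@cnice_sum _ M (fun k z => c k * g k z)) => k; exact: cniceZ. Qed.

(* Up to a small operator, multiplication by z is diagonal on the tail of
   (phi_n), with eigenvalues close to the ltil n. *)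
Lemma spectral_gap l (eta : R) N : 0 < eta ->
  (forall n, (N <= n)%N -> eta <= normc (lt_ n - l)) ->
  exists p, forall M (c : nat -> R[i]),
    let f := fun z => \sum_(k < M) c k * phi (p.+1 + k)%N z in
    eta ^+ 2 / 4 * nsq m f <= nsq m (fun z => (z - l) * f z).
Proof.
move=> eta0 Hl; have K0 : 0 < K by rewrite invr_gt0 subr_gt0.
(* 52 = 2 (2 + 2 * 12): [nsqD] is used twice, with the bound C0 for sums of psi_n and 12 C0 for sums
   of psi_n^*. The value 1/6 in [e] is the threshold of [nsq_sum_psis]. *)
pose Y := 52 * C0 * K ^+ 2 + 1.
have Y0 : 0 < Y by rewrite ltr_wpDl// mulr_ge0 ?sqr_ge0// mulr_ge0.
pose e := Num.min (1 / 6) (eta ^+ 2 / 2 / Y).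
have e0 : 0 < e by rewrite lt_min divr_gt0// divr_gt0// divr_gt0// exprn_gt0.
have eY : 52 * C0 * K ^+ 2 * e <= eta ^+ 2 / 2.
  have h : e <= eta ^+ 2 / 2 / Y by rewrite ge_min lexx orbT.
  rewrite ler_pdivlMr// in h; apply: le_trans h; rewrite mulrC ler_wpM2l ?(ltW e0)//.
  by rewrite /Y lerDl.
have [N1 HN1] := rho_to0 e0; pose p := maxn N N1; exists p => M c /=.
have rp n : (p <= n)%N -> rho a n ^+ 2 <= e.
  by rewrite geq_max => /andP[_]; exact: HN1.
set f := fun z => _; pose S := \sum_(k < M) normc (c k) ^+ 2.
have nf : cnice f by exact: (nlin c M (fun k => phi_nice (p.+1 + k)%N)).
have fS : nsq m f = S by exact: (nsq_phi_shift mTfin phi_nice phi_orth).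
(* The exactly diagonal part; its difference with (z - l) f is E1 + E2, both carrying a factor rho.
   As [E2] reaches one index lower, f starts at p + 1. *)
pose D z := \sum_(k < M) (c k * (lt_ (p.+1 + k)%N - l)) * phi (p.+1 + k)%N z.
pose b1 k := - (c k * kap alpha a (p.+1 + k)%N * (rho a (p.+2 + k)%N)%:C%C).
pose b2 k := c k * kap alpha a (p.+1 + k)%N * a (p.+2 + k)%N * (rho a (p.+1 + k)%N)%:C%C.
pose E1 z := \sum_(k < M) b1 k * psi (p.+2 + k)%N z.
pose E2 z := \sum_(k < M) b2 k * psis (p + k)%N z.
have nE1 : cnice E1 by exact: (nlin b1 M (fun k => npsi (p.+2 + k)%N)).
have nE2 : cnice E2 by exact: (nlin b2 M (fun k => npsis (p + k)%N)).
have nzf : cnice (fun z => (z - l) * f z).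
  by apply: cniceM => //; apply: cniceB; [exact: cnice_id|exact: cnice_cst].
have DE z : T z -> D z = (z - l) * f z + (E1 z + E2 z).
  move=> Tz; rewrite /D /f /E1 /E2 mulr_sumr -!big_split; apply: eq_bigr => k _ /=.
  have := ltil_phi r_ge0 r_lt1 alpha_le a_lt1 phi_rec (p + k)%N Tz.
  rewrite /b1 /b2 !addSn => h.
  transitivity (c k * ((z - l) * phi (p + k).+1 z)
    - c k * ((z - lt_ (p + k).+1) * phi (p + k).+1 z)); first by ring.
  by rewrite h; ring.
have lowD : eta ^+ 2 * S <= nsq m D.
  rewrite /D (nsq_phi_shift mTfin phi_nice phi_orth p.+1 M
    (fun k => c k * (lt_ (p.+1 + k)%N - l))) /S mulr_sumr ler_sum// => k _.
  rewrite normcM exprMn mulrC ler_wpM2l ?sqr_ge0// ler_pXn2r ?nnegrE ?normc_ge0 ?(ltW eta0)//.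
  by apply: Hl; rewrite addSn (leq_trans (leq_maxl N N1))// leqW// leq_addr.
have kapK k : normc (kap alpha a (p.+1 + k)%N) ^+ 2 <= K ^+ 2.
  rewrite ler_pXn2r ?nnegrE ?normc_ge0 ?(ltW K0)//.
  by apply: (normc_kap r_lt1 alpha_le a_lt1).
have bnd (x y w t : R) : 0 <= x -> 0 <= y -> 0 <= w -> y <= K ^+ 2 -> w <= 1 ->
    0 <= t -> t <= e -> x * y * w * t <= K ^+ 2 * e * x.
  move=> x0 y0 w0 yK w1 t0 te; rewrite -!(mulrA x) [leRHS]mulrC -mulrA ler_wpM2l//.
  apply: ler_pM => //; first exact: mulr_ge0.
  by apply: le_trans te; rewrite ler_piMl.
have E1S : nsq m E1 <= C0 * (K ^+ 2 * e * S).
  apply: (le_trans (nsq_sum_psi r_ge0 r_lt1 alpha_le mTfin phi_nice phi_orth p.+2 M b1)).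
  rewrite ler_wpM2l// /S mulr_sumr ler_sum// => k _.
  rewrite /b1; move: (kap _ _ _) (kapK k) => kp kpK; rewrite normcN !normcM !exprMn.
  rewrite normc_real real_normK ?num_real//.
  rewrite -(mulr1 (normc (c k) ^+ 2 * _)); apply: bnd; rewrite ?sqr_ge0//.
  by apply: rp; rewrite !addSn !leqW// leq_addr.
have E2S : nsq m E2 <= 12 * C0 * (K ^+ 2 * e * S).
  have r6 n : (p < n)%N -> rho a n ^+ 2 <= 1 / 6.
    by move=> /ltnW /rp h; apply: le_trans h _; rewrite ge_min lexx.
  apply: (le_trans (nsq_sum_psis r_ge0 r_lt1 alpha_le a_lt1 phi_rec mTfin phi_nice phi_orth
    M b2 r6)).
  apply: ler_wpM2l; first exact: mulr_ge0.
  rewrite /S mulr_sumr ler_sum// => k _.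
  rewrite /b2; move: (kap _ _ _) (kapK k) => kp kpK; rewrite !normcM !exprMn.
  rewrite normc_real real_normK ?num_real//.
  apply: bnd; rewrite ?sqr_ge0//.
    by rewrite expr_le1 ?normc_ge0// ltW// a_lt1// !addSn.
  by apply: rp; rewrite !addSn leqW// leq_addr.
have S0 : 0 <= S by apply: sumr_ge0 => k _; exact: sqr_ge0.
have up : nsq m D <= 2 * nsq m (fun z => (z - l) * f z) + 2 * (2 * nsq m E1 + 2 * nsq m E2).
  rewrite (eq_nsq m DE) (le_trans (nsqD mTfin nzf (cniceD nE1 nE2)))// lerD2l ler_pM2l//.
  exact: nsqD.
have eYS : 52 * C0 * K ^+ 2 * e * S <= eta ^+ 2 / 2 * S by rewrite ler_wpM2r.
rewrite fS.
have E12 : 2 * (2 * nsq m E1 + 2 * nsq m E2) <= 52 * C0 * K ^+ 2 * e * S.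
  rewrite [leRHS](_ : _ = 2 * (2 * (C0 * (K ^+ 2 * e * S)) + 2 * (12 * C0 * (K ^+ 2 * e * S))));
    last by ring.
  by rewrite ler_pM2l// lerD// ler_pM2l.
lra.
Qed.

End LimitPointsOfSupport.

Lemma cnice_prod (R : realType) n (f : nat -> R[i] -> R[i]) : (forall k, cnice (f k)) ->
  cnice (fun z => \prod_(k < n) f k z).
Proof.
move=> nf; elim: n => [|n IH].
  by under eq_fun do rewrite big_ord0; exact: cnice_cst.
by under eq_fun do rewrite big_ord_recr /=; exact: cniceM.
Qed.

Lemma measure_setI_circle (R : realType) (m : {measure set (borelC R) -> \bar R})
    (A : set (borelC R)) : m (~` @unit_circle R : set (borelC R)) = 0%E ->
  measurable A -> (m A <= m (A `&` @unit_circle R))%E.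
Proof.
move=> mTC mA; pose T := @unit_circle R : set (borelC R).
have mT : measurable T := @measurable_unit_circle R.
have mAT : measurable (A `&` T) by exact: measurableI.
have mC : measurable (~` T) by exact: measurableC.
have mC0 : m (~` T) = 0%E by exact: mTC.
have : (m ((A `&` T) `|` ~` T) <= m (A `&` T) + m (~` T))%E by exact: measureU2.
rewrite mC0 adde0; apply: le_trans.
apply: le_measure; rewrite ?inE//; first exact: measurableU.
by move=> z Az; have [Tz|Tz] := pselect (T z); [left|right].
Qed.

(** The parallelogram identity: the mean of two unimodular numbers falls short of modulus 1 by a
    quantity governed by their distance. *)
Lemma sqr_normc_mid (R : realType) (u v : R[i]) : normc u = 1 -> normc v = 1 ->
  normc (u / 2 + 2^-1 * v) ^+ 2 = 1 - normc (u - v) ^+ 2 / 4.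
Proof.
move=> u1 v1; have : normc u ^+ 2 = 1 by rewrite u1 expr1n.
have : normc v ^+ 2 = 1 by rewrite v1 expr1n.
have -> : u / 2 + 2^-1 * v = (2^-1)%:C%C * (u + v).
  by rewrite fmorphV rmorph_nat; field.
rewrite normcM normc_real exprMn real_normK ?num_real// !sqr_normcE.
case: u v {u1 v1} => a b [c d] /= h1 h2.
have -> : (2^-1 : R) ^+ 2 = 1 / 4 by field.
lra.
Qed.

Lemma kernel_vector (F : fieldType) n (A : 'M[F]_(n.+1, n)) :
  exists2 t : 'rV[F]_n.+1, t != 0 & t *m A = 0.
Proof.
have : kermx A != 0.
  by rewrite -mxrank_eq0 mxrank_ker subn_eq0 -ltnNge ltnS rank_leq_col.
by move=> /rowV0Pn[t /sub_kermxP tA t0]; exists t.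
Qed.

(** * Interpolation and peak functions in the spans of Blaschke products *)

Section PeakFunctions.
Variables (R : realType) (alpha : nat -> R[i]) (r : R).
Hypotheses (r_ge0 : 0 <= r) (r_lt1 : r < 1) (alpha_le : forall n, normc (alpha n) <= r).
Local Notation T := (@unit_circle R).
Local Notation B := (blaschke alpha).
Implicit Types (z w : R[i]).

Lemma zeta_inj n z w : T z -> T w -> zeta alpha n z = zeta alpha n w -> z = w.
Proof.
move=> Tz Tw /eqP; rewrite -subr_eq0.
rewrite (zetaB r_lt1 alpha_le) ?T_le1// mulf_eq0 subr_eq0 => /orP[/eqP//|].
rewrite mulf_eq0 invr_eq0 expf_eq0 /= (negbTE (salC_neq0 r_ge0 r_lt1 alpha_le n)).
by rewrite mulf_eq0 !(negbTE (varpi_neq0 r_lt1 alpha_le n _)) ?T_le1.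
Qed.

Lemma lip_affine_zeta n (u v : R[i]) : exists L, lip (fun z => u + v * zeta alpha n z) L.
Proof.
have r1 : 0 < 1 - r by rewrite subr_gt0.
have k0 : 0 <= ((1 - r) ^+ 2)^-1 by rewrite invr_ge0 sqr_ge0.
exists (normc u + normc v + normc v * ((1 - r) ^+ 2)^-1); split=> [z Tz|z w Tz Tw].
  rewrite (le_trans (le_normcD _ _))// normcM (normc_zeta r_lt1 alpha_le)// mulr1.
  by rewrite lerDl mulr_ge0 ?normc_ge0.
rewrite (_ : _ - _ = v * (zeta alpha n z - zeta alpha n w)); last by ring.
rewrite normcM (le_trans (ler_wpM2l (normc_ge0 _)
  (normc_zetaB_le r_lt1 alpha_le n (T_le1 Tz) (T_le1 Tw))))//.
rewrite [normc (z - w) / _]mulrC mulrA ler_wpM2r ?normc_ge0//.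
by rewrite lerDr addr_ge0 ?normc_ge0.
Qed.

(** Lagrange interpolation with a different coordinate in each factor: the k-th uses zeta_(k+1), so
    that the product of n factors stays in the span of B_0, ..., B_n. [bump i] enumerates the nodes
    other than the i-th. *)
Lemma interpolation n (x : nat -> R[i]) : (forall i, (i <= n)%N -> T (x i)) ->
  (forall i j, (i < n.+1)%N -> (j < n.+1)%N -> x i = x j -> i = j) ->
  exists ell : nat -> R[i] -> R[i], forall i,
    [/\ cnice (ell i), lspan B n.+1 (ell i), exists L, lip (ell i) L
      & (i <= n)%N -> forall j, (j <= n)%N -> ell i (x j) = (i == j)%:R].
Proof.
move=> Tx xinj.
pose den i k := zeta alpha k.+1 (x i) - zeta alpha k.+1 (x (bump i k)).
pose u i k := - zeta alpha k.+1 (x (bump i k)) / den i k.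
pose v i k := (den i k)^-1.
exists (fun i z => \prod_(k < n) (u i k + v i k * zeta alpha k.+1 z)) => i; split.
- apply: (@cnice_prod _ n (fun k z => u i k + v i k * zeta alpha k.+1 z)) => k.
  by apply: cniceD; [exact: cnice_cst|apply: cniceZ; exact: (cnice_zeta r_lt1 alpha_le)].
- have B1 : lspan B 1 (fun=> 1).
    by apply: eq_lspan (lspan_gen _ (ltn0Sn 0)) => z _; exact: blaschke0.
  apply: eq_lspan (lspan_prod_zeta r_ge0 r_lt1 alpha_le n (u i) (v i) B1) => z _.
  by rewrite mul1r.
- apply: (@lip_prod _ n (fun k z => u i k + v i k * zeta alpha k.+1 z)) => k.
  exact: lip_affine_zeta.
move=> ni j nj.
have bn k : (k < n)%N -> (bump i k <= n)%N.
  by move=> kn; rewrite /bump; case: (leqP i k) => _; [exact: kn|exact: ltnW].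
have den0 k : (k < n)%N -> den i k != 0.
  move=> kn; rewrite subr_eq0; apply/eqP => /zeta_inj H.
  have /xinj : x i = x (bump i k) by apply: H; apply: Tx => //; exact: bn.
  by rewrite !ltnS => /(_ ni (bn _ kn))/eqP; rewrite (negbTE (neq_bump _ _)).
have [<-|ij] := eqVneq i j.
  rewrite big1// => k _; have := den0 k (ltn_ord k); rewrite /u /v => d0.
  by rewrite [_^-1 * _]mulrC -mulrDl addrC mulfV.
have bK : bump i (unbump i j) = j by apply: unbumpK; rewrite inE eq_sym.
have kn : (unbump i j < n)%N.
  rewrite /unbump; case: (ltnP i j) => /= h; first by rewrite subn1; case: j h nj {ij bK}.
  by rewrite subn0; rewrite ltn_neqAle nj andbT; apply: contra ij => /eqP jn;
     rewrite eqn_leq h jn ni.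
rewrite (bigD1 (Ordinal kn))//= /u /v bK [_^-1 * _]mulrC -mulrDl addNr !mul0r.
by [].
Qed.

Lemma normc_peak n K l z : T z -> T l ->
  normc (\prod_(k < K) (zeta alpha (n + k).+1 l / 2 + 2^-1 * zeta alpha (n + k).+1 z)) ^+ 2 =
  \prod_(k < K) (1 - normc (zeta alpha (n + k).+1 l - zeta alpha (n + k).+1 z) ^+ 2 / 4).
Proof.
move=> Tz Tl; elim: K => [|K IH]; first by rewrite !big_ord0 normc1 expr1n.
rewrite !big_ord_recr /= normcM exprMn IH sqr_normc_mid//; exact: (normc_zeta r_lt1 alpha_le).
Qed.

Lemma peak_far n K l z (b : R) : T z -> T l -> 0 <= b -> b <= normc (z - l) ->
  normc (\prod_(k < K) (zeta alpha (n + k).+1 l / 2 + 2^-1 * zeta alpha (n + k).+1 z)) ^+ 2 <=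
  (1 - ((1 - r ^+ 2) / (1 + r) ^+ 2 * b) ^+ 2 / 4) ^+ K.
Proof.
move=> Tz Tl b0 bz; rewrite normc_peak// -[in leRHS](card_ord K) -prodr_const.
apply: ler_prod => k _; rewrite -sqr_normc_mid ?(normc_zeta r_lt1 alpha_le)// sqr_ge0 /=.
rewrite sqr_normc_mid ?(normc_zeta r_lt1 alpha_le)// lerD2l lerN2 ler_pM2r// ?invr_gt0//.
have D0 : 0 <= (1 - r ^+ 2) / (1 + r) ^+ 2.
  by rewrite divr_ge0 ?sqr_ge0// ltW// r2_lt1.
rewrite ler_pXn2r ?nnegrE ?normc_ge0 ?(mulr_ge0 D0 b0)// normc_subC.
apply: le_trans (normc_zetaB_ge r_ge0 r_lt1 alpha_le _ (T_le1 Tz) (T_le1 Tl)).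
by rewrite mulrC ler_wpM2r.
Qed.

Lemma peak_near n K l z (b : R) : T z -> T l -> normc (z - l) <= b ->
  0 <= 1 - (((1 - r) ^+ 2)^-1 * b) ^+ 2 / 4 ->
  (1 - (((1 - r) ^+ 2)^-1 * b) ^+ 2 / 4) ^+ K <=
  normc (\prod_(k < K) (zeta alpha (n + k).+1 l / 2 + 2^-1 * zeta alpha (n + k).+1 z)) ^+ 2.
Proof.
move=> Tz Tl zb b4; rewrite normc_peak// -[in leLHS](card_ord K) -prodr_const.
apply: ler_prod => k _; rewrite b4 /= lerD2l lerN2 ler_pM2r// ?invr_gt0//.
have b0 : 0 <= b by exact: le_trans (normc_ge0 _) zb.
have k0 : 0 <= ((1 - r) ^+ 2)^-1 by rewrite invr_ge0 sqr_ge0.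
rewrite ler_pXn2r ?nnegrE ?normc_ge0 ?(mulr_ge0 k0 b0)// normc_subC.
apply: le_trans (normc_zetaB_le r_lt1 alpha_le _ (T_le1 Tz) (T_le1 Tl)) _.
by rewrite mulrC ler_wpM2l ?invr_ge0 ?sqr_ge0.
Qed.

End PeakFunctions.

Section LimitPointsAreEigenvalueLimits.
Variables (R : realType) (alpha a : nat -> R[i]) (r : R) (phi : nat -> R[i] -> R[i]).
Hypotheses (r_ge0 : 0 <= r) (r_lt1 : r < 1) (alpha_le : forall n, normc (alpha n) <= r).
Hypothesis a_lt1 : forall n, (0 < n)%N -> normc (a n) < 1.
Hypothesis phi_rec : orf_recurrence alpha a phi.
Local Notation T := (@unit_circle R).
Implicit Types (z w : R[i]).
Local Notation lt_ := (ltil alpha a).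
Local Notation B := (blaschke alpha).
Variable m : {measure set (borelC R) -> \bar R}.
Hypothesis mTfin : (m (T : set (borelC R)) < +oo)%E.
Hypothesis mTC : m (~` T : set (borelC R)) = 0%E.
Hypothesis phi_nice : forall n, cnice (phi n).
Hypothesis phi_orth : forall i j, cint m (fun z => (phi i z)^* * phi j z) = (i == j)%:R.
Hypothesis phi_span : forall n, lspan B n.+1 (phi n).
Hypothesis rho_to0 : forall d : R, 0 < d ->
  exists N, forall n, (N <= n)%N -> rho a n ^+ 2 <= d.

(** There are n linear conditions on n + 1 coefficients. An index of largest modulus is singled out
    since this is the only quantitative information on the solution. *)
Lemma orthogonal_combination n (g : nat -> R[i] -> R[i]) : (forall i, cnice (g i)) ->
  exists t : nat -> R[i], exists2 i0, [/\ (i0 <= n)%N, 0 < normc (t i0) &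
      forall i, (i <= n)%N -> normc (t i) <= normc (t i0)] &
    forall k, (k < n)%N ->
      cint m (fun z => (phi k z)^* * \sum_(i < n.+1) t i * g i z) = 0.
Proof.
move=> ng.
pose A : 'M[R[i]]_(n.+1, n) := \matrix_(i, k) cint m (fun z => (phi k z)^* * g i z).
have [t t0 tA] := kernel_vector A.
pose i0 := [arg max_(i > ord0) normc (t ord0 i)]%O.
have i0P i : normc (t ord0 i) <= normc (t ord0 i0).
  by rewrite /i0; case: arg_maxP => // j _; apply.
exists (fun i => t ord0 (inord i)), (i0 : nat).
  split; first by rewrite -ltnS.
    rewrite inord_val; case/rV0Pn: t0 => j tj.
    by rewrite (lt_le_trans _ (i0P j))// normc_gt0.
  by move=> i _; rewrite inord_val; exact: i0P.
move=> k kn; have : (t *m A) ord0 (Ordinal kn) = 0 by rewrite tA mxE.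
rewrite mxE => tA0.
have nh i : cnice (fun z => t ord0 (inord i) * ((phi k z)^* * g i z)).
  by apply/cniceZ/cniceM => //; exact: cniceJ.
rewrite (@eq_cint _ _ _ (fun z => \sum_(i < n.+1) t ord0 (inord i) * ((phi k z)^* * g i z))).
  rewrite (@cint_sum _ _ mTfin n.+1 (fun i z => t ord0 (inord i) * ((phi k z)^* * g i z)))//.
  rewrite -[RHS]tA0; apply: eq_bigr => i _; rewrite inord_val !mxE /= cintZ//.
  by apply: cniceM => //; exact: cniceJ.
by move=> z _; rewrite mulr_sumr; apply: eq_bigr => i _; rewrite mulrCA.
Qed.

Lemma lspan_orthogonal_tail n K f : lspan phi (n + K).+1 f ->
  (forall k, (k < n)%N -> cint m (fun z => (phi k z)^* * f z) = 0) ->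
  exists c : nat -> R[i], forall z, T z -> f z = \sum_(k < K.+1) c k * phi (n + k)%N z.
Proof.
move=> [c fc] f_orth; exists (fun k => c (n + k)%N) => z Tz.
rewrite fc// -addnS big_split_ord /= big1 ?add0r// => k _.
suff -> : c k = 0 by rewrite mul0r.
rewrite -(f_orth k (ltn_ord k)).
rewrite (@eq_cint _ _ _ (fun z => (phi k z)^* * \sum_(j < (n + K).+1) c j * phi j z)).
  by rewrite (cint_orthonormal_coef mTfin phi_nice phi_orth) ltnS ltnW// ltn_addr.
by move=> w Tw; rewrite fc.
Qed.

(* A product of many functions (zeta_k(l) + zeta_k) / 2 peaks at l. Multiplied by
   an interpolating function that does not vanish at some point of the support
   near l, it contradicts the spectral gap; the interpolating function has
   enough coefficients to make the product orthogonal to phi_0, ..., phi_p. *)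
Lemma limit_point_is_eigenvalue_limit (l : R[i]) :
  limit_point (supp m) l -> seq_limit_points (lt_ : nat -> R[i]^o) l.
Proof.
move=> ml; apply: contrapT => /not_seq_limit_point[eta eta0 [N etaN]].
have [p gap] := spectral_gap r_ge0 r_lt1 alpha_le a_lt1 phi_rec mTfin phi_nice phi_orth
  rho_to0 eta0 etaN.
have sl : supp m l.
  move=> U oU Ul; have [|y [_ my Uy]] := ml U; last exact: my.
  exact: open_nbhs_nbhs.
have Tl := supp_subset_circle mTC sl.
set n := p.+1 in gap.
(* Within b of l, |z - l|^2 <= eta^2 / 16, a quarter of the gap constant eta^2 / 4; the cap at 1/4
   keeps q1 nonnegative. *)
pose b := Num.min eta 1 / 4.
have b0 : 0 < b by rewrite divr_gt0// lt_min eta0 ltr01.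
have [b_eta b_1] : b <= eta / 4 /\ b <= 1 / 4.
  by split; rewrite ler_pM2r ?invr_gt0// ge_min lexx ?orbT.
pose c1 := (1 - r ^+ 2) / (1 + r) ^+ 2; pose c2 := ((1 - r) ^+ 2)^-1.
have r1 : 0 < 1 - r by rewrite subr_gt0.
have c1_gt0 : 0 < c1 by rewrite divr_gt0 ?r2_lt1// exprn_gt0// ltr_wpDr.
have c1_le1 : c1 <= 1.
  rewrite ler_pdivrMr; last by rewrite exprn_gt0// ltr_wpDr.
  rewrite mul1r sqrrD expr1n; have r0 := r_ge0; have := sqr_ge0 r.
  move: (r ^+ 2) => r2 r20; lra.
have c2_gt0 : 0 < c2 by rewrite invr_gt0 exprn_gt0.
(* Makes c2 e half of c1 b: each squared peak factor is then at least q2 within e of l, and at most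
   q1 < q2 beyond b. *)
pose e := c1 * b / (2 * c2).
have e0 : 0 < e by apply: divr_gt0; exact: mulr_gt0.
have c2e : c2 * e = c1 * b / 2.
  have H (x y : R) : x != 0 -> x * (y / (2 * x)) = y / 2 by move=> x0; field.
  by apply: H; rewrite gt_eqF.
have cb : 0 < c1 * b by exact: mulr_gt0.
have cb1 : c1 * b <= 1.
  have := ler_wpM2r (ltW b0) c1_le1; lra.
pose q1 := 1 - (c1 * b) ^+ 2 / 4; pose q2 := 1 - (c2 * e) ^+ 2 / 4.
have q10 : 0 <= q1 by rewrite /q1; nra.
have q12 : q1 < q2 by rewrite /q1 /q2 c2e; nra.
have q20 : 0 <= q2 by exact: le_trans q10 (ltW q12).
have e20 : 0 < e / 2 by rewrite divr_gt0.
have [x [xP xinj]] := limit_point_distinct n.+1 ml e20.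
have Tx i : (i <= n)%N -> T (x i).
  by move=> ni; apply: supp_subset_circle mTC _ _; have [] := xP i ni.
have [ell ellP] := interpolation r_ge0 r_lt1 alpha_le Tx xinj.
have /choice[L LP] : forall i, exists L, lip (ell i) L by move=> i; have [] := ellP i.
have L0 i : 0 <= L i by exact: lip_ge0 (LP i).
pose LL := \sum_(i < n.+1) L i.
have LL0 : 0 <= LL by apply: sumr_ge0.
(* Within d of a node the combination varies by at most half its largest coefficient, and z stays
   within e of l since the nodes lie within e / 2 of it. *)
pose d := Num.min (e / 2) (2 * (LL + 1))^-1.
have LL1 : 0 < LL + 1 by rewrite ltr_wpDl.
have d0 : 0 < d by rewrite lt_min e20 invr_gt0 mulr_gt0.
pose V i : set (borelC R) := [set z | normc (x i - z) < d].
(* The index i0 will depend on K, so the lower bound is taken over all nodes at once. *)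
have [mm mm0 mmP] : exists2 c : R, 0 < c &
    forall i, (i < n.+1)%N -> (c%:E <= m (V i `&` T))%E.
  apply: common_lower_bound => i ni.
  apply: lt_le_trans (measure_setI_circle mTC (measurable_disc _ _)).
  by apply: supp_disc d0; have [] := xP i ni.
pose M := fine (m (T : set (borelC R))).
have M0 : 0 <= M by rewrite fine_ge0// measure_ge0.
(* Subtracting eta^2 / 16 from the gap constant leaves 3/16 eta^2, to be multiplied by the lower
   bound tau^2 / 4 * q2^K * mm; the 4 in [B0] bounds |z - l|^2 on the circle. *)
have A0 : 0 < 3 / 64 * eta ^+ 2 * mm by rewrite !mulr_gt0// ?exprn_gt0.
have B0 : 0 <= 4 * LL ^+ 2 * M by rewrite !mulr_ge0// ?sqr_ge0.
have [K gapK] := geometric_gap q10 q12 A0 B0.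
pose pk z := \prod_(k < K) (zeta alpha (n + k).+1 l / 2 + 2^-1 * zeta alpha (n + k).+1 z).
have npk : cnice pk.
  apply: (@cnice_prod _ K (fun k z => zeta alpha (n + k).+1 l / 2 +
    2^-1 * zeta alpha (n + k).+1 z)) => k.
  by apply: cniceD; [exact: cnice_cst|apply: cniceZ; exact: (cnice_zeta r_lt1 alpha_le)].
have nell i : cnice (ell i) by have [] := ellP i.
have [t [i0 [i0n ti0 tmax] t_orth]] :=
  @orthogonal_combination n (fun i z => ell i z * pk z) (fun i => cniceM (nell i) npk).
set tau := normc (t i0) in ti0 tmax.
pose q z := \sum_(i < n.+1) t i * ell i z.
pose f z := q z * pk z.
have nq : cnice q by apply: (@cnice_sum _ n.+1 (fun i z => t i * ell i z)) => i; exact: cniceZ.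
have nf : cnice f by exact: cniceM.
have fE z : f z = \sum_(i < n.+1) t i * (ell i z * pk z).
  by rewrite /f mulr_suml; apply: eq_bigr => i _; rewrite mulrA.
have [c fc] : exists c : nat -> R[i], forall z, T z ->
    f z = \sum_(k < K.+1) c k * phi (n + k)%N z.
  apply: lspan_orthogonal_tail => [|k kn].
    apply: (lspan_blaschke_phi mTfin phi_nice phi_orth phi_span).
    apply: (lspan_prod_zeta r_ge0 r_lt1 alpha_le K
      (fun k => zeta alpha (n + k).+1 l / 2) (fun=> 2^-1)).
    by apply: lspan_sum => i _; have [] := ellP i.
  by rewrite -(t_orth k kn); apply: eq_cint => z _; rewrite fE.
have q_le z : T z -> normc (q z) <= tau * LL.
  move=> Tz; have h k : normc (t k * ell k z) = normc (t k) * normc (ell k z) by exact: normcM.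
  apply: (@le_trans _ _ (\sum_(i < n.+1) normc (t i * ell i z))).
    rewrite /q; elim/big_ind2 : _ => [|u1 u2 v1 v2 h1 h2|//]; first by rewrite normc0.
    by rewrite (le_trans (le_normcD _ _))// lerD.
  rewrite /LL mulr_sumr; apply: ler_sum => i _; rewrite normcM.
  have [elli _] := LP i; apply: ler_pM; rewrite ?normc_ge0//; first exact: (tmax _ (ltn_ord i)).
  exact: elli.
have q_ge z : T z -> V i0 z -> tau / 2 <= normc (q z).
  move=> Tz Vz.
  have qx : q (x i0) = t i0.
    rewrite /q (bigD1 (Ordinal (i0n : (i0 < n.+1)%N)))//= big1 ?addr0 => [|i ii0].
      by have [_ _ _ ->//] := ellP i0; rewrite eqxx mulr1.
    have [_ _ _ ->//] := ellP i; last exact: (ltn_ord i).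
    rewrite (_ : (i == i0 :> nat) = false) ?mulr0//.
    by apply/negbTE; apply: contra ii0 => /eqP ii0; apply/eqP/val_inj.
  have hq : normc (q (x i0) - q z) <= tau / 2.
    apply: (@le_trans _ _ (tau * (LL * d))); last first.
      rewrite ler_pM2l//; apply: (@le_trans _ _ (LL * (2 * (LL + 1))^-1)).
        by rewrite ler_wpM2l// ge_min lexx orbT.
      by rewrite ler_pdivrMr ?mulr_gt0//; lra.
    rewrite /q -sumrB.
    apply: (@le_trans _ _ (\sum_(i < n.+1) normc (t i * ell i (x i0) - t i * ell i z))).
      elim/big_ind2 : _ => [|u1 u2 v1 v2 h1 h2|//]; first by rewrite normc0.
      by rewrite (le_trans (le_normcD _ _))// lerD.
    rewrite /LL mulr_suml mulr_sumr; apply: ler_sum => i _; rewrite -mulrBr normcM.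
    apply: ler_pM; rewrite ?normc_ge0//; first exact: (tmax _ (ltn_ord i)).
    have [_ lipi] := LP i; apply: le_trans (lipi _ _ (Tx _ i0n) Tz) _.
    by rewrite ler_wpM2l// ltW.
  have := le_normcD (q (x i0) - q z) (q z); rewrite subrK {1}qx -/tau; lra.
have nzf : cnice (fun z => (z - l) * f z).
  by apply: cniceM => //; apply: cniceB; [exact: cnice_id|exact: cnice_cst].
have gapf : eta ^+ 2 / 4 * nsq m f <= nsq m (fun z => (z - l) * f z).
  have h : nsq m (fun z => (z - l) * f z) =
      nsq m (fun z => (z - l) * \sum_(k < K.+1) c k * phi (n + k)%N z).
    by apply: eq_nsq => z /fc ->.
  by rewrite h (eq_nsq m fc); exact: gap.
have lowf : tau ^+ 2 / 4 * q2 ^+ K * mm <= nsq m f.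
  have cc0 : 0 <= tau ^+ 2 / 4 * q2 ^+ K by rewrite mulr_ge0 ?exprn_ge0// divr_ge0 ?sqr_ge0.
  rewrite -lee_fin EFinM; apply: (@le_trans _ _ ((tau ^+ 2 / 4 * q2 ^+ K)%:E * m (V i0 `&` T))%E).
    by rewrite lee_wpmul2l ?lee_fin// mmP.
  apply: RI_markov => //; [exact: measurable_disc|exact: cnice_sqr|by move=> z _; exact: sqr_ge0|].
  move=> z Tz Vz; rewrite /f normcM exprMn; apply: ler_pM.
  - by rewrite divr_ge0 ?sqr_ge0.
  - by rewrite exprn_ge0.
  - have := q_ge z Tz Vz; have := normc_ge0 (q z); nra.
  apply: (peak_near r_lt1 alpha_le) => //.
  have /xP[_ xl] : (i0 < n.+1)%N by [].
  rewrite (_ : z - l = (z - x i0) + (x i0 - l)); last by ring.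
  rewrite (le_trans (le_normcD _ _))// [e in _ <= e](splitr e) lerD// ?(ltW xl)//.
  by rewrite normc_subC (le_trans (ltW Vz))// ge_min lexx.
have upf : nsq m (fun z => (z - l) * f z) <=
    eta ^+ 2 / 16 * nsq m f + 4 * (tau * LL) ^+ 2 * q1 ^+ K * M.
  rewrite /nsq -RIZ//; last exact: cnice_sqr.
  rewrite -RI_cst -RID//; [|by apply: rniceM; [exact: rnice_cst|exact: cnice_sqr]|exact: rnice_cst].
  apply: le_RI => //; first exact: cnice_sqr.
    by apply: rniceD; [apply: rniceM; [exact: rnice_cst|exact: cnice_sqr]|exact: rnice_cst].
  move=> z Tz; rewrite normcM exprMn.
  have [zb|bz] := leP (normc (z - l)) b.
    have h1 : normc (z - l) ^+ 2 <= eta ^+ 2 / 16.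
      by have := normc_ge0 (z - l); nra.
    rewrite ler_wpDr ?ler_wpM2r ?sqr_ge0//.
    by rewrite mulr_ge0 ?exprn_ge0// mulr_ge0 ?sqr_ge0.
  have h2 : normc (z - l) ^+ 2 <= 4.
    have := le_normcD z (- l); rewrite normcN.
    move/unit_circleE : (Tz) => ->; move/unit_circleE : (Tl) => ->.
    have := normc_ge0 (z - l); nra.
  have h3 : normc (f z) ^+ 2 <= (tau * LL) ^+ 2 * q1 ^+ K.
    rewrite /f normcM exprMn; apply: ler_pM; rewrite ?sqr_ge0//.
      by rewrite ler_pXn2r ?nnegrE ?normc_ge0 ?mulr_ge0 ?(ltW ti0)// q_le.
    exact: (peak_far r_ge0 r_lt1 alpha_le n K Tz Tl (ltW b0) (ltW bz)).
  apply: ler_wpDl; first by rewrite mulr_ge0 ?divr_ge0 ?sqr_ge0.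
  by rewrite -mulrA; apply: ler_pM; rewrite ?sqr_ge0.
have tau2 : 0 < tau ^+ 2 by rewrite exprn_gt0.
have := ltr_pM2l tau2 (4 * LL ^+ 2 * M * q1 ^+ K) (3 / 64 * eta ^+ 2 * mm * q2 ^+ K).
rewrite gapK => final.
have eta2 := exprn_gt0 2 eta0.
have h := ler_wpM2l (ltW eta2) lowf.
move: final gapf h upf; rewrite exprMn.
move: (nsq m f) (nsq m _) (q1 ^+ K) (q2 ^+ K) => Q X x1 x2 final gapf h upf.
have : (3 / 64 * eta ^+ 2 * mm * x2) * tau ^+ 2 <= (4 * LL ^+ 2 * M * x1) * tau ^+ 2 by lra.
by rewrite leNgt ![_ * tau ^+ 2]mulrC final.
Qed.

End LimitPointsAreEigenvalueLimits.

(** * Arc length and the disk algebra *)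

Section ArcLength.
Variable R : realType.
Local Notation C := (borelC R).
Local Notation T := (@unit_circle R).
Implicit Types (z w : R[i]) (t : R).

Definition circle_point (t : measurableTypeR R) : C := Complex (cos t) (sin t).

Lemma circle_point_T t : T (circle_point t).
Proof.
apply/unit_circleE/eqP; rewrite -(@eqrXn2 _ 2) ?normc_ge0//.
by rewrite sqr_normcE /= cos2Dsin2 expr1n.
Qed.

Lemma circle_pointX t k : (circle_point t : R[i]) ^+ k = Complex (cos (k%:R * t)) (sin (k%:R * t)).
Proof.
elim: k => [|k IH]; first by rewrite expr0 mul0r cos0 sin0.
rewrite exprS IH /circle_point -natr1 mulrDl mul1r cosD sinD; apply/eqP.
by rewrite eq_complex /=; apply/andP; split; apply/eqP; ring.
Qed.

Lemma measurable_circle_point : measurable_fun [set: measurableTypeR R] circle_point.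
Proof.
apply: (@measurability _ _ _ C _ _ (@open R[i]^o)) => // _ [U oU <-]; rewrite setTI.
apply: open_measurable; rewrite openE => t /= Ut.
have [e e0 eU] := (openCP U).1 oU _ Ut.
have e2 : 0 < e / 2 by rewrite divr_gt0.
have /cvgrPdist_lt /(_ _ e2) cc := @continuous_cos R t.
have /cvgrPdist_lt /(_ _ e2) cs := @continuous_sin R t.
rewrite /interior; near=> x; apply: eU.
rewrite (le_lt_trans (normc_le_ReIm _))// raddfB raddfB /= [ltRHS]splitr ltrD//.
  by near: x.
by near: x.
Unshelve. all: by end_near.
Qed.

HB.instance Definition _ :=
  isMeasurableFun.Build _ _ (measurableTypeR R) C circle_point measurable_circle_point.

Lemma twopi_gt0 : 0 < pi *+ 2 :> R.
Proof. by rewrite pmulrn_lgt0// pi_gt0. Qed.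

Local Notation unif := (uniform_prob twopi_gt0).

(** Arc length normalized to mass 1, as a measure to which the previous calculus applies;
    [arc0_circle_lebesgue] leads back to [circle_lebesgue]. *)
Definition arc : probability C R := distribution unif circle_point.

Lemma arcE (A : set C) : arc A = unif (circle_point @^-1` A).
Proof. by []. Qed.

Lemma arc_T : arc (T : set C) = 1%E.
Proof.
rewrite arcE (_ : _ @^-1` _ = setT) ?probability_setT//.
by apply/seteqP; split=> // t _; exact: circle_point_T.
Qed.

Lemma arc_Tfin : (arc (T : set C) < +oo)%E.
Proof. by rewrite arc_T ltry. Qed.

Lemma arc_TC : arc (~` T : set C) = 0%E.
Proof.
by rewrite probability_setC ?arc_T ?subee//; exact: measurable_unit_circle.
Qed.

Lemma arc0_circle_lebesgue (A : set C) : measurable A -> arc A = 0%E -> circle_lebesgue A = 0%E.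
Proof.
move=> mA; rewrite arcE => A0.
pose S := circle_point @^-1` A; pose I := [set t : R | 0 <= t < pi *+ 2].
have mS : measurable S by rewrite -[S]setTI; exact: measurable_circle_point.
have IE : I = `[0, pi *+ 2[%classic by apply/seteqP; split=> t /=; rewrite in_itv.
have mI : measurable I by rewrite IE.
have mSI : measurable (I `&` S) by exact: measurableI.
rewrite /circle_lebesgue (_ : [set t | _] = I `&` S); last by [].
have k0 : 0 < (pi *+ 2 - 0)^-1 :> R by rewrite subr0 invr_gt0 twopi_gt0.
apply/eqP; rewrite eq_le measure_ge0 andbT.
suff : ((pi *+ 2 - 0)^-1%:E * lebesgue_measure (I `&` S) <= 0)%E.
  rewrite -[X in (_ <= X)%E -> _](mule0 (pi *+ 2 - 0)^-1%:E).
  by rewrite lee_pmul2l.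
rewrite -A0 /uniform_prob -integral_cst//.
apply: (@le_trans _ _ (\int[lebesgue_measure]_(x in I `&` S) (uniform_pdf 0 (pi *+ 2) x)%:E)%E).
  apply: ge0_le_integral => //.
  - by move=> x _; rewrite lee_fin ltW.
  - by apply/measurable_EFinP; apply: measurable_funTS; exact: measurable_uniform_pdf.
  move=> x [/andP[x0 x2] _]; rewrite lee_fin /uniform_pdf x0 (ltW x2) /=.
  by [].
apply: ge0_subset_integral => //.
- by apply/measurable_EFinP; apply: measurable_funTS; exact: measurable_uniform_pdf.
- by move=> x _; rewrite lee_fin uniform_pdf_ge0// twopi_gt0.
Qed.

Lemma integral_FTC (f F : R -> R) (a b : R) : a < b -> continuous f ->
  (forall t, is_derive t 1 F (f t)) ->
  (\int[lebesgue_measure]_(t in `[a, b]) (f t)%:E = (F b - F a)%:E)%E.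
Proof.
move=> ab cf dF.
have dvF t : derivable F t 1 by apply: ex_derive; exact: dF.
have cF : continuous F by move=> t; exact/differentiable_continuous/derivable1_diffP.
rewrite (@continuous_FTC2 _ f F)//.
- exact: continuous_subspaceT.
- by split=> //; [exact/cvg_at_right_filter/cF|exact/cvg_at_left_filter/cF].
- by move=> t _; rewrite derive1E derive_val.
Qed.

Lemma RI_arc_ge0 (G : R[i] -> R) : rnice G -> (forall z, T z -> 0 <= G z) ->
  (RI arc G)%:E = ((pi *+ 2)^-1%:E *
    \int[lebesgue_measure]_(t in `[0%R, (pi *+ 2)%R]) (G (circle_point t))%:E)%E.
Proof.
move=> nG G0; rewrite /RI /Rintegral fineK; last first.
  apply: integrable_fin_num; [exact: measurable_unit_circle|].
  exact: rnice_integrable arc_Tfin _ nG.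
have mG : measurable_fun [set: C] (EFin \o G : C -> _) by apply/measurable_EFinP; exact: nG.1.
have mG' : measurable_fun (T : set C) (EFin \o G : C -> _).
  by apply: measurable_funS mG => //.
rewrite ge0_integral_pushforward//; first last.
- by move=> z; rewrite inE => Tz; rewrite lee_fin G0.
- exact: measurable_unit_circle.
rewrite (_ : circle_point @^-1` T = setT); last first.
  by apply/seteqP; split=> // t _; exact: circle_point_T.
rewrite integral_uniform ?subr0//.
- exact: (measurableT_comp mG measurable_circle_point).
- by move=> t /=; rewrite lee_fin G0//; exact: circle_point_T.
Qed.

Lemma RI_arc_cst (c : R) : RI arc (fun=> c) = c.
Proof. by rewrite RI_cst [X in _ * X](congr1 fine arc_T) mulr1. Qed.

Lemma RI_arc_FTC (G : R[i] -> R) (f F : R -> R) : rnice G -> (forall z, T z -> 0 <= G z) ->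
  (forall t, G (circle_point t) = f t) -> continuous f ->
  (forall t, is_derive t 1 F (f t)) -> RI arc G = (pi *+ 2)^-1 * (F (pi *+ 2) - F 0).
Proof.
move=> nG G0 Gf cf dF; apply: EFin_inj; rewrite RI_arc_ge0// EFinM; congr (_ * _)%E.
rewrite -(integral_FTC twopi_gt0 cf dF); apply: eq_integral => t _.
by rewrite Gf.
Qed.

Lemma cnice_exp k : cnice (fun z : R[i] => z ^+ k).
Proof.
elim: k => [|k IH]; first by under eq_fun do rewrite expr0; exact: cnice_cst.
by under eq_fun do rewrite exprS; apply: cniceM => //; exact: cnice_id.
Qed.

Lemma normcX (z : R[i]) k : normc (z ^+ k) = normc z ^+ k.
Proof. by elim: k => [|k IH]; rewrite ?expr0 ?normc1// !exprS normcM IH. Qed.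

Lemma cint_arc_exp k : cint arc (fun z => z ^+ k.+1) = 0.
Proof.
have nX := cnice_exp k.+1; have k0 : k.+1%:R != 0 :> R by rewrite pnatr_eq0.
have X1 z : T z -> normc (z ^+ k.+1) = 1 by move=> /unit_circleE z1; rewrite normcX z1 expr1n.
have lin (x : R) : continuous (fun t : R => x * t) by move=> t; exact: mulrl_continuous.
(* [RI_arc_FTC] is stated for nonnegative functions; the real and imaginary parts of z^k, at least
   -1, become so when 1 is added. *)
have shift (G : R[i] -> R) : rnice G -> RI arc (fun z => 1 + G z) = 1 -> RI arc G = 0.
  move=> nG; rewrite (RID arc_Tfin (rnice_cst 1) nG) RI_arc_cst.
  by move=> /(canRL (addKr _)); rewrite addNr.
have pi0 : pi *+ 2 != 0 :> R by rewrite gt_eqF// twopi_gt0.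
have k2pi : k.+1%:R * (pi *+ 2) = 0 + pi *+ 2 *+ k.+1 :> R by rewrite add0r mulr_natl.
apply/eqP; rewrite eq_complex; apply/andP; split; apply/eqP; apply: shift.
- exact: cnice_Re.
- have dF t : is_derive t 1 (fun t : R => t + k.+1%:R^-1 * sin (k.+1%:R * t))
      (1 + cos (k.+1%:R * t)).
    apply: is_derive_eq; rewrite /GRing.scale /=.
    by rewrite mulr1 [cos _ * _]mulrC mulKf.
  apply: etrans (RI_arc_FTC _ _ _ _ dF) _.
  + by apply: rniceD; [exact: rnice_cst|exact: cnice_Re].
  + move=> z Tz; have := normr_Re_le (z ^+ k.+1); rewrite X1// ler_norml => /andP[h _].
    by rewrite -lerBlDl sub0r.
  + by move=> t; rewrite circle_pointX.
  + move=> t; apply: cvgD; first exact: cvg_cst.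
    by apply: continuous_comp; [exact: lin|exact: continuous_cos].
  + by rewrite k2pi (periodicn (@sinD2pi R)) mulr0 add0r addrK mulVf.
- exact: cnice_Im.
- have dF t : is_derive t 1 (fun t : R => t - k.+1%:R^-1 * cos (k.+1%:R * t))
      (1 + sin (k.+1%:R * t)).
    apply: is_derive_eq; rewrite /GRing.scale /=.
    by rewrite mulr1 mulNr mulrN opprK [sin _ * _]mulrC mulKf.
  apply: etrans (RI_arc_FTC _ _ _ _ dF) _.
  + by apply: rniceD; [exact: rnice_cst|exact: cnice_Im].
  + move=> z Tz; have := normr_Im_le (z ^+ k.+1); rewrite X1// ler_norml => /andP[h _].
    by rewrite -lerBlDl sub0r.
  + by move=> t; rewrite circle_pointX.
  + move=> t; apply: cvgD; first exact: cvg_cst.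
    by apply: continuous_comp; [exact: lin|exact: continuous_sin].
  + by rewrite k2pi (periodicn (@cosD2pi R)) mulr0 sub0r opprK subrK mulVf.
Qed.

End ArcLength.

(** * The disk algebra and the mean over the circle *)

Section DiskAlgebra.
Variable R : realType.
Local Notation C := (borelC R).
Local Notation T := (@unit_circle R).
Local Notation E := (cint (arc R)).
Local Notation fin := (@arc_Tfin R).
Implicit Types (z w : R[i]) (f g h : R[i] -> R[i]).

Lemma cint_arc_cst c : E (fun=> c) = c.
Proof.
by rewrite /cint !RI_arc_cst; case: c.
Qed.

Lemma normc_cint_arc f (M : R) : cnice f -> (forall z, T z -> normc (f z) <= M) ->
  normc (E f) <= M.
Proof.
move=> nf fM; set w := E f.
have [w0|w0] := eqVneq w 0.
  rewrite w0 normc0; apply: le_trans (normc_ge0 (f 1)) (fM 1 _).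
  exact/unit_circleE/normc1.
have nw : 0 < normc w by rewrite normc_gt0.
(* Rotating f by the phase of its mean turns the modulus of the mean into the mean of a real
   part. *)
pose om := w^* / (normc w)%:C%C.
have om1 : normc om = 1.
  by rewrite normcM normcV normcJ normc_real ger0_norm ?normc_ge0// divff// gt_eqF.
have nwC : (normc w)%:C%C != 0 by rewrite -normc_eq0 normc_real normr_eq0 gt_eqF.
have omw : om * w = (normc w)%:C%C.
  by rewrite /om mulrAC [w^* * w]mulrC mulcJ rmorphXn /= expr2 mulfK.
have := cintZ fin om nf; rewrite -/w omw => /(congr1 (@complex.Re R)) /= <-.
rewrite -[leRHS](RI_arc_cst M).
apply: (le_RI fin); [by apply: cnice_Re; exact: cniceZ|exact: rnice_cst|].
move=> z Tz; apply: le_trans (fM z Tz).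
by rewrite -[leRHS]mul1r -om1 -normcM (le_trans (ler_norm _))// normr_Re_le.
Qed.

(** Boundary values of the disk algebra, as the uniform closure of the polynomials on the circle;
    nothing is asked of f inside the disk. *)
Definition disk_algebra f := cnice f /\ forall e : R, 0 < e ->
  exists p : {poly R[i]}, forall z, T z -> normc (f z - p.[z]) <= e.

Lemma cnice_horner (p : {poly R[i]}) : cnice (horner p).
Proof.
rewrite (_ : horner p = fun z => \sum_(i < size p) p`_i * z ^+ i); last first.
  by apply/funext => z; rewrite horner_coef.
by apply: (@cnice_sum _ (size p) (fun i z => p`_i * z ^+ i)) => i; apply/cniceZ/cnice_exp.
Qed.

Lemma disk_algebra_horner (p : {poly R[i]}) : disk_algebra (horner p).
Proof.
split=> [|e e0]; first exact: cnice_horner.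
by exists p => z _; rewrite subrr normc0 ltW.
Qed.

Lemma eq_disk_algebra f g : cmeasurable f -> (forall z, T z -> f z = g z) ->
  disk_algebra g -> disk_algebra f.
Proof.
move=> mf fg [[_ [M gM]] gp]; split; first by split=> //; exists M => z Tz; rewrite fg ?gM.
by move=> e /gp[p pP]; exists p => z Tz; rewrite fg ?pP.
Qed.

Lemma disk_algebra_cst c : disk_algebra (fun=> c).
Proof.
apply: eq_disk_algebra (disk_algebra_horner c%:P); first exact: cmeasurable_cst.
by move=> z _; rewrite hornerC.
Qed.

Lemma disk_algebra_id : disk_algebra id.
Proof.
apply: eq_disk_algebra (disk_algebra_horner 'X); first exact: cmeasurable_id.
by move=> z _; rewrite hornerX.
Qed.

Lemma disk_algebraD f g : disk_algebra f -> disk_algebra g ->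
  disk_algebra (fun z => f z + g z).
Proof.
move=> [nf fp] [ng gp]; split=> [|e e0]; first exact: cniceD.
have e2 : 0 < e / 2 by rewrite divr_gt0.
have [p pP] := fp _ e2; have [q qP] := gp _ e2; exists (p + q) => z Tz.
rewrite hornerD opprD addrACA (le_trans (le_normcD _ _))// [leRHS]splitr.
by rewrite lerD ?pP ?qP.
Qed.

Lemma disk_algebraM f g : disk_algebra f -> disk_algebra g ->
  disk_algebra (fun z => f z * g z).
Proof.
move=> [nf fp] [ng gp]; split=> [|e e0]; first exact: cniceM.
have [M1 fM] := nf.2; have [M2 gM] := ng.2.
pose M := `|M1| + `|M2| + 1; have M0 : 0 < M by rewrite ltr_wpDl// addr_ge0.
pose d := Num.min 1 (e / (2 * M)).
have d0 : 0 < d by rewrite lt_min ltr01 divr_gt0// mulr_gt0.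
have [p pP] := fp _ d0; have [q qP] := gp _ d0; exists (p * q) => z Tz.
have hf : normc (f z) <= M.
  have := fM z Tz; have := ler_norm M1; have := normr_ge0 M2; rewrite /M; lra.
have hg : normc q.[z] <= M.
  have := le_normcD (q.[z] - g z) (g z); rewrite subrK normc_subC.
  have := qP z Tz; have := gM z Tz; have := ler_norm M2; have := normr_ge0 M1.
  have : d <= 1 by rewrite ge_min lexx.
  rewrite /M; lra.
rewrite hornerM (_ : _ - _ = f z * (g z - q.[z]) + (f z - p.[z]) * q.[z]); last by ring.
rewrite (le_trans (le_normcD _ _))// !normcM.
apply: (@le_trans _ _ (M * d + d * M)).
  by apply: lerD; apply: ler_pM; rewrite ?normc_ge0 ?pP ?qP.
have : d * (2 * M) <= e by rewrite -ler_pdivlMr ?mulr_gt0// ge_min lexx orbT.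
lra.
Qed.

Lemma disk_algebra_lim f : cnice f ->
  (forall e : R, 0 < e -> exists2 h, disk_algebra h & forall z, T z -> normc (f z - h z) <= e) ->
  disk_algebra f.
Proof.
move=> nf fh; split=> // e e0; have e2 : 0 < e / 2 by rewrite divr_gt0.
have [h [_ hp] hP] := fh _ e2; have [p pP] := hp _ e2; exists p => z Tz.
rewrite (_ : _ - _ = (f z - h z) + (h z - p.[z])); last by ring.
by rewrite (le_trans (le_normcD _ _))// [leRHS]splitr lerD ?hP ?pP.
Qed.

(** The partial sums of the geometric series converge uniformly, with error f^K / (1 - f). *)
Lemma disk_algebraV f (q : R) : q < 1 -> (forall z, T z -> normc (f z) <= q) ->
  disk_algebra f -> disk_algebra (fun z => (1 - f z)^-1).
Proof.
move=> q1 fq Af.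
have q0 : 0 <= q.
  apply: le_trans (normc_ge0 (f 1)) (fq 1 _); exact/unit_circleE/normc1.
have dq z : T z -> 1 - q <= normc (1 - f z).
  move=> Tz; have := le_normcD (1 - f z) (f z); rewrite subrK normc1.
  have := fq z Tz; lra.
have q1' : 0 < 1 - q by rewrite subr_gt0.
have [nf _] := Af.
apply: disk_algebra_lim.
  by apply: (cniceV q1' dq); apply: cniceB => //; exact: cnice_cst.
move=> e e0.
have Asum n : disk_algebra (fun z => \sum_(j < n) f z ^+ j).
  elim: n => [|n IH].
    by under eq_fun do rewrite big_ord0; exact: disk_algebra_cst.
  under eq_fun do rewrite big_ord_recr /=; apply: disk_algebraD => //.
  elim: n {IH} => [|n IH]; first by under eq_fun do rewrite expr0; exact: disk_algebra_cst.
  by under eq_fun do rewrite exprS; exact: disk_algebraM.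
have [K HK] := geometric_gap q0 q1 (mulr_gt0 e0 q1') ler01.
exists (fun z => \sum_(j < K) f z ^+ j) => // z Tz.
have f1 : 1 - f z != 0 by rewrite -normc_gt0 (lt_le_trans q1') ?dq.
have -> : (1 - f z)^-1 - \sum_(j < K) f z ^+ j = (1 - f z)^-1 * f z ^+ K.
  have hS : (1 - f z) * \sum_(j < K) f z ^+ j = 1 - f z ^+ K.
    by rewrite -[LHS]opprK -mulNr opprB -subrX1 opprB.
  have hV : (1 - f z) * (1 - f z)^-1 = 1 by rewrite mulfV.
  by apply: (mulfI f1); rewrite mulrBr hS hV mulrA hV mul1r subKr.
have n1f : 0 < normc (1 - f z) by exact: lt_le_trans (dq z Tz).
rewrite normcM normcV normcX ler_pdivrMl//.
apply: (@le_trans _ _ (q ^+ K)); first by apply: lerXn2r; rewrite ?nnegrE ?normc_ge0 ?fq.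
rewrite mul1r expr1n mulr1 in HK; apply: le_trans (ltW HK) _.
by rewrite mulrC ler_wpM2r ?dq ?ltW.
Qed.

(* The mean over the circle is multiplicative on the disk algebra, where it is
   the evaluation at 0. *)
Lemma cint_mul_closed f g : cnice f -> cnice g ->
  (forall e : R, 0 < e -> exists2 h, cnice h /\ E (fun z => h z * g z) = E h * E g &
      forall z, T z -> normc (f z - h z) <= e) ->
  E (fun z => f z * g z) = E f * E g.
Proof.
move=> nf ng fh; have [M gM] := ng.2.
have M0 : 0 <= M.
  apply: le_trans (normc_ge0 (g 1)) (gM 1 _); exact/unit_circleE/normc1.
apply/eqP; rewrite -subr_eq0 -normc_eq0 eq_le normc_ge0 andbT.
apply/ler_addgt0Pr => e e0; rewrite add0r.
have M1 : 0 < 2 * M + 1 by rewrite ltr_wpDl// mulr_ge0.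
have d0 : 0 < e / (2 * M + 1) by rewrite divr_gt0.
have [h [nh hE] hP] := fh _ d0; set d := e / _ in d0 hP.
have nfh : cnice (fun z => f z - h z) by exact: cniceB.
have linB k1 k2 : cnice k1 -> cnice k2 -> E (fun z => k1 z - k2 z) = E k1 - E k2.
  move=> n1 n2; rewrite (@eq_cint _ _ _ (fun z => k1 z + (- 1) * k2 z)); last first.
    by move=> z _; rewrite mulN1r.
  by rewrite (cintD fin)//; [rewrite (cintZ fin)// mulN1r|exact: cniceZ].
have -> : E (fun z => f z * g z) - E f * E g =
    E (fun z => (f z - h z) * g z) - E (fun z => f z - h z) * E g.
  rewrite (@eq_cint _ _ (fun z => (f z - h z) * g z) (fun z => f z * g z - h z * g z)); last first.
    by move=> z _; rewrite mulrBl.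
  by rewrite !linB//; [rewrite hE; ring|exact: cniceM..].
rewrite (le_trans (le_normcD _ _))// normcN normcM.
have h1 : normc (E (fun z => (f z - h z) * g z)) <= d * M.
  apply: normc_cint_arc => [|z Tz]; first exact: cniceM.
  by rewrite normcM ler_pM ?normc_ge0 ?hP ?gM.
have h2 : normc (E (fun z => f z - h z)) <= d by exact: normc_cint_arc.
have h3 : normc (E g) <= M by exact: normc_cint_arc.
have h4 : normc (E (fun z => f z - h z)) * normc (E g) <= d * M by rewrite ler_pM ?normc_ge0.
have dM : d * (2 * M + 1) = e by rewrite /d divfK// gt_eqF.
lra.
Qed.

Lemma cint_horner (p : {poly R[i]}) : E (horner p) = p.[0].
Proof.
rewrite (@eq_cint _ _ _ (fun z => \sum_(i < size p) p`_i * z ^+ i)); last first.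
  by move=> z _; rewrite horner_coef.
have nX i : cnice (fun z : R[i] => z ^+ i) by exact: cnice_exp.
rewrite (@cint_sum _ _ fin _ (fun i z => p`_i * z ^+ i)); last by move=> i; exact: cniceZ.
rewrite horner_coef0.
case: (size p) (@size_poly0 R[i]) (nth_default 0 (leqnn (size p))) => [|n] _ p0.
  by rewrite big_ord0 p0.
rewrite big_ord_recl big1 ?addr0 => [|i _]; rewrite (cintZ fin)// ?cint_arc_exp ?mulr0//.
by rewrite (@eq_cint _ _ _ (fun=> 1))// cint_arc_cst mulr1.
Qed.

Lemma cint_disk_algebraM f g : disk_algebra f -> disk_algebra g ->
  E (fun z => f z * g z) = E f * E g.
Proof.
move=> [nf fp] [ng gp]; apply: cint_mul_closed => // e /fp[p pP].
exists (horner p) => //; split; first exact: cnice_horner.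
rewrite mulrC (@eq_cint _ _ _ (fun z => g z * p.[z])); last by move=> z _; rewrite mulrC.
(* The first factor is already a polynomial; this approximates the second. *)
apply: cint_mul_closed => //; first exact: cnice_horner.
move=> d /gp[q qP]; exists (horner q) => //; split; first exact: cnice_horner.
rewrite !cint_horner -hornerM -cint_horner; apply: eq_cint => z _.
by rewrite hornerM.
Qed.

Lemma cint_arc_id : E id = 0.
Proof.
rewrite -(cint_arc_exp R 0); apply: eq_cint => z _; by rewrite expr1.
Qed.

Lemma cint_arc_idM f : disk_algebra f -> E (fun z => z * f z) = 0.
Proof.
by move=> Af; rewrite (cint_disk_algebraM disk_algebra_id Af) cint_arc_id mul0r.
Qed.

Lemma cint_arcV f (q : R) : q < 1 -> (forall z, T z -> normc (f z) <= q) ->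
  disk_algebra f -> (1 - E f) * E (fun z => (1 - f z)^-1) = 1.
Proof.
move=> q1 fq Af; have AV := disk_algebraV q1 fq Af.
have A1 : disk_algebra (fun z => 1 + (- 1) * f z).
  by apply: disk_algebraD; [|apply: disk_algebraM]; rewrite //; exact: disk_algebra_cst.
have -> : 1 - E f = E (fun z => 1 + (- 1) * f z).
  rewrite (cintD fin)//; [|exact: cnice_cst|by apply: cniceZ; exact: Af.1].
  by rewrite cint_arc_cst (cintZ fin) ?mulN1r//; exact: Af.1.
rewrite -cint_disk_algebraM// -[RHS](cint_arc_cst 1); apply: eq_cint => z Tz.
rewrite mulN1r mulfV// subr_eq0; apply/eqP => fz1.
by have := fq z Tz; rewrite -fz1 normc1 leNgt q1.
Qed.

End DiskAlgebra.

(** * Singularity *)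

Section SublevelSets.
Variable R : realType.
Local Notation C := (borelC R).
Local Notation T := (@unit_circle R).
Implicit Types (z w : R[i]) (f : R[i] -> R[i]).

Lemma conjE z : z^* = conjc z.
Proof. by []. Qed.

Definition sublevel f (x : R) : set C := [set z | normc (f z) ^+ 2 <= x].

Lemma measurable_sublevel f x : cmeasurable f -> measurable (sublevel f x).
Proof.
move=> /measurable_sqr_normc mf.
rewrite -[sublevel f x]setTI
  (_ : sublevel f x = (fun z : C => normc (f z) ^+ 2) @^-1` `]-oo, x]%classic).
  exact: mf.
by apply/seteqP; split=> z /=; rewrite in_itv.
Qed.

Lemma sublevel_markov (m : {measure set C -> \bar R}) f (c M : R) (A : set C) :
  (m (T : set C) < +oo)%E -> measurable A -> 0 < c -> cnice f ->
  (forall z, T z -> A z -> c <= normc (f z) ^+ 2) -> nsq m f <= c * M ->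
  (m (A `&` T) <= M%:E)%E.
Proof.
move=> mTfin mA c0 nf cA nsqM.
have h := RI_markov mTfin mA (ltW c0) (cnice_sqr nf) (fun z _ => sqr_ge0 _) cA.
have : (c%:E * m (A `&` T) <= (c * M)%:E)%E by apply: le_trans h _; rewrite lee_fin.
by rewrite EFinM lee_pmul2l.
Qed.

(* The Poisson kernel at s E(u) dominates a multiple of the indicator function
   of the set where u is within 1 - s of 1. *)
Lemma arc_sublevel (u : R[i] -> R[i]) (r d : R) : disk_algebra u ->
  (forall z, T z -> normc (u z) = 1) -> normc (cint (arc R) u) <= r -> r < 1 ->
  0 < d -> d < 1 ->
  (arc R (sublevel (fun z => 1 - u z)%R (d ^+ 2)%R `&` T) <= (4 * d * (2 / (1 - r)))%:E)%E.
Proof.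
move=> Au u1 ur r1 d0 d1; pose s := 1 - d.
have sE : s + d = 1 by rewrite subrK.
have [s0 s1] : 0 < s /\ s < 1 by split; lra.
have r1' : 0 < 1 - r by rewrite subr_gt0.
pose f z := s%:C%C * u z; pose G z := (1 - f z)^-1.
have Af : disk_algebra f by apply: disk_algebraM => //; exact: disk_algebra_cst.
have fs z : T z -> normc (f z) = s.
  by move=> Tz; rewrite normcM u1// mulr1 normc_real ger0_norm// ltW.
have fs' z : T z -> normc (f z) <= s by move=> /fs ->.
have AG : disk_algebra G by exact: disk_algebraV s1 fs' Af.
have EG := cint_arcV s1 fs' Af.
have Ef : normc (cint (arc R) f) <= r.
  rewrite (cintZ (@arc_Tfin R))//; last exact: Au.1.
  rewrite normcM normc_real ger0_norm ?(ltW s0)//.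
  have := normc_ge0 (cint (arc R) u); nra.
have EGr : normc (cint (arc R) G) <= (1 - r)^-1.
  have := congr1 (@normc R) EG; rewrite normcM normc1 => h.
  have : 1 - r <= normc (1 - cint (arc R) f).
    have := le_normcD (1 - cint (arc R) f) (cint (arc R) f); rewrite subrK normc1; lra.
  rewrite -/(G) in h => h2.
  rewrite -[leRHS]mul1r ler_pdivlMr// -[X in _ <= X]h mulrC.
  by rewrite ler_wpM2r ?normc_ge0.
(* The left side is the Poisson kernel at s u(z), and the right side is the real part of (1 + f) /
   (1 - f). *)
have GE z : T z -> (1 - s ^+ 2) * normc (G z) ^+ 2 = 2 * complex.Re (G z) - 1.
  move=> Tz; apply: complexI.
  transitivity ((1 - s%:C%C ^+ 2) * (G z * (G z)^*)); first by rewrite mulcJ; ring.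
  transitivity (G z + (G z)^* - 1); last by rewrite conjE addcJ; ring.
  have f0 : 1 - f z != 0.
    rewrite subr_eq0; apply/eqP => f1; have := fs z Tz; rewrite -f1 normc1 => s_1.
    by move: s1; rewrite -s_1 ltxx.
  have f0' : 1 - (f z)^* != 0 by rewrite -[X in X - _]conjC1 -rmorphB conjC_eq0.
  have ff : f z * (f z)^* = s%:C%C ^+ 2 by rewrite mulcJ fs// rmorphXn.
  rewrite -ff /G fmorphV rmorphB rmorph1.
  by field; rewrite f0 f0'.
have nsqG : (1 - s ^+ 2) * nsq (arc R) G <= 2 / (1 - r).
  have nG2 := cnice_sqr AG.1.
  rewrite /nsq -(RIZ (@arc_Tfin R))// (eq_RI _ GE).
  have nRe := cnice_Re AG.1.
  rewrite (RID (@arc_Tfin R) _ (rnice_cst _)) ?RI_arc_cst; last first.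
    by apply: rniceM => //; exact: rnice_cst.
  rewrite (RIZ (@arc_Tfin R))//.
  have := normr_Re_le (cint (arc R) G); rewrite /cint /= => /(le_trans (ler_norm _)) h.
  have := le_trans h EGr; lra.
apply: (@sublevel_markov _ G (4 * d ^+ 2)^-1).
- exact: arc_Tfin.
- by apply: measurable_sublevel; apply: (cniceB (cnice_cst 1) Au.1).1.
- by rewrite invr_gt0 mulr_gt0// exprn_gt0.
- exact: AG.1.
- move=> z Tz; rewrite /sublevel /= => ud.
  have ud' : normc (1 - u z) <= d.
    by rewrite -(@ler_pXn2r _ 2) ?nnegrE ?normc_ge0 ?(ltW d0).
  have n2 : normc (1 - f z) <= 2 * d.
    rewrite (_ : 1 - f z = (1 - u z) + d%:C%C * u z).
      by rewrite (le_trans (le_normcD _ _))// normcM u1// mulr1 normc_real ger0_norm; lra.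
    rewrite /f (_ : s%:C%C = 1 - d%:C%C); last by rewrite /s rmorphB rmorph1.
    by ring.
  have f0 : 0 < normc (1 - f z).
    have := le_normcD (1 - f z) (f z); rewrite subrK normc1 fs//; lra.
  rewrite /G normcV exprVn lef_pV2 ?posrE ?exprn_gt0//; last by rewrite mulr_gt0// exprn_gt0.
  have := normc_ge0 (1 - f z); nra.
(* Here 1 - s^2 = d (2 - d). On the sublevel set |1 - f| <= 2 d, so Markov's inequality for |G|^2
   costs 4 d^2, one d of which cancels. *)
have h : d <= 1 - s ^+ 2 by nra.
have nG0 := nsq_ge0 (arc R) G.
have dG : d * nsq (arc R) G <= 2 / (1 - r).
  by apply: le_trans nsqG; rewrite ler_wpM2r.
rewrite ler_pdivlMl; last by rewrite mulr_gt0// exprn_gt0.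
rewrite (_ : 4 * d ^+ 2 * _ = 4 * d * (d * nsq (arc R) G)); last by ring.
by rewrite ler_wpM2l// mulr_ge0// ltW.
Qed.

End SublevelSets.

(** * Inner quotients and Bernstein-Szego densities *)

Section SingularPart.
Variables (R : realType) (alpha a : nat -> R[i]) (r : R) (phi : nat -> R[i] -> R[i]).
Hypotheses (r_ge0 : 0 <= r) (r_lt1 : r < 1) (alpha_le : forall n, normc (alpha n) <= r).
Hypothesis alpha0 : alpha 0%N = 0.
Hypothesis a_lt1 : forall n, (0 < n)%N -> normc (a n) < 1.
Hypothesis phi0 : forall z, phi 0%N z = 1.
Hypothesis phi_rec : orf_recurrence alpha a phi.
Local Notation C := (borelC R).
Local Notation T := (@unit_circle R).
Implicit Types (z w : R[i]).
Local Notation s := (sal alpha).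
Local Notation psi := (nphi alpha phi).
Local Notation psis := (nphis alpha phi).
Local Notation B := (blaschke alpha).
Local Notation E := (cint (arc R)).
Local Notation fin := (@arc_Tfin R).
Hypothesis phi_nice : forall n, cnice (phi n).
Let npsi n : cnice (psi n) := cnice_psi alpha phi_nice n.
Let npsis n : cnice (psis n) := cnice_psis r_lt1 alpha_le phi_nice n.

(** On the circle [quot] is phi_n / phi_n^*, [bquot] is the inner function b of the overview for
    index n + 1, and |dinv|^2 is the Bernstein-Szego density. *)
Definition quot n z := psi n z / psis n z.
Definition bquot n z := zeta alpha n z * quot n z.
Definition dinv n z := (psis n z)^-1.

(** A zero of psi_(n+1)^* would give |psi_n^*| = |a_(n+1)| |psi_n|, whereas both moduli agree, are
    nonzero by induction, and |a_(n+1)| < 1. *)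
Lemma psis_neq0 n z : T z -> psis n z != 0.
Proof.
move=> Tz; elim: n => [|n IH]; first by rewrite (psis0 alpha0 phi0)// oner_neq0.
apply/eqP => p0; have := psis_rec r_ge0 r_lt1 alpha_le a_lt1 phi_rec n Tz.
rewrite p0 mulr0 => /esym/eqP; rewrite addr_eq0 => /eqP /(congr1 (@normc R)).
rewrite normcN normcM normcJ [normc (zeta _ _ _ * _)]normcM (normc_zeta r_lt1 alpha_le)// mul1r.
rewrite (normc_psis phi r_lt1 alpha_le)// => h.
have p1 : 0 < normc (psi n z) by rewrite -(normc_psis phi r_lt1 alpha_le)// normc_gt0.
have := a_lt1 (ltn0Sn n); nra.
Qed.

Lemma normc_quot n z : T z -> normc (quot n z) = 1.
Proof.
move=> Tz; rewrite /quot normcM normcV -(normc_psis phi r_lt1 alpha_le)// divff//.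
by rewrite normc_eq0 psis_neq0.
Qed.

Lemma normc_bquot n z : T z -> normc (bquot n z) = 1.
Proof. by move=> Tz; rewrite normcM normc_quot// mulr1 (normc_zeta r_lt1 alpha_le). Qed.

(** The sign gives the factor 1 + conj(a) b of the recurrence the form 1 - f of [disk_algebraV]. *)
Let aJb n z := - ((a n.+1)^* * bquot n z).

Lemma normc_aJb n z : T z -> normc (aJb n z) = normc (a n.+1).
Proof. by move=> Tz; rewrite normcN normcM normcJ normc_bquot// mulr1. Qed.

Lemma aJb_neq0 n z : T z -> 1 - aJb n z != 0.
Proof.
move=> Tz; rewrite subr_eq0; apply/eqP => h; have := normc_aJb n Tz.
by rewrite -h normc1 => h1; have := a_lt1 (ltn0Sn n); rewrite -h1 ltxx.
Qed.

Lemma psis_step n z : T z ->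
  (rho a n.+1)%:C%C * psis n.+1 z = psis n z * (1 - aJb n z).
Proof.
move=> Tz; rewrite (psis_rec r_ge0 r_lt1 alpha_le a_lt1 phi_rec)//.
by have := psis_neq0 n Tz; rewrite /aJb /bquot /quot => h; field.
Qed.

(** A step of the inverse Schur algorithm: the Moebius map b -> (b + a) / (1 + conj(a) b) keeps the
    quotient in the disk algebra. *)
Lemma quotS n z : T z -> quot n.+1 z = (bquot n z + a n.+1) * (1 - aJb n z)^-1.
Proof.
move=> Tz; have h1 := psis_neq0 n Tz; have h2 := psis_neq0 n.+1 Tz; have h3 := aJb_neq0 n Tz.
have h4 := rhoC_neq0 a_lt1 (ltn0Sn n).
have key : quot n.+1 z * (psis n z * (1 - aJb n z)) =
    zeta alpha n z * psi n z + a n.+1 * psis n z.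
  rewrite -psis_step// -(psi_rec r_ge0 r_lt1 alpha_le a_lt1 phi_rec)//.
  by rewrite /quot; field.
apply: (mulIf h3); apply: (mulIf h1).
transitivity (zeta alpha n z * psi n z + a n.+1 * psis n z); first by rewrite -key; ring.
by rewrite divfK// /bquot /quot; field.
Qed.

Lemma dinvS n z : T z -> dinv n.+1 z = (rho a n.+1)%:C%C * dinv n z * (1 - aJb n z)^-1.
Proof.
move=> Tz; have h1 := psis_neq0 n Tz; have h2 := psis_neq0 n.+1 Tz; have h3 := aJb_neq0 n Tz.
have h4 := rhoC_neq0 a_lt1 (ltn0Sn n); have := psis_step n Tz.
rewrite /dinv => h; apply: (mulfI (mulf_neq0 h4 h2)).
transitivity ((rho a n.+1)%:C%C : R[i]); first by field.
by rewrite h; field; rewrite h1 h3.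
Qed.

Lemma disk_algebra_zeta n : disk_algebra (zeta alpha n).
Proof.
have Aaz : disk_algebra (fun z => (alpha n)^* * z).
  by apply: disk_algebraM; [exact: disk_algebra_cst|exact: disk_algebra_id].
apply: disk_algebraM.
  by apply: disk_algebraD; [exact: disk_algebra_id|exact: disk_algebra_cst].
apply: (disk_algebraV r_lt1) => // z /unit_circleE z1.
by rewrite normcM normcJ z1 mulr1.
Qed.

Lemma cint_zeta n : E (zeta alpha n) = - alpha n.
Proof.
have Aaz : disk_algebra (fun z => (alpha n)^* * z).
  by apply: disk_algebraM; [exact: disk_algebra_cst|exact: disk_algebra_id].
have azr z : T z -> normc ((alpha n)^* * z) <= r.
  by move=> /unit_circleE z1; rewrite normcM normcJ z1 mulr1.
have := cint_arcV r_lt1 azr Aaz.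
rewrite (cintZ fin); last exact: cnice_id.
rewrite cint_arc_id mulr0 subr0 mul1r => h.
have A1 : disk_algebra (fun z => z + - alpha n).
  by apply: disk_algebraD; [exact: disk_algebra_id|exact: disk_algebra_cst].
rewrite -[RHS]mulr1 -h -[X in X * _](cint_arc_cst (- alpha n)).
rewrite (_ : E (fun=> - alpha n) = E (fun z => z + - alpha n)); last first.
  rewrite (cintD fin); [|exact: cnice_id|exact: cnice_cst].
  by rewrite cint_arc_id add0r.
by rewrite -cint_disk_algebraM//; apply: disk_algebraV r_lt1 azr Aaz.
Qed.

Lemma cmeasurable_quot n : cmeasurable (quot n).
Proof. by apply: cmeasurableM (npsi n).1 _; apply: cmeasurableV (npsis n).1. Qed.

Lemma disk_algebra_quot n : disk_algebra (quot n).
Proof.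
elim: n => [|n IH].
  apply: eq_disk_algebra (disk_algebra_cst 1); first exact: cmeasurable_quot.
  by move=> z Tz; rewrite /quot (psis0 alpha0 phi0)// (psi0 alpha0 phi0) divr1.
have Ab : disk_algebra (bquot n) by apply: disk_algebraM => //; exact: disk_algebra_zeta.
apply: (@eq_disk_algebra _ _ (fun z => (bquot n z + a n.+1) * (1 - aJb n z)^-1)).
- exact: cmeasurable_quot.
- exact: quotS.
apply: disk_algebraM; first by apply: disk_algebraD => //; exact: disk_algebra_cst.
apply: (disk_algebraV (a_lt1 (ltn0Sn n))) => [z Tz|]; first by rewrite normc_aJb.
rewrite /aJb; under eq_fun do rewrite -mulNr; apply: disk_algebraM => //.
exact: disk_algebra_cst.
Qed.

Lemma disk_algebra_bquot n : disk_algebra (bquot n).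
Proof. by apply: disk_algebraM; [exact: disk_algebra_zeta|exact: disk_algebra_quot]. Qed.

Lemma disk_algebra_aJbV n : disk_algebra (fun z => (1 - aJb n z)^-1).
Proof.
apply: (disk_algebraV (a_lt1 (ltn0Sn n))) => [z Tz|]; first by rewrite normc_aJb.
rewrite /aJb; under eq_fun do rewrite -mulNr.
by apply: disk_algebraM; [exact: disk_algebra_cst|exact: disk_algebra_bquot].
Qed.

Lemma disk_algebra_dinv n : disk_algebra (dinv n).
Proof.
elim: n => [|n IH].
  apply: eq_disk_algebra (disk_algebra_cst 1); first exact: cmeasurableV (npsis 0%N).1.
  by move=> z Tz; rewrite /dinv (psis0 alpha0 phi0)// invr1.
apply: (@eq_disk_algebra _ _ (fun z => (rho a n.+1)%:C%C * dinv n z * (1 - aJb n z)^-1)).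
- exact: cmeasurableV (npsis n.+1).1.
- exact: dinvS.
apply: disk_algebraM; last exact: disk_algebra_aJbV.
by apply: disk_algebraM => //; exact: disk_algebra_cst.
Qed.

Lemma disk_algebra_blaschke n : disk_algebra (B n).
Proof.
elim: n => [|n IH].
  by rewrite (_ : B 0%N = fun=> 1); [exact: disk_algebra_cst|apply/funext/blaschke0].
rewrite (_ : B n.+1 = fun z => B n z * zeta alpha n.+1 z); last exact/funext/blaschkeS.
by apply: disk_algebraM => //; exact: disk_algebra_zeta.
Qed.

(** The factor z comes from varpi_n^* = z conj(varpi_n) on the circle; it is what gives mean 0 to
    the correction terms in [nsq_dinv]. *)
Lemma zeta_psiJ n z : T z -> zeta alpha n z * psi n z = z * B n z * (psis n z)^*.
Proof.
move=> Tz; have BB : B n z * (B n z)^* = 1.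
  by rewrite mulcJ (normc_blaschke r_lt1 alpha_le)// expr1n.
have h1 := varpi_neq0 r_lt1 alpha_le n (T_le1 Tz).
rewrite /nphis /nphi !rmorphM /= fmorphV /= conjCK.
have -> : ((s n)%:C%C : R[i])^* = (s n)%:C%C by rewrite conjE conjc_real.
rewrite /zeta varpi_starE//.
transitivity (B n z * (B n z)^* * (z * (varpi alpha n z)^* / (s n)%:C%C * phi n z)); last by ring.
rewrite BB mul1r.
have h3 := salC_neq0 r_ge0 r_lt1 alpha_le n.
by field; rewrite h1 h3.
Qed.

Lemma dinvJ_bquot n z : T z -> (dinv n z)^* * bquot n z = z * B n z * dinv n z.
Proof.
move=> Tz; have h := psis_neq0 n Tz; have h' : (psis n z)^* != 0 by rewrite conjC_eq0.
rewrite /bquot /quot mulrA zeta_psiJ// /dinv fmorphV.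
by field; rewrite h h'.
Qed.

(* The Bernstein-Szego measures |psi_n|^-2 dm all have mass 1: the density is
   multiplied at each step by a Poisson kernel, whose non-constant terms
   integrate to 0. *)
Lemma nsq_dinv n : nsq (arc R) (dinv n) = 1.
Proof.
elim: n => [|n IH].
  rewrite (@eq_nsq _ _ _ (fun=> 1)); last first.
    by move=> z Tz; rewrite /dinv (psis0 alpha0 phi0)// invr1.
  rewrite /nsq (@eq_RI _ _ _ (fun=> 1)) ?RI_arc_cst// => z _.
  by rewrite normc1 expr1n.
have AD := disk_algebra_dinv n; have AD1 := disk_algebra_dinv n.+1.
(* With J = [aJb], rho^2 / |1 - J|^2 = 1 + J / (1 - J) + its conjugate, as |J| = |a|. Y is |dinv|^2
   J / (1 - J), made analytic by [dinvJ_bquot], which absorbs the conjugate of dinv. *)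
pose Y z := z * (B n z * (dinv n z * (dinv n z * (- (a n.+1)^* * (1 - aJb n z)^-1)))).
have AY : disk_algebra (fun z =>
    B n z * (dinv n z * (dinv n z * (- (a n.+1)^* * (1 - aJb n z)^-1)))).
  apply: disk_algebraM; first exact: disk_algebra_blaschke.
  apply: disk_algebraM => //; apply: disk_algebraM => //.
  by apply: disk_algebraM; [exact: disk_algebra_cst|exact: disk_algebra_aJbV].
have Y0 : E Y = 0 by exact: cint_arc_idM.
have nY : cnice Y by apply: cniceM; [exact: cnice_id|exact: AY.1].
apply: complexI; rewrite -(nsqE fin AD1.1).
have DY z : T z -> (dinv n.+1 z)^* * dinv n.+1 z = (dinv n z)^* * dinv n z + Y z + (Y z)^*.
  move=> Tz; rewrite dinvS//.
  have YE : Y z = (dinv n z)^* * dinv n z * (aJb n z * (1 - aJb n z)^-1).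
    transitivity ((z * B n z * dinv n z) * dinv n z * (- (a n.+1)^* * (1 - aJb n z)^-1)).
      by rewrite /Y; ring.
    by rewrite -dinvJ_bquot// /aJb; ring.
  have h3 := aJb_neq0 n Tz; have h3' : 1 - (aJb n z)^* != 0.
    by rewrite -[X in X - _]conjC1 -rmorphB conjC_eq0.
  have cc : aJb n z * (aJb n z)^* = a n.+1 * (a n.+1)^*.
    by rewrite !mulcJ normc_aJb.
  have rhoJ : ((rho a n.+1)%:C%C : R[i])^* = (rho a n.+1)%:C%C by rewrite conjE conjc_real.
  rewrite YE; move: (dinv n z) (aJb n z) h3 h3' cc {YE} => D J h3 h3' cc.
  rewrite !(rmorphM, fmorphV, rmorphB, rmorph1) /= conjCK rhoJ.
  transitivity ((rho a n.+1)%:C%C ^+ 2 * (D^* * D * ((1 - J^*)^-1 * (1 - J)^-1))).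
    by ring.
  rewrite (rhoC_sqr a_lt1)// -cc.
  by field; rewrite h3 h3'.
have nDD : cnice (fun z => (dinv n z)^* * dinv n z).
  by apply: cniceM; [apply: cniceJ|]; exact: AD.1.
have nJ : cnice (fun z => (Y z)^*) by exact: cniceJ.
have nD := cniceD nDD nY.
rewrite (eq_cint _ DY) (cintD fin nD nJ) (cintD fin nDD nY).
by rewrite (cintJ fin nY) [cint _ (fun z => Y z)]Y0 conjC0 !addr0 (nsqE fin AD.1) IH.
Qed.

End SingularPart.

Section SingularCriterion.
Variable R : realType.
Local Notation C := (borelC R).

(** Borel-Cantelli: the limit superior of the complements, for e = 2^-(n+1), is mu-null; its
    complement is a countable union of sets each contained in almost all A_n, hence of arc length
    0. *)
Lemma singular_criterion (mu : probability C R) :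
  (forall e : R, 0 < e -> exists A : set C,
    [/\ measurable A, (mu (~` A) <= e%:E)%E & (arc R A <= e%:E)%E]) ->
  singular mu.
Proof.
move=> H; pose e n : R := 1 / (2 ^ n.+1)%:R.
have e0 n : 0 < e n by rewrite divr_gt0// ltr0n expn_gt0.
have /choice[A AP] : forall n, exists A : set C,
    [/\ measurable A, (mu (~` A) <= (e n)%:E)%E & (arc R A <= (e n)%:E)%E].
  by move=> n; exact: H.
have mA n : measurable (A n) by have [] := AP n.
have mAC n : measurable (~` A n) by exact: measurableC.
pose N := lim_sup_set (fun n => ~` A n).
have mN : measurable N.
  by apply: bigcap_measurable => // k _; exact: bigcup_measurable.
exists N; split=> //.
  apply: lim_sup_set_cvg0 => //.
  apply: (@le_lt_trans _ _ (\sum_(n <oo) (e n)%:E)%E).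
    by apply: lee_nneseries => n _ //; have [] := AP n.
  by apply: le_lt_trans (epsilon_trick0 xpredT ler01) _; rewrite ltry.
apply: arc0_circle_lebesgue; first exact: measurableC.
pose F k := \bigcap_(n in [set n | (k <= n)%N]) A n.
have F0 k : (arc R).-negligible (F k).
  have mF : measurable (F k) by apply: bigcap_measurable => //; exists k => /=.
  apply/negligibleP => //; apply/eqP; rewrite eq_le measure_ge0 andbT.
  apply/lee_addgt0Pr => d d0; rewrite add0e.
  have [n kn ned] : exists2 n, (k <= n)%N & e n <= d.
    have [h0 h1] : 0 <= 1 / 2 :> R /\ 1 / 2 < 1 :> R by split; lra.
    have [K] := geometric_gap h0 h1 d0 ler01; rewrite expr1n mulr1 [_ * _ ^+ K]mul1r => HK.
    exists (maxn k K); first exact: leq_maxl.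
    apply: le_trans (ltW HK).
    have -> : e (maxn k K) = (1 / 2) ^+ (maxn k K).+1 by rewrite /e natrX expr_div_n expr1n.
    by apply: ler_wiXn2l => //; [exact: ltW|rewrite leqW// leq_maxr].
  apply: (@le_trans _ _ (arc R (A n))).
    by apply: le_measure; rewrite ?inE// => z; apply.
  by have [_ _ h] := AP n; apply: le_trans h _; rewrite lee_fin.
apply/negligibleP; first exact: measurableC.
apply: negligibleS (negligible_bigcup F0) => z.
rewrite /N /lim_sup_set setC_bigcap => -[k _]; rewrite setC_bigcup => h.
by exists k => // n kn; have := h n kn; rewrite setCK.
Qed.

(** A limit superior ignores finitely many terms, so the index can be positive; index 0 carries no
    information on a. *)
Lemma limn_esup_frequently (u : nat -> R) (l : R) :
  limn_esup (fun n => (u n)%:E) = l%:E ->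
  forall d, 0 < d -> exists2 n, (0 < n)%N & l - d < u n.
Proof.
move=> ul d d0; apply: contrapT => H.
have u_le n : (0 < n)%N -> u n <= l - d.
  by move=> n0; rewrite leNgt; apply/negP => nd; apply: H; exists n.
have : (limn_esup (fun n => (u n)%:E) <= (l - d)%:E)%E.
  rewrite limn_esup_lim; apply: lime_le; first exact: is_cvg_esups.
  exists 1%N => // n /= n1; apply: ge_ereal_sup => _ [k /= nk <-].
  by rewrite lee_fin u_le// (leq_trans n1).
by rewrite ul lee_fin; lra.
Qed.

End SingularCriterion.

Section SmallSets.
Variables (R : realType) (alpha a : nat -> R[i]) (r : R) (phi : nat -> R[i] -> R[i]).
Hypotheses (r_ge0 : 0 <= r) (r_lt1 : r < 1) (alpha_le : forall n, normc (alpha n) <= r).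
Hypothesis alpha0 : alpha 0%N = 0.
Hypothesis a_lt1 : forall n, (0 < n)%N -> normc (a n) < 1.
Hypothesis phi0 : forall z, phi 0%N z = 1.
Hypothesis phi_rec : orf_recurrence alpha a phi.
Local Notation C := (borelC R).
Local Notation T := (@unit_circle R).
Implicit Types (z w : R[i]).
Local Notation psi := (nphi alpha phi).
Local Notation psis := (nphis alpha phi).
Variable m : {measure set C -> \bar R}.
Hypothesis mTfin : (m (T : set C) < +oo)%E.
Hypothesis mTC : m (~` T : set C) = 0%E.
Hypothesis phi_nice : forall n, cnice (phi n).
Hypothesis phi_orth : forall i j, cint m (fun z => (phi i z)^* * phi j z) = (i == j)%:R.
Hypothesis a_freq : forall d : R, 0 < d -> exists2 n, (0 < n)%N & 1 - d < normc (a n).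
Local Notation C0 := (4 / (1 - r ^+ 2)).
Let npsi n : cnice (psi n) := cnice_psi alpha phi_nice n.
Let npsis n : cnice (psis n) := cnice_psis r_lt1 alpha_le phi_nice n.
Local Notation bq := (bquot alpha phi).
Local Notation fin := (@arc_Tfin R).

(* With tau = a_(n+1) / |a_(n+1)|, the function zeta_n psi_n + tau psi_n^* is
   small in L^2(m), and its modulus is |psi_n| |1 - u| for an inner function u,
   which is small on a set of small arc length only. *)
Lemma small_sets (e : R) : 0 < e -> exists A : set C,
  [/\ measurable A, (m (~` A) <= e%:E)%E & (arc R A <= e%:E)%E].
Proof.
move=> e0; pose k := 1 + 4 * (2 / (1 - r)).
have r1 : 0 < 1 - r by rewrite subr_gt0.
have k0 : 0 < k by rewrite ltr_pwDl// mulr_ge0// divr_ge0// ltW.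
(* The final set has arc length at most d^2 + 4 d * 2 / (1 - r) <= d k. *)
pose d := Num.min (1 / 2) (e / k).
have d0 : 0 < d by rewrite lt_min !divr_gt0.
have d1 : d < 1 by rewrite gt_min; apply/orP; left; lra.
have dk : d * k <= e by rewrite -ler_pdivlMr// ge_min lexx orbT.
have c0 : 0 <= C0 := C0_ge0 r_ge0 r_lt1.
(* As |h|^2 = |psi_n|^2 |1 - u|^2, a value at most d^4 forces one of the two factors to be at most
   d^2. *)
pose th := (d ^+ 2) * (d ^+ 2); have th0 : 0 < th by rewrite mulr_gt0 ?exprn_gt0.
(* When 1 - |a| < et, both rho^2 <= 2 et and (1 - |a|)^2 <= et, so the squared norm of h is at most
   2 (2 et C0) + 2 (et C0) = 6 C0 et. *)
pose et := Num.min (1 / 2) (e * th / (6 * C0 + 1)).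
have c1 : 0 < 6 * C0 + 1 by rewrite ltr_wpDl// mulr_ge0.
have et0 : 0 < et by rewrite lt_min !divr_gt0// mulr_gt0.
have etc : 6 * C0 * et <= e * th.
  have : et * (6 * C0 + 1) <= e * th.
    by rewrite -ler_pdivlMr// ge_min lexx orbT.
  have := ltW et0; lra.
have et1 : et <= 1 / 2 by rewrite ge_min lexx.
have [[//|n] _ an] := a_freq et0.
have an1 := a_lt1 (ltn0Sn n); have an0 : 0 < normc (a n.+1) by lra.
pose t := a n.+1 / (normc (a n.+1))%:C%C.
have nC : (normc (a n.+1))%:C%C != 0 :> R[i] by rewrite -normc_eq0 normc_real normr_eq0 gt_eqF.
have t1 : normc t = 1.
  by rewrite normcM normcV normc_real ger0_norm ?normc_ge0// divff// gt_eqF.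
have ta : normc (t - a n.+1) = 1 - normc (a n.+1).
  rewrite (_ : t - a n.+1 = t * (1 - normc (a n.+1))%:C%C); last first.
    by rewrite /t rmorphB rmorph1; field.
  by rewrite normcM t1 mul1r normc_real ger0_norm// subr_ge0 ltW.
pose h z := zeta alpha n z * psi n z + t * psis n z.
have nh : cnice h.
  apply: cniceD; last exact: cniceZ.
  by apply: cniceM => //; exact: (cnice_zeta r_lt1 alpha_le).
have nsqh : nsq m h <= th * e.
  pose g1 z := (rho a n.+1)%:C%C * psi n.+1 z; pose g2 z := (t - a n.+1) * psis n z.
  have [n1 n2] : cnice g1 /\ cnice g2 by split; exact: cniceZ.
  rewrite (@eq_nsq _ _ _ (fun z => g1 z + g2 z)); last first.
    move=> z Tz; rewrite /h (zeta_psi r_ge0 r_lt1 alpha_le a_lt1 phi_rec)// /g1 /g2; ring.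
  rewrite (le_trans (nsqD mTfin n1 n2))// !nsqZ// ta normc_real.
  rewrite real_normK ?num_real// (rho_sqr a_lt1)//.
  have p1 := nsq_psi r_ge0 r_lt1 alpha_le mTfin phi_nice phi_orth n.+1.
  have p2 := nsq_psis r_ge0 r_lt1 alpha_le mTfin phi_nice phi_orth n.
  have q1 := nsq_ge0 m (psi n.+1); have q2 := nsq_ge0 m (psis n).
  rewrite [th * e]mulrC; apply: le_trans etc.
  set x := normc (a n.+1) in an an1 an0 *.
  have y1 : (1 - x ^+ 2) * nsq m (psi n.+1) <= (2 * et) * C0.
    by apply: ler_pM => //; nra.
  have y2 : (1 - x) ^+ 2 * nsq m (psis n) <= et * C0.
    by apply: ler_pM => //; [exact: sqr_ge0|nra].
  rewrite (_ : 6 * C0 * et = 2 * (2 * et * C0) + 2 * (et * C0)); last by ring.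
  by apply: lerD; rewrite ler_pM2l.
have mA : measurable (sublevel h th) by apply: measurable_sublevel; exact: nh.1.
exists (sublevel h th); split=> //.
  have mAC : measurable (~` sublevel h th) by exact: measurableC.
  apply: le_trans (measure_setI_circle mTC mAC) _.
  apply: (@sublevel_markov _ _ h th) => // z Tz /negP; rewrite -ltNge => /ltW.
  by [].
pose u z := - t^* * bq n z.
have Au : disk_algebra u.
  apply: disk_algebraM; first exact: disk_algebra_cst.
  exact: (disk_algebra_bquot r_ge0 r_lt1 alpha_le alpha0 a_lt1 phi0 phi_rec phi_nice).
have u1 z : T z -> normc (u z) = 1.
  move=> Tz; rewrite /u normcM normcN normcJ t1 mul1r.
  exact: (normc_bquot r_ge0 r_lt1 alpha_le alpha0 a_lt1 phi0 phi_rec).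
(* The mean of u is, up to a unimodular factor, that of zeta_n, equal to -alpha_n, times that of the
   quotient, of modulus at most 1. *)
have Eu : normc (cint (arc R) u) <= r.
  have Aq := disk_algebra_quot r_ge0 r_lt1 alpha_le alpha0 a_lt1 phi0 phi_rec phi_nice n.
  have Ab := disk_algebra_bquot r_ge0 r_lt1 alpha_le alpha0 a_lt1 phi0 phi_rec phi_nice n.
  rewrite (cintZ fin _ Ab.1) normcM normcN normcJ t1 mul1r.
  rewrite (cint_disk_algebraM (disk_algebra_zeta r_lt1 alpha_le n) Aq).
  rewrite (cint_zeta r_lt1 alpha_le) normcM normcN -[leRHS]mulr1.
  apply: ler_pM; rewrite ?normc_ge0//; apply: normc_cint_arc => [|z Tz]; first exact: Aq.1.
  by rewrite (normc_quot r_ge0 r_lt1 alpha_le alpha0 a_lt1 phi0 phi_rec).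
have hE z : T z -> normc (h z) ^+ 2 = normc (psi n z) ^+ 2 * normc (1 - u z) ^+ 2.
  move=> Tz; rewrite -exprMn; congr (_ ^+ 2).
  rewrite -(normc_psis phi r_lt1 alpha_le n Tz) -normcM -[LHS]mul1r -t1 -normcJ -normcM.
  have p0 := psis_neq0 r_ge0 r_lt1 alpha_le alpha0 a_lt1 phi0 phi_rec n Tz.
  have tt : t * t^* = 1 by rewrite mulcJ t1 expr1n.
  congr normc; rewrite /u /h /bquot /quot.
  transitivity (t^* * (zeta alpha n z * psi n z) + t * t^* * psis n z); first by ring.
  by rewrite tt; field.
pose S1 := ~` sublevel (dinv alpha phi n) (d ^+ 2)^-1; pose S1' := sublevel (psi n) (d ^+ 2).
pose S2 := sublevel (fun z => 1 - u z) (d ^+ 2).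
have mS1 : measurable S1' by apply: measurable_sublevel; exact: (npsi n).1.
have mS2 : measurable S2.
  by apply: measurable_sublevel; apply: (cniceB (cnice_cst 1) Au.1).1.
have mT : measurable (T : set C) := @measurable_unit_circle R.
have mS1T : measurable (S1' `&` T) by exact: measurableI.
have mS2T : measurable (S2 `&` T) by exact: measurableI.
apply: le_trans (measure_setI_circle (arc_TC R) mA) _.
apply: (@le_trans _ _ (arc R ((S1' `&` T) `|` (S2 `&` T)))).
  apply: le_measure; rewrite ?inE//; [exact: measurableI|exact: measurableU|].
  move=> z [hz Tz]; have [z1|z1] := pselect (S1' z); first by left.
  right; split=> //; move: hz; rewrite /S2 /sublevel /= hE// => hz.
  move: z1; rewrite /S1' /sublevel /= => /negP; rewrite -ltNge => z1.
  rewrite leNgt; apply/negP => z2; move: hz; rewrite leNgt /th => /negP; apply.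
  by apply: ltr_pM => //; exact: exprn_ge0 (ltW d0).
have : (arc R ((S1' `&` T) `|` (S2 `&` T)) <= arc R (S1' `&` T) + arc R (S2 `&` T))%E.
  exact: measureU2.
move=> /le_trans; apply.
have D1 := nsq_dinv r_ge0 r_lt1 alpha_le alpha0 a_lt1 phi0 phi_rec phi_nice n.
have AD := disk_algebra_dinv r_ge0 r_lt1 alpha_le alpha0 a_lt1 phi0 phi_rec phi_nice n.
(* Markov's inequality for |psi_n^*|^-2, of mean 1 for arc length. *)
have s1 : (arc R (S1' `&` T) <= (d ^+ 2)%:E)%E.
  have d2 : 0 < d ^+ 2 by rewrite exprn_gt0.
  apply: (@sublevel_markov _ _ (dinv alpha phi n) (d ^+ 2)^-1) => //.
  - exact: fin.
  - by rewrite invr_gt0.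
  - exact: AD.1.
  - move=> z Tz; rewrite /S1' /sublevel /dinv /= => z1.
    rewrite normcV exprVn (normc_psis phi r_lt1 alpha_le n Tz) lef_pV2 ?posrE//.
    rewrite exprn_gt0// -(normc_psis phi r_lt1 alpha_le n Tz) normc_gt0.
    exact: (psis_neq0 r_ge0 r_lt1 alpha_le alpha0 a_lt1 phi0 phi_rec).
  - by rewrite D1 mulVf// gt_eqF.
have s2 := arc_sublevel Au u1 Eu r_lt1 d0 d1.
apply: le_trans (leeD s1 s2) _; rewrite -EFinD lee_fin; apply: le_trans dk.
rewrite /k mulrDr mulr1 [d * (4 * _)]mulrA [d * 4]mulrC lerD2r expr2.
by rewrite ler_piMr ?ltW.
Qed.

End SmallSets.

Theorem theorem6p3 (R : realType) (alpha a : nat -> R[i])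
    (halpha0 : alpha 0%N = 0)
    (halpha : compactly_in_disk alpha)
    (ha : forall n, (0 < n)%N -> `|a n| < 1)
    (mu : probability (borelC R) R)
    (hmu : circle_measure mu)
    (hS : orf_parameters alpha mu a) :
  [/\ (a n : R[i]^o) @[n --> \oo] --> (0 : R[i]^o) ->
        supp mu = @unit_circle R,
      normc (a n) @[n --> \oo] --> (1 : R) ->
        limit_point (supp mu) =
        seq_limit_points
          (fun n => zeta_inv alpha n (- (a n)^* * a n.+1) : R[i]^o)
    & limn_esup (fun n => (normc (a n))%:E) = 1%E ->
        singular mu].
Proof.
have [r r_lt1 r_ub] := halpha.
have r_ge0 : 0 <= r by exact: le_trans (normc_ge0 _) (r_ub 1%N isT).
have alpha_le n : normc (alpha n) <= r.
  by case: n => [|n]; [rewrite halpha0 normc0|exact: r_ub].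
have a_lt1 n : (0 < n)%N -> normc (a n) < 1.
  by move=> /ha; rewrite normcE -(rmorph1 (real_complex R)) ltcR.
have [muT _] := hmu; have [_ [phi [[phi_B phi_inner] phi0 phi_rec]]] := hS.
have muTfin : (mu (@unit_circle R : set (borelC R)) < +oo)%E by rewrite muT ltry.
have muTC : mu (~` @unit_circle R : set (borelC R)) = 0%E.
  by rewrite probability_setC ?muT ?subee//; exact: measurable_unit_circle.
have phi_nice n : cnice (phi n).
  have [c phic] := phi_B n.
  rewrite (_ : phi n = fun z => \sum_(k < n.+1) c k * blaschke alpha k z); last first.
    by apply/funext => z; rewrite phic big_mkord.
  apply: (@cnice_sum _ n.+1 (fun k z => c k * blaschke alpha k z)) => k.
  by apply: cniceZ; exact: (cnice_blaschke r_lt1 alpha_le).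
have phi_span n : lspan (blaschke alpha) n.+1 (phi n).
  by have [c phic] := phi_B n; exists c => z _; rewrite phic big_mkord.
have phi_orth i j : cint mu (fun z => (phi i z)^* * phi j z) = (i == j)%:R.
  exact: phi_inner.
split=> [a0|a1|a_sup].
- apply/seteqP; split; first exact: supp_subset_circle muTC.
  move=> z Tz; apply: contrapT => /not_supp_disc[e e0 ze].
  apply: (no_gap r_ge0 r_lt1 alpha_le a_lt1 phi_rec muTfin phi_nice phi_orth _ Tz e0 ze).
  move=> d d0; have [N _ Na] := (cvgCP a 0).1 a0 d d0.
  by exists N => n /Na; rewrite sub0r normcN.
- have rho_to0 d : 0 < d -> exists N, forall n, (N <= n)%N -> rho a n ^+ 2 <= d.
    move=> d0; have d2 : 0 < d / 2 by rewrite divr_gt0.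
    have /cvgrPdist_lt /(_ _ d2) [N _ Na] := a1.
    (* The successor excludes the index 0; d / 2 is used because 1 - |a|^2 <= 2 (1 - |a|). *)
    exists N.+1 => n Nn; have n0 : (0 < n)%N by exact: leq_trans Nn.
    have := Na n (ltnW Nn); rewrite (rho_sqr a_lt1)//.
    have an := a_lt1 n n0; have an0 := normc_ge0 (a n).
    rewrite ger0_norm ?subr_ge0 ?(ltW an)//; nra.
  apply/seteqP; split=> l.
    exact: (limit_point_is_eigenvalue_limit r_ge0 r_lt1 alpha_le a_lt1 phi_rec muTfin muTC
      phi_nice phi_orth phi_span rho_to0).
  exact: (limit_eigenvalue_in_limit_point r_ge0 r_lt1 alpha_le a_lt1 phi_rec muTfin
      phi_nice phi_orth rho_to0).
- apply: singular_criterion => e e0.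
  exact: (small_sets r_ge0 r_lt1 alpha_le halpha0 a_lt1 phi0 phi_rec muTfin muTC phi_nice
    phi_orth (limn_esup_frequently a_sup)).
Qed.
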